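(* Let $p>4$ and let $q$ be defined by $\frac2p+\frac1q=1$. Let $E\subset\mathbb{R}$ be a compact set whose equilibrium measure is absolutely continuous (with respect to Lebesgue measure) with density function $\omega_E\in L^{q}(\mathbb{R})$. Let $f\in L^{p}(\mathbb{R})$ (possibly complex-valued) be supported in $E$. Then $$\int_{E}|f(y)|^{2}\,\omega_E(y)\,dy=\int_{E}|\tilde f(y)|^{2}\,\omega_E(y)\,dy$$ and $$\int_{E}|f(y)|^{2}\,\omega_E(y)\,y\,dy=\int_{E}|\tilde f(y)|^{2}\,\omega_E(y)\,y\,dy,$$ where $\tilde f$ is the Hilbert transform of $f$.
   Context: The Hilbert transform of $f\in L^{p}(\mathbb{R})$, $1\le p<\infty$, is $\tilde f(x)=Hf(x)=\frac{1}{\pi}\,\mathrm{p.v.}\int_{-\infty}^{\infty}\frac{f(t)}{x-t}\,dt$ (defined for a.e. $x$). The equilibrium measure of a compact set $E\subset\mathbb{R}$ is the unique minimizer of the logarithmic energy $I(\mu)=\iint\ln\frac{1}{|x-t|}\,d\mu(x)\,d\mu(t)$ among all Borel probability measures $\mu$ supported in $E$ (for this to be defined, $E$ has positive logarithmic capacity); $\omega_E$ denotes its density, extended by $0$ outside $E$. *)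

(* Defs.v *)
From HB Require Import structures.
From mathcomp Require Export all_boot all_order all_algebra.
From mathcomp Require Export all_classical all_reals all_analysis.
From mathcomp Require Export complex.

Set Implicit Arguments.
Unset Strict Implicit.
Unset Printing Implicit Defensive.

Export Order.TTheory GRing.Theory Num.Theory.
Export numFieldNormedType.Exports.

Global Open Scope classical_set_scope.
Global Open Scope ring_scope.

Section LogarithmicEnergy.
Context {R : realType}.
Local Open Scope ereal_scope.

(* [E] is closed in all uses, so that [mu (~` E) = 0] says that the closed
   support of [mu] is included in [E]. *)
Definition supported_in (E : set R) (mu : probability (measurableTypeR R) R) :=
  mu (~` E) = 0.

(* The kernel is [ln (1 / `|x - t|)], with value [+oo] on the diagonal; this
   is why it is written with the extended logarithm [lne] ([lne 0 = -oo])
   rather than with [ln] or with the real inverse, which are total with junk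
   values at 0. The kernel is bounded below on the square of a compact set,
   so the iterated integral makes sense in ]-oo, +oo] there. *)
Definition log_energy (mu : probability (measurableTypeR R) R) : \bar R :=
  \int[mu]_x \int[mu]_t (- lne (`|x - t|%R)%:E).

Definition log_capacity (E : set R) : \bar R :=
  expeR (- ereal_inf [set log_energy mu | mu in supported_in E]).

(* When the capacity is positive there is exactly one such measure
   if [E] is compact. *)
Definition equilibrium_measure (E : set R)
    (mu : probability (measurableTypeR R) R) :=
  [/\ 0 < log_capacity E, supported_in E mu
    & forall nu : probability (measurableTypeR R) R,
        supported_in E nu -> log_energy mu <= log_energy nu].

(* The last clause is the convention that the density vanishes off [E]. *)
Definition equilibrium_density (E : set R) (w : R -> R) :=
  exists mu : probability (measurableTypeR R) R,
  [/\ equilibrium_measure E mu,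
      measurable_fun [set: measurableTypeR R] w,
      (forall x, 0 <= w x)%R,
      (forall A : set (measurableTypeR R), measurable A ->
         mu A = \int[lebesgue_measure]_(x in A) (w x)%:E)
    & forall x, ~ E x -> w x = 0%R].

End LogarithmicEnergy.

Section HilbertTransform.
Context {R : realType}.

Definition trunc_hilbert (f : R -> R) (e x : R) : R :=
  pi^-1 * \int[lebesgue_measure]_(t in [set t | e < `|x - t|]) (f t / (x - t)).

Definition hilbert (f : R -> R) (x : R) : R :=
  lim (trunc_hilbert f e x @[e --> 0^'+]).

(* Integrals of complex-valued functions are taken componentwise. *)
Definition hilbertC (f : R -> R[i]) (x : R) : R[i] :=
  Complex (hilbert (fun t => complex.Re (f t)) x)
          (hilbert (fun t => complex.Im (f t)) x).

(* The real-valued modulus on [R[i]]; the norm [`|z|] of the library lives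
   in [R[i]]. *)
Definition cmod (z : R[i]) : R := ComplexField.Normc.normc z.

Definition LfunC (p : \bar R) (f : R -> R[i]) :=
  [/\ measurable_fun [set: measurableTypeR R] (fun x => complex.Re (f x)),
      measurable_fun [set: measurableTypeR R] (fun x => complex.Im (f x))
    & finite_norm lebesgue_measure p
        ((fun x => cmod (f x)) : measurableTypeR R -> R)].

End HilbertTransform.

(* Main.v *)
(* Smooth the Hilbert transform to convolution Q_e with u / (pi (u^2 + e^2)), and
   let P_e be the Poisson kernel. For bounded compactly supported f, partial
   fractions give (Q_e f)^2 - 2 Q_e (f Q_e f) = R_e, where R_e is bounded and tends
   to f^2 at every Lebesgue point of f. Integrated, this bounds Q_e on L^(2^k) by
   induction on k, as in M. Riesz's theorem; since the density w lies in L^q with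
   q > 1, it also makes every limit below legitimate under the integral against w.
   The identity for f then follows from the fact that int (Q_e phi) w -> 0 for
   bounded phi supported in E, because phi may be taken to be f Q_e f. That fact is
   where the equilibrium property enters: the logarithmic potential U of w is
   constant a.e. on E (U >= c a.e. on E by varying the energy, U <= c because the set
   U <= c is closed and the kernel is convex across its gaps), and averaging phi over
   intervals of length h turns Q_e phi into differences U (t + h) - U (t), which
   vanish when t and t + h are both in E. The second identity follows in the same way
   from y Q_e phi (y) = Q_e (t phi) (y) + (1/pi) int phi - e P_e phi (y) and
   int f Q_e f = 0. Truncation and Fatou's lemma extend both identities to
   f in L^2(w), which contains L^p(E) by Young's inequality. *)

(* The density lies in [L^q] with [1 < q < 2], and [q] may be arbitrarily close to 1, so the
   estimates must be paid for by the other factor: [Qo e f] is controlled in [L^(2^k)], uniformly in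
   [e], with [2 ^ k] at least the exponent conjugate to [q]. Exponents are powers of 2 because
   Tricomi's identity is quadratic, so each use of it doubles the exponent. The smoothing keeps the
   kernels bounded, which makes exchanges of integrals absolutely convergent; the addition laws of
   the two kernels take the place of the Fourier transform; and [Po e] is a probability average, so
   Jensen's inequality makes it a contraction in the norms that occur. Two limits compete in the
   integral of [Q_e (f Q_e f)] against the density: the vanishing result concerns a fixed bounded
   function, whereas [f Q_e f] changes with [e] and has no evident uniform bound. The inner
   parameter is therefore frozen first, at the price of an error that is small in [L^(2^k)] whatever
   the outer parameter is. *)
From HB Require Import structures.
Require Import Defs.
From mathcomp Require Import measurable_realfun lra ring zify.

Set Implicit Arguments.
Unset Strict Implicit.
Unset Printing Implicit Defensive.

(** * Real-valued Lebesgue integrals *)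

Section Tools.
Context {R : realType}.
Notation mu := (@lebesgue_measure R).
Implicit Types (f g h : R -> R).

Lemma aeS (P Q : R -> Prop) : (forall x, P x -> Q x) ->
  {ae mu, forall x, P x} -> {ae mu, forall x, Q x}.
Proof. by move=> PQ; apply: (@filterS _ _ (ae_filter_ringOfSetsType mu)). Qed.

Lemma aeS2 (P P' Q : R -> Prop) : (forall x, P x -> P' x -> Q x) ->
  {ae mu, forall x, P x} -> {ae mu, forall x, P' x} -> {ae mu, forall x, Q x}.
Proof. by move=> PQ; apply: (@filterS2 _ _ (ae_filter_ringOfSetsType mu)). Qed.

Lemma aeT (P : R -> Prop) : (forall x, P x) -> {ae mu, forall x, P x}.
Proof. by move=> PT; apply: (@nearW _ _ _ (ae_filter_ringOfSetsType mu)). Qed.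

Definition itg f : Prop := mu.-integrable [set: R] (EFin \o f).
Definition Int f : R := \int[mu]_x f x.

Lemma itg_meas f : itg f -> measurable_fun [set: R] f.
Proof. by move=> /integrableP[/measurable_EFinP]. Qed.

Lemma itgD f g : itg f -> itg g -> itg (fun x => f x + g x).
Proof. by move=> fi gi; exact: (@integrableD _ _ _ mu _ measurableT _ _ fi gi). Qed.

Lemma itgB f g : itg f -> itg g -> itg (fun x => f x - g x).
Proof. by move=> fi gi; exact: (@integrableB _ _ _ mu _ measurableT _ _ fi gi). Qed.

Lemma itgZ (k : R) f : itg f -> itg (fun x => k * f x).
Proof. by move=> fi; exact: (@integrableZl _ _ _ mu _ measurableT k _ fi). Qed.

Lemma itg_le f g : measurable_fun [set: R] f -> itg g ->
  (forall x, `|f x| <= g x) -> itg f.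
Proof.
move=> mf gi fg; apply: (@le_integrable _ _ _ mu _ measurableT _ _ _ _ gi).
  exact/measurable_EFinP.
by move=> x _ /=; rewrite lee_fin (le_trans (fg x))// ler_norm.
Qed.

Lemma itg_abs f : itg f -> itg (fun x => `|f x|).
Proof. by move=> fi; apply: (integrable_norm fi). Qed.

Lemma IntD f g : itg f -> itg g -> Int (fun x => f x + g x) = Int f + Int g.
Proof. by move=> fi gi; exact: (@RintegralD _ _ _ mu _ _ _ measurableT fi gi). Qed.

Lemma IntB f g : itg f -> itg g -> Int (fun x => f x - g x) = Int f - Int g.
Proof. by move=> fi gi; exact: (@RintegralB _ _ _ mu _ _ _ measurableT fi gi). Qed.

Lemma IntZ (k : R) f : itg f -> Int (fun x => k * f x) = k * Int f.
Proof. by move=> fi; exact: (@RintegralZl _ _ _ mu _ _ k measurableT fi). Qed.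

Lemma Int0 : Int (fun=> 0) = 0.
Proof. by rewrite /Int /Rintegral integral0. Qed.

Lemma Int_le f g : itg f -> itg g -> (forall x, f x <= g x) -> Int f <= Int g.
Proof. by move=> fi gi fg; apply: le_Rintegral. Qed.

Lemma Int_ge0 f : (forall x, 0 <= f x) -> 0 <= Int f.
Proof. by move=> f0; apply: Rintegral_ge0. Qed.

Lemma Int_abs f : itg f -> `|Int f| <= Int (fun x => `|f x|).
Proof. by move=> fi; apply: le_normr_Rintegral. Qed.

Lemma Int_absle f g : itg f -> itg g -> (forall x, `|f x| <= g x) ->
  `|Int f| <= Int g.
Proof.
move=> fi gi fg; apply: (le_trans (Int_abs fi)).
by apply: Int_le => //; exact: itg_abs.
Qed.

Lemma eq_Int f g : f =1 g -> Int f = Int g.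
Proof. by move=> fg; congr Int; apply/funext. Qed.

Lemma IntE f : itg f -> (\int[mu]_x (f x)%:E)%E = (Int f)%:E.
Proof. by move=> fi; rewrite /Int /Rintegral fineK//; apply: integrable_fin_num. Qed.

Lemma ae_Int f g : measurable_fun [set: R] f -> measurable_fun [set: R] g ->
  {ae mu, forall x, f x = g x} -> Int f = Int g.
Proof.
move=> mf mg fg; congr fine; apply: ae_eq_integral => //.
- exact/measurable_EFinP.
- exact/measurable_EFinP.
- by apply: aeS fg => x /= fgx _; rewrite fgx.
Qed.

Lemma ge0_itg f : measurable_fun [set: R] f -> (forall x, 0 <= f x) ->
  (\int[mu]_x (f x)%:E < +oo)%E -> itg f.
Proof.
move=> mf f0 foo; apply/integrableP; split; first exact/measurable_EFinP.
by under eq_integral do rewrite /= ger0_norm//.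
Qed.

Lemma itg_lty f : itg f -> (\int[mu]_x `|f x|%:E < +oo)%E.
Proof. by move=> /integrableP[]. Qed.

Lemma ae_itg_le f g : measurable_fun [set: R] f -> itg g ->
  {ae mu, forall x, `|f x| <= g x} -> itg f.
Proof.
move=> mf gi fg; apply/integrableP; split; first exact/measurable_EFinP.
apply: le_lt_trans (itg_lty gi); apply: ae_ge0_le_integral => //.
- by do 2!apply: measurableT_comp => //; exact/measurable_EFinP.
- by apply/measurable_EFinP; apply: measurableT_comp => //; exact: itg_meas.
- by apply: aeS fg => x fgx _ /=; rewrite lee_fin (le_trans fgx)// ler_norm.
Qed.

Lemma ae_Int_le f g : itg f -> itg g -> {ae mu, forall x, f x <= g x} ->
  Int f <= Int g.
Proof.
move=> fi gi fg; rewrite -subr_ge0 -IntB//.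
have -> : Int (fun x => g x - f x) = Int (fun x => `|g x - f x|).
  apply: ae_Int; first exact: itg_meas (itgB gi fi).
  - by apply: itg_meas; apply: itg_abs; exact: itgB.
  - by apply: aeS fg => x fgx; rewrite ger0_norm// subr_ge0.
exact: Int_ge0.
Qed.

Lemma Int_eq0_ae f : itg f -> (forall x, 0 <= f x) -> Int f = 0 ->
  {ae mu, forall x, f x = 0}.
Proof.
move=> fi f0 If; have : (\int[mu]_x `|(f x)%:E| = 0)%E.
  under eq_integral do rewrite gee0_abs ?lee_fin//.
  by rewrite IntE// If.
have mf : measurable_fun [set: R] (EFin \o f).
  by apply/measurable_EFinP; exact: itg_meas.
move=> /(ae_eq_integral_abs mu (@measurableT _ _) mf).
by apply: aeS => x /(_ I)[].
Qed.

(** Every section is assumed integrable, not just almost every one, so that [Int] of a section is at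
    each point the genuine extended-real integral. *)
Lemma Fub (G : R -> R -> R) :
  measurable_fun [set: R * R] (fun z => G z.1 z.2) ->
  (forall x, itg (G x)) -> (forall y, itg (G^~ y)) ->
  itg (fun x => Int (fun y => `|G x y|)) ->
  [/\ itg (fun x => Int (G x)), itg (fun y => Int (G^~ y)),
      itg (fun y => Int (fun x => `|G x y|)) &
      Int (fun x => Int (G x)) = Int (fun y => Int (G^~ y))].
Proof.
move=> mG Gx Gy GG.
pose H (z : R * R) := (G z.1 z.2)%:E.
have mH : measurable_fun setT H by apply/measurable_EFinP.
have oo : (\int[mu]_x \int[mu]_y `|H (x, y)| < +oo)%E.
  have := itg_lty GG; congr (_ < _)%E; apply: eq_integral => x _.
  rewrite ger0_norm; last exact: Int_ge0.
  by rewrite -IntE//; exact: itg_abs.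
have HI : (mu \x mu)%E.-integrable setT H by apply/integrable12ltyP.
have FI := integrable_fubini_F HI.
have GI := Fubini HI.
have E1 x : (\int[mu]_y H (x, y))%E = (Int (G x))%:E by rewrite -IntE.
have E2 y : (\int[mu]_x H (x, y))%E = (Int (G^~ y))%:E by rewrite -IntE.
have i1 : itg (fun x => Int (G x)).
  by move: FI; congr (_.-integrable _ _); apply/funext => x; exact: E1.
have i3 : itg (fun y => Int (fun x => `|G x y|)).
  apply: ge0_itg; last 2 first.
  - by move=> x; exact: Int_ge0.
  - have := (integrable21ltyP mu mu mH).1 HI; congr (_ < _)%E.
    by apply: eq_integral => y _; rewrite -IntE//; exact: itg_abs.
  apply/measurable_EFinP.
  have : measurable_fun setT (fubini_G mu (fun z : R * R => `|G z.1 z.2|%:E)).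
    apply: measurable_fun_fubini_tonelli_G => //.
    by apply/measurable_EFinP; exact: measurableT_comp.
  congr measurable_fun; apply/funext => y; rewrite /fubini_G/= -IntE//; exact: itg_abs.
have i2 : itg (fun y => Int (G^~ y)).
  apply: itg_le i3 _.
    apply/measurable_EFinP; have := measurable_fubini_G HI.
    by congr measurable_fun; apply/funext => y; exact: E2.
  by move=> y; exact: Int_abs.
split => //.
apply: EFin_inj; rewrite -!IntE//.
under eq_integral do rewrite -E1.
by under [RHS]eq_integral do rewrite -E2.
Qed.

(** A product majorant settles the integrability of all sections and of the double integral at once;
    nearly every exchange of integrals below is justified this way. *)
Lemma FubM (G : R -> R -> R) a b :
  measurable_fun [set: R * R] (fun z => G z.1 z.2) -> itg a -> itg b ->
  (forall x, 0 <= a x) -> (forall x y, `|G x y| <= a x * b y) ->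
  [/\ forall x, itg (G x), forall y, itg (G^~ y),
      itg (fun x => Int (G x)), itg (fun y => Int (G^~ y)) &
      Int (fun x => Int (G x)) = Int (fun y => Int (G^~ y))].
Proof.
move=> mG ai bi a0 Gab.
have Gx x : itg (G x).
  apply: itg_le (itgZ (a x) bi) _ => //.
  exact: (measurableT_comp mG (pair1_measurable x)).
have Gy y : itg (G^~ y).
  apply: itg_le (itgZ (b y) ai) _ => //.
    exact: (measurableT_comp mG (pair2_measurable y)).
  by move=> x; rewrite mulrC.
have GG : itg (fun x => Int (fun y => `|G x y|)).
  apply: (@itg_le _ (fun x => Int b * a x)).
  - apply/measurable_EFinP.
    have : measurable_fun setT (fubini_F mu (fun z : R * R => `|G z.1 z.2|%:E)).
      apply: measurable_fun_fubini_tonelli_F => //.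
      by apply/measurable_EFinP; exact: measurableT_comp.
    by congr measurable_fun; apply/funext => x; rewrite /fubini_F/= -IntE//; exact: itg_abs.
  - exact: itgZ.
  - move=> x; rewrite ger0_norm; last exact: Int_ge0.
    rewrite mulrC -IntZ//.
    by apply: Int_le => //; [exact: itg_abs|exact: itgZ].
by have [? ? _ ?] := Fub mG Gx Gy GG.
Qed.

Lemma DCT (F : nat -> R -> R) f g :
  (forall n, measurable_fun [set: R] (F n)) -> measurable_fun [set: R] f ->
  itg g -> {ae mu, forall x, F ^~ x @ \oo --> f x} ->
  (forall n, {ae mu, forall x, `|F n x| <= g x}) ->
  itg f /\ (Int (F n) @[n --> \oo] --> Int f).
Proof.
move=> mF mf gi Ff Fg.
have Fi n : itg (F n) by exact: ae_itg_le (Fg n).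
have Fg' : {ae mu, forall x n, `|F n x| <= g x}.
  exact/ae_foralln.
have fi : itg f.
  apply: ae_itg_le mf gi _; apply: aeS2 Ff Fg' => x Fx Gx.
  rewrite -(cvg_lim (@Rhausdorff R) (cvg_norm Fx)); apply: limr_le.
    by apply/cvg_ex; exists `|f x|; exact: cvg_norm.
  exact: nearW.
have FE : {ae mu, forall x, [set: R] x -> (F n x)%:E @[n --> \oo] --> (f x)%:E}.
  by apply: aeS Ff => x Fx _; apply: cvg_EFin => //; exact: nearW.
have FgE : {ae mu, forall x n, [set: R] x -> (`|(F n x)%:E| <= (g x)%:E)%E}.
  by apply: aeS Fg' => x Fx n _; rewrite lee_fin.
have [_ _ cv] := @dominated_convergence _ _ _ mu _ (@measurableT _ _)
  (fun n => EFin \o F n) (EFin \o f) (EFin \o g)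
  (fun n => (measurable_EFinP _ _).2 (mF n)) ((measurable_EFinP _ _).2 mf)
  FE gi FgE.
split => //.
rewrite (IntE fi) in cv.
exact: (fine_cvg cv).
Qed.

(** Besides the bound, this delivers the integrability of the limit, which is how limits of smoothed
    transforms are shown to be square integrable. *)
Lemma Fatou_Int (F : nat -> R -> R) f (M : R) :
  (forall n, itg (F n)) -> (forall n x, 0 <= F n x) ->
  measurable_fun [set: R] f -> (forall x, 0 <= f x) ->
  {ae mu, forall x, F ^~ x @ \oo --> f x} ->
  (forall n, Int (F n) <= M) -> itg f /\ Int f <= M.
Proof.
move=> Fi F0 mf f0 Ff FM.
have le : (\int[mu]_x (f x)%:E <= M%:E)%E.
  apply: (@le_trans _ _ (\int[mu]_x limn_einf (fun n => (F n x)%:E))%E); last first.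
    apply: (@le_trans _ _ (limn_einf (fun n => \int[mu]_x (F n x)%:E))%E).
      apply: fatou => //; first by move=> n; apply/measurable_EFinP; exact: itg_meas.
      by move=> n x _; rewrite lee_fin.
    rewrite limn_einf_lim; apply: lime_le; first exact: is_cvg_einfs.
    apply: nearW => n; apply: (@le_trans _ _ (\int[mu]_x (F n x)%:E)%E).
      by apply: ereal_inf_lbound; exists n => /=.
    by rewrite IntE// lee_fin.
  apply: ae_ge0_le_integral => //.
  - by move=> x _; rewrite lee_fin.
  - exact/measurable_EFinP.
  - move=> x _; rewrite limn_einf_lim; apply: lime_ge; first exact: is_cvg_einfs.
    apply: nearW => n; apply: le_ereal_inf_tmp => _ [k _ <-].
    by rewrite lee_fin.
  - rewrite /limn_einf; apply: measurableT_comp => //.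
    apply: measurable_fun_limn_esup => n; apply: measurableT_comp => //.
    by apply/measurable_EFinP; exact: itg_meas.
  - apply: aeS Ff => x Fx _.
    rewrite (@cvg_limn_einf_sup _ (fun n => (F n x)%:E) (f x)%:E _).1//.
    by apply: cvg_EFin => //; exact: nearW.
have fi : itg f by apply: ge0_itg => //; exact: le_lt_trans le (ltry _).
by split=> //; rewrite -lee_fin -IntE.
Qed.

Lemma itgE f : itg f = mu.-integrable [set: R] (EFin \o f).
Proof. by []. Qed.

Lemma IntEfine f : Int f = fine (\int[mu]_x (f x)%:E).
Proof. by []. Qed.

Lemma Int_restrict f (D : set R) : Int (f \_ D) = \int[mu]_(x in D) f x.
Proof. by rewrite Rintegral_mkcond. Qed.

End Tools.
#[global] Opaque itg Int.

(** * Poisson and conjugate Poisson kernels *)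

Section Kernels.
Context {R : realType}.
Notation mu := (@lebesgue_measure R).
Implicit Types (f g h F : R -> R).

Lemma FTC_itv F f (a b : R) : a < b -> (forall x, is_derive x (1 : R) F (f x)) ->
  continuous f -> \int[mu]_(x in `[a, b]) f x = F b - F a.
Proof.
move=> ab dF cf.
have cF : continuous F.
  move=> x; apply: differentiable_continuous; apply/derivable1_diffP.
  by have := dF x; case.
rewrite /Rintegral (@continuous_FTC2 _ f F a b ab) //.
- exact: continuous_subspaceT.
- split.
  + by move=> x _; have := dF x; case.
  + by apply: cvg_at_right_filter; exact: cF.
  + by apply: cvg_at_left_filter; exact: cF.
- by move=> x _; rewrite derive1E; have := dF x; case.
Qed.

Lemma patch_cvg f (x : R) :
  (f \_ `[- n.+1%:R, n.+1%:R]%classic) x @[n --> \oo] --> f x.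
Proof.
apply: cvg_near_cst; near=> n; rewrite patchE mem_set//= in_itv/=.
have : `|x| <= n.+1%:R.
  near: n; exists (Num.truncn `|x|).+1 => // k /= Hk.
  apply: (le_trans (ltW (truncnS_gt _))); rewrite ler_nat; exact: ltnW.
by rewrite ler_norml.
Unshelve. all: by end_near.
Qed.

Lemma FTCT F f (lp lm : R) : (forall x, is_derive x (1 : R) F (f x)) ->
  continuous f -> itg f ->
  F (n.+1%:R) @[n --> \oo] --> lp -> F (- n.+1%:R) @[n --> \oo] --> lm ->
  Int f = lp - lm.
Proof.
move=> dF cf fi Flp Flm.
have mf := itg_meas fi.
have : Int (f \_ `[- n.+1%:R, n.+1%:R]%classic) @[n --> \oo] --> Int f.
  apply: (DCT _ mf (itg_abs fi) _ _).2.
  - by move=> n; apply/(measurable_restrictT _ _).1 => //; exact: measurable_funTS.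
  - apply: aeT => x; exact: patch_cvg.
  - by move=> n; apply: aeT => x; rewrite patchE; case: ifP => //; rewrite normr0.
move=> /cvg_lim <- //; apply/cvg_lim => //.
rewrite (_ : (fun n => Int _) = (fun n => F n.+1%:R - F (- n.+1%:R))).
  exact: cvgB.
apply/funext => n; rewrite Int_restrict (FTC_itv _ dF cf)//.
by rewrite gtrN.
Qed.

(** The integral over each [[-n, n]] is an increment of [F], at most [2 * M], so Fatou's lemma
    applies to the truncations. *)
Lemma itg_FTC F f (M : R) : (forall x, is_derive x (1 : R) F (f x)) ->
  continuous f -> (forall x, 0 <= f x) -> (forall x, `|F x| <= M) -> itg f.
Proof.
move=> dF cf f0 FM.
have mf : measurable_fun [set: R] f by exact: continuous_measurable_fun.
pose g (n : nat) x := (f \_ `[- n.+1%:R, n.+1%:R]%classic) x.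
have E n : (\int[mu]_(x in `[(- n.+1%:R)%R, n.+1%:R]) (f x)%:E =
    (F n.+1%:R - F (- n.+1%:R))%:E)%E.
  rewrite (@continuous_FTC2 _ f F) //.
  - by rewrite gtrN.
  - exact: continuous_subspaceT.
  - have cF : continuous F.
      move=> x; apply: differentiable_continuous; apply/derivable1_diffP.
      by have := dF x; case.
    split.
    + by move=> x _; have := dF x; case.
    + by apply: cvg_at_right_filter; exact: cF.
    + by apply: cvg_at_left_filter; exact: cF.
  - by move=> x _; rewrite derive1E; have := dF x; case.
have gi n : itg (g n).
  apply: ge0_itg.
  - by apply/(measurable_restrictT _ _).1 => //; exact: measurable_funTS.
  - by move=> x; rewrite /g patchE; case: ifP.
  - have := E n; rewrite integral_mkcond restrict_EFin => ->; exact: ltry.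
apply: (Fatou_Int (F := g) (M := 2 * M) gi _ mf f0 _ _).1.
- by move=> n x; rewrite /g patchE; case: ifP.
- apply: aeT => x; exact: patch_cvg.
- move=> n; rewrite Int_restrict /Rintegral E /=.
  have := FM n.+1%:R; have := FM (- n.+1%:R); rewrite !ler_norml; lra.
Qed.

End Kernels.

Section Kernels.
Context {R : realType}.
Notation mu := (@lebesgue_measure R).
Implicit Types (f g h F : R -> R) (d e t s x u : R).

(** [1 / (u + i e) = qk e u - i pk e u], which is why products of the two kernels can be resolved by
    partial fractions. *)
Definition pk e u : R := e / (u ^+ 2 + e ^+ 2).
Definition qk e u : R := u / (u ^+ 2 + e ^+ 2).

Lemma den_gt0 e u : 0 < e -> 0 < u ^+ 2 + e ^+ 2.
Proof. by move=> e0; rewrite ltr_wpDl ?sqr_ge0// exprn_gt0. Qed.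

Lemma is_derive_lnq e t x : 0 < e ->
  is_derive x (1 : R) (fun x => 2^-1 * ln ((x - t) ^+ 2 + e ^+ 2)) (qk e (x - t)).
Proof.
move=> e0; have D0 := den_gt0 (x - t) e0.
have d1 : is_derive x (1 : R) (fun x => (x - t) ^+ 2 + e ^+ 2) (2 * (x - t)).
  apply: is_derive_eq; rewrite /GRing.scale/=; ring.
have d2 := is_derive1_ln D0.
have d3 := @is_derive1_comp _ (@ln R) (fun x => (x - t) ^+ 2 + e ^+ 2) x _ _ d2 d1.
have d4 := is_deriveZ (2^-1 : R) d3.
apply: (is_derive_eq d4).
rewrite /qk /GRing.scale/=; field; rewrite gt_eqF//.
Qed.

Lemma is_derive_atanp e t x : 0 < e ->
  is_derive x (1 : R) (fun x => atan ((x - t) / e)) (pk e (x - t)).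
Proof.
move=> e0; have D0 := den_gt0 (x - t) e0.
have d1 : is_derive x (1 : R) (fun x => (x - t) / e) (e^-1).
  by apply: is_derive_eq; rewrite /GRing.scale/= mulr0 add0r subr0 mulr1.
have d3 := @is_derive1_comp _ (@atan R) (fun x => (x - t) / e) x _ _
  (is_derive1_atan _) d1.
apply: (is_derive_eq d3); rewrite /pk /=; field.
by rewrite !gt_eqF//= addrC.
Qed.

Lemma cont_pk e t : 0 < e -> continuous (fun x => pk e (x - t)).
Proof.
move=> e0 x; apply: cvgM; first exact: cvg_cst.
apply: cvgV; first by rewrite gt_eqF// den_gt0.
apply: cvgD; last exact: cvg_cst.
apply: (@continuous_comp _ _ _ (fun x => x - t) (fun y => y ^+ 2)).
  by apply: cvgB => //; exact: cvg_cst.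
exact: exprn_continuous.
Qed.

Lemma cont_qk e t : 0 < e -> continuous (fun x => qk e (x - t)).
Proof.
move=> e0 x; apply: cvgM; first by apply: cvgB => //; exact: cvg_cst.
apply: cvgV; first by rewrite gt_eqF// den_gt0.
apply: cvgD; last exact: cvg_cst.
apply: (@continuous_comp _ _ _ (fun x => x - t) (fun y => y ^+ 2)).
  by apply: cvgB => //; exact: cvg_cst.
exact: exprn_continuous.
Qed.

Lemma cvg_atan_p e t : 0 < e -> atan ((n.+1%:R - t) / e) @[n --> \oo] --> pi / 2.
Proof.
move=> e0; apply: (cvg_comp _ _ _ (@cvgy_atan R)).
apply/cvgryPge => A.
near=> n.
rewrite ler_pdivlMr// lerBrDr.
near: n.
exists (Num.truncn (`|A * e + t|)).+1 => // k /= Hk.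
apply: (le_trans (ler_norm _)); apply: (le_trans (ltW (truncnS_gt _))); rewrite ler_nat; exact: ltnW.
Unshelve. all: by end_near.
Qed.

Lemma cvg_atan_m e t : 0 < e -> atan ((- n.+1%:R - t) / e) @[n --> \oo] --> - (pi / 2).
Proof.
move=> e0; have -> : (fun n => atan ((- n.+1%:R - t) / e)) =
    (fun n => - atan ((n.+1%:R - - t) / e)).
  by apply/funext => n; rewrite -atanN; congr atan; ring.
by apply: cvgN; exact: cvg_atan_p.
Qed.

Lemma ln_ratio_le (a b : R) : 0 < a -> 0 < b -> `|ln a - ln b| <= `|a - b| / a + `|a - b| / b.
Proof.
move=> a0 b0.
have H c d : 0 < c -> 0 < d -> ln c - ln d <= `|c - d| / d.
  move=> c0 d0; rewrite -ln_div ?posrE//.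
  have -> : c / d = 1 + (c - d) / d by field; rewrite gt_eqF.
  apply: (@le_trans _ _ ((c - d) / d)); last first.
    by rewrite ler_pM2r ?invr_gt0// ler_norm.
  apply: le_ln1Dx; rewrite ltr_pdivlMr// ; lra.
have := H a b a0 b0; have := H b a b0 a0; rewrite (distrC b a) => h1 h2.
have P : 0 <= `|a - b| / a by rewrite divr_ge0// ltW.
have Q : 0 <= `|a - b| / b by rewrite divr_ge0// ltW.
rewrite ler_norml; apply/andP; split; lra.
Qed.

(** Each logarithm diverges; only the difference has a limit, the same at both ends of the line.
    Taking [v] with [|v n| = n + 1] treats both ends at once. *)
Lemma cvg_ln_ratio (t s d e : R) (v : nat -> R) : 0 < d -> 0 < e ->
  (forall n, `|v n| = n.+1%:R) ->
  2^-1 * ln ((v n - t) ^+ 2 + d ^+ 2) - 2^-1 * ln ((v n - s) ^+ 2 + e ^+ 2)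
    @[n --> \oo] --> (0 : R).
Proof.
move=> d0 e0 vn.
(* Once [n >= 2 * C], both arguments of the logarithm are at least [(n + 1)^2 / 4], while they
   differ by at most [C * (n + 1)]. *)
pose C := 2 * (`|t| + `|s| + `|t| ^+ 2 + `|s| ^+ 2 + d ^+ 2 + e ^+ 2).
have C0 : 0 <= C by rewrite /C mulr_ge0// !addr_ge0// ?sqr_ge0.
have Ct : `|t| <= C. rewrite /C. have := sqr_ge0 `|t|; have := sqr_ge0 `|s|; have := sqr_ge0 d; have := sqr_ge0 e; have := normr_ge0 t; have := normr_ge0 s. lra.
have Cs : `|s| <= C. rewrite /C. have := sqr_ge0 `|t|; have := sqr_ge0 `|s|; have := sqr_ge0 d; have := sqr_ge0 e; have := normr_ge0 t; have := normr_ge0 s. lra.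
have B (n : nat) : 2 * C <= n%:R ->
  `|2^-1 * ln ((v n - t) ^+ 2 + d ^+ 2) - 2^-1 * ln ((v n - s) ^+ 2 + e ^+ 2)| <= 8 * C * harmonic n.
  move=> Cn; rewrite -mulrBr normrM ger0_norm ?invr_ge0//.
  have nS : n%:R <= n.+1%:R :> R by rewrite ler_nat.
  have n0 : (0 : R) < n.+1%:R by rewrite ltr0n.
  have low c a : `|a| <= C -> n.+1%:R ^+ 2 / 4 <= (v n - a) ^+ 2 + c ^+ 2.
    move=> aC; apply: (@le_trans _ _ (`|v n - a| ^+ 2)); last first.
      by rewrite real_normK ?num_real// lerDl sqr_ge0.
    have -> : n.+1%:R ^+ 2 / 4 = (n.+1%:R / 2) ^+ 2 :> R by field.
    rewrite lerXn2r ?nnegrE ?divr_ge0//.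
    have := lerB_dist (v n) a; rewrite vn; lra.
  have up : `|(v n - t) ^+ 2 + d ^+ 2 - ((v n - s) ^+ 2 + e ^+ 2)| <= C * n.+1%:R.
    have -> : (v n - t) ^+ 2 + d ^+ 2 - ((v n - s) ^+ 2 + e ^+ 2) =
       2 * (s - t) * v n + (t ^+ 2 - s ^+ 2 + d ^+ 2 - e ^+ 2) by ring.
    apply: (le_trans (ler_normD _ _)); rewrite !normrM vn (ger0_norm (_ : 0 <= 2))//.
    have h1 : `|s - t| <= `|t| + `|s| by rewrite [leRHS]addrC; exact: ler_normB.
    have h2 : `|t ^+ 2 - s ^+ 2 + d ^+ 2 - e ^+ 2| <= `|t| ^+ 2 + `|s| ^+ 2 + d ^+ 2 + e ^+ 2.
      rewrite !real_normK ?num_real// ler_norml.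
      have := sqr_ge0 t; have := sqr_ge0 s; have := sqr_ge0 d; have := sqr_ge0 e; lra.
    have n1 : (1 : R) <= n.+1%:R by rewrite ler1n.
    apply: (@le_trans _ _ (2 * (`|t| + `|s|) * n.+1%:R + (`|t| ^+ 2 + `|s| ^+ 2 + d ^+ 2 + e ^+ 2) * n.+1%:R)).
      apply: lerD; first by rewrite ler_pM2r// ler_pM2l.
      by apply: (le_trans h2); rewrite ler_peMr// !addr_ge0 ?sqr_ge0.
    rewrite -mulrDl ler_pM2r// /C.
    have := sqr_ge0 `|t|; have := sqr_ge0 `|s|; have := sqr_ge0 d; have := sqr_ge0 e; lra.
  have := ln_ratio_le (den_gt0 (v n - t) d0) (den_gt0 (v n - s) e0).
  set A := _ + d ^+ 2; set B := _ + e ^+ 2 => H.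
  have q0 : 0 < n.+1%:R ^+ 2 / 4 :> R by rewrite divr_gt0// exprn_gt0.
  have K c a : 0 < c -> `|a| <= C -> `|A - B| / ((v n - a) ^+ 2 + c ^+ 2) <= 4 * C * harmonic n.
    move=> c0 aC.
    apply: (@le_trans _ _ (C * n.+1%:R / (n.+1%:R ^+ 2 / 4))).
      apply: ler_pM => //; first by rewrite invr_ge0 ltW// den_gt0.
      by rewrite lef_pV2 ?posrE ?den_gt0//; exact: low.
    by rewrite /harmonic/= le_eqVlt; apply/orP; left; apply/eqP; field; rewrite gt_eqF.
  have := normr_ge0 (ln A - ln B); have := K d t d0 Ct; have := K e s e0 Cs; rewrite -/A -/B; lra.
apply: norm_cvg0; apply: (@squeeze_cvgr _ _ _ _ (fun=> 0) (fun n => 8 * C * harmonic n)).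
- near=> n; rewrite normr_ge0/= B//.
  near: n; exists (Num.truncn (2 * C)).+1 => // k /= Hk.
  apply: (le_trans (ltW (truncnS_gt _))); rewrite ler_nat; exact: Hk.
- exact: cvg_cst.
- rewrite -[X in _ --> X](mulr0 (8 * C)); apply: cvgM; first exact: cvg_cst.
  exact: cvg_harmonic.
Unshelve. all: by end_near.
Qed.

(** Partial fractions bring every product of two kernels to the form [G]. Since [qk] decays only
    like [1 / x], it must occur as a difference; that part contributes nothing, and each Poisson
    term contributes [pi]. *)
Lemma Int_pq (t s d e al be ga : R) : 0 < d -> 0 < e ->
  let G x := al * (qk d (x - t) - qk e (x - s)) + be * pk d (x - t)
    + ga * pk e (x - s) in
  itg G -> Int G = pi * (be + ga).
Proof.
move=> d0 e0 G Gi.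
pose F x := al * (2^-1 * ln ((x - t) ^+ 2 + d ^+ 2) - 2^-1 * ln ((x - s) ^+ 2 + e ^+ 2))
  + be * atan ((x - t) / d) + ga * atan ((x - s) / e).
have lim (v : nat -> R) (l : R) : (forall n, `|v n| = n.+1%:R) ->
    atan ((v n - t) / d) @[n --> \oo] --> l -> atan ((v n - s) / e) @[n --> \oo] --> l ->
    F (v n) @[n --> \oo] --> be * l + ga * l.
  move=> vn h1 h2; rewrite -[be * l]add0r -[X in X + be * l](mulr0 al).
  apply: cvgD; [apply: cvgD|].
  - by apply: cvgM; [exact: cvg_cst|exact: cvg_ln_ratio].
  - by apply: cvgM; [exact: cvg_cst|exact: h1].
  - by apply: cvgM; [exact: cvg_cst|exact: h2].
have dF x : is_derive x (1 : R) F (G x).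
  have D1 := is_derive_lnq t x d0; have D2 := is_derive_lnq s x e0.
  have D3 := is_derive_atanp t x d0; have D4 := is_derive_atanp s x e0.
  exact: (is_derive_eq (is_deriveD (is_deriveD (is_deriveZ al (is_deriveB D1 D2)) (is_deriveZ be D3)) (is_deriveZ ga D4)) erefl).
have cG : continuous G.
  move=> x; apply: cvgD; [apply: cvgD|].
  + apply: cvgM; first exact: cvg_cst.
    by apply: cvgB; exact: cont_qk.
  + by apply: cvgM; [exact: cvg_cst|exact: cont_pk].
  + by apply: cvgM; [exact: cvg_cst|exact: cont_pk].
rewrite (FTCT dF cG Gi (lp := be * (pi / 2) + ga * (pi / 2))
  (lm := be * - (pi / 2) + ga * - (pi / 2))).
- by field.
- apply: (lim (fun n => n.+1%:R)) => [n||]; first by rewrite ger0_norm.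
  + exact: cvg_atan_p.
  + exact: cvg_atan_p.
- apply: (lim (fun n => - n.+1%:R)) => [n||]; first by rewrite normrN ger0_norm.
  + exact: cvg_atan_m.
  + exact: cvg_atan_m.
Qed.
End Kernels.

HB.lock Definition Pois {R : realType} (e u : R) : R := pi^-1 * pk e u.
HB.lock Definition Conj {R : realType} (e u : R) : R := pi^-1 * qk e u.

Section Kernels.
Context {R : realType}.
Notation mu := (@lebesgue_measure R).
Implicit Types (f g h F : R -> R) (d e t s x u : R).

Lemma PoisE e u : Pois e u = pi^-1 * pk e u. Proof. by rewrite Pois.unlock. Qed.
Lemma ConjE e u : Conj e u = pi^-1 * qk e u. Proof. by rewrite Conj.unlock. Qed.

Lemma pi0 : 0 < pi^-1 :> R. Proof. by rewrite invr_gt0 pi_gt0. Qed.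

Lemma pk_ge0 e u : 0 < e -> 0 <= pk e u.
Proof. by move=> e0; rewrite divr_ge0// ltW// den_gt0. Qed.

Lemma pk_le e u : 0 < e -> pk e u <= e^-1.
Proof.
move=> e0; rewrite /pk ler_pdivrMr ?den_gt0// mulrC ler_pdivlMr//.
by rewrite -expr2 lerDr sqr_ge0.
Qed.

Lemma qk_le e u : 0 < e -> `|qk e u| <= e^-1.
Proof.
move=> e0; rewrite /qk normrM normfV (gtr0_norm (den_gt0 u e0)).
rewrite ler_pdivrMr ?den_gt0// mulrC ler_pdivlMr//.
have := sqr_ge0 (`|u| - e); rewrite -(real_normK (num_real u)).
have := mulr_ge0 (normr_ge0 u) (ltW e0); nra.
Qed.

Lemma qk_sqr_le e u : 0 < e -> qk e u ^+ 2 <= e^-1 * pk e u.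
Proof.
move=> e0; have D0 := den_gt0 u e0; rewrite /qk /pk.
have -> : e^-1 * (e / (u ^+ 2 + e ^+ 2)) = (u ^+ 2 + e ^+ 2) / (u ^+ 2 + e ^+ 2) ^+ 2.
  by field; rewrite !gt_eqF.
rewrite expr_div_n ler_pM2r ?invr_gt0 ?exprn_gt0// lerDl sqr_ge0//.
Qed.

Lemma Pois_gt0 e u : 0 < e -> 0 < Pois e u.
Proof. by move=> e0; rewrite PoisE mulr_gt0 ?pi0// divr_gt0// den_gt0. Qed.

Lemma Pois_ge0 e u : 0 < e -> 0 <= Pois e u.
Proof. by move=> e0; rewrite PoisE mulr_ge0 ?pk_ge0// ltW ?pi0. Qed.

Lemma Pois_le e u : 0 < e -> Pois e u <= pi^-1 * e^-1.
Proof. by move=> e0; rewrite PoisE ler_pM2l ?pi0// pk_le. Qed.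

Lemma Conj_le e u : 0 < e -> `|Conj e u| <= pi^-1 * e^-1.
Proof. by move=> e0; rewrite ConjE normrM gtr0_norm ?pi0// ler_pM2l ?pi0// qk_le. Qed.

Lemma P_even e u : Pois e (- u) = Pois e u.
Proof. by rewrite !PoisE /pk sqrrN. Qed.

Lemma P_sym e x t : Pois e (x - t) = Pois e (t - x).
Proof. by rewrite -P_even opprB. Qed.

Lemma Q_anti e x t : Conj e (x - t) = - Conj e (t - x).
Proof. by rewrite !ConjE /qk -(opprB t x) sqrrN !mulNr mulrN. Qed.

Lemma cont_P e : 0 < e -> continuous (Pois e).
Proof.
move=> e0 x; rewrite Pois.unlock; apply: cvgM; first exact: cvg_cst.
have := @cont_pk _ e 0 e0 x; rewrite /continuous_at subr0.
by under eq_fun do rewrite subr0.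
Qed.

Lemma cont_Q e : 0 < e -> continuous (Conj e).
Proof.
move=> e0 x; rewrite Conj.unlock; apply: cvgM; first exact: cvg_cst.
have := @cont_qk _ e 0 e0 x; rewrite /continuous_at subr0.
by under eq_fun do rewrite subr0.
Qed.

Lemma mP e : 0 < e -> measurable_fun [set: R] (Pois e).
Proof. by move=> e0; apply: continuous_measurable_fun; exact: cont_P. Qed.

Lemma mQ e : 0 < e -> measurable_fun [set: R] (Conj e).
Proof. by move=> e0; apply: continuous_measurable_fun; exact: cont_Q. Qed.

Lemma itg_pk e t : 0 < e -> itg (fun x => pk e (x - t)).
Proof.
move=> e0; apply: (@itg_FTC _ (fun x => atan ((x - t) / e)) _ (pi / 2)).
- by move=> x; exact: is_derive_atanp.
- exact: cont_pk.
- by move=> x; exact: pk_ge0.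
- by move=> x; rewrite ler_norml !ltW ?atan_gtNpi2 ?atan_ltpi2.
Qed.

Lemma Int_pk e t : 0 < e -> Int (fun x => pk e (x - t)) = pi.
Proof.
move=> e0; have := @Int_pq _ t t e e 0 1 0 e0 e0 => /=.
rewrite addr0 mulr1 => <-.
  by apply: eq_Int => x; rewrite !mul0r mul1r addr0 add0r.
move: (itg_pk t e0); congr itg; apply/funext => x.
by rewrite !mul0r mul1r addr0 add0r.
Qed.

Lemma itgP1 e t : 0 < e -> itg (fun x => Pois e (x - t)).
Proof. by move=> e0; rewrite Pois.unlock; apply: itgZ; exact: itg_pk. Qed.

Lemma itgP2 e x : 0 < e -> itg (fun t => Pois e (x - t)).
Proof.
move=> e0; have := itgP1 x e0; congr itg; apply/funext => t; exact: P_sym.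
Qed.

Lemma IntP1 e t : 0 < e -> Int (fun x => Pois e (x - t)) = 1.
Proof. by move=> e0; rewrite Pois.unlock IntZ ?Int_pk ?mulVf ?gt_eqF ?pi_gt0//; exact: itg_pk. Qed.

Lemma IntP2 e x : 0 < e -> Int (fun t => Pois e (x - t)) = 1.
Proof. by move=> e0; rewrite -(IntP1 x e0); apply: eq_Int => t; exact: P_sym. Qed.

Lemma mshift (k : R -> R) t : measurable_fun [set: R] k ->
  measurable_fun [set: R] (fun x => k (x - t)).
Proof. by move=> mk; apply: measurableT_comp => //; exact: measurable_funB. Qed.

Section conv.
Variables (t s d e : R).
Hypotheses (d0 : 0 < d) (e0 : 0 < e).

Let mpp (k l : R -> R) : measurable_fun [set: R] k -> measurable_fun [set: R] l ->
  measurable_fun [set: R] (fun x => k (x - t) * l (x - s)).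
Proof. by move=> mk ml; apply: measurable_funM; exact: mshift. Qed.

Lemma itgPP : itg (fun x => Pois d (x - t) * Pois e (x - s)).
Proof.
apply: itg_le (itgZ (pi^-1 * e^-1) (itgP1 t d0)) _ => [|x].
  by apply: mpp; exact: mP.
rewrite normrM !ger0_norm ?Pois_ge0// mulrC ler_wpM2r ?Pois_ge0//; exact: Pois_le.
Qed.

Lemma itgPQ : itg (fun x => Pois d (x - t) * Conj e (x - s)).
Proof.
apply: itg_le (itgZ (pi^-1 * e^-1) (itgP1 t d0)) _ => [|x].
  by apply: mpp; [exact: mP|exact: mQ].
rewrite normrM mulrC (ger0_norm (Pois_ge0 _ _))// ler_wpM2r ?Pois_ge0//; exact: Conj_le.
Qed.

(** [Conj] is not integrable by itself, but its square is at most a multiple of [Pois]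
    ([qk_sqr_le]), and a product is bounded by the two squares. *)
Lemma itgQQ : itg (fun x => Conj d (x - t) * Conj e (x - s)).
Proof.
apply: itg_le (itgD (itgZ (pi^-1 * d^-1) (itgP1 t d0)) (itgZ (pi^-1 * e^-1) (itgP1 s e0))) _ => [|x].
  by apply: mpp; exact: mQ.
have H c u : 0 < c -> Conj c u ^+ 2 <= pi^-1 * c^-1 * Pois c u.
  move=> c0; rewrite !ConjE !PoisE exprMn.
  have := qk_sqr_le u c0; have := pi0; have := sqr_ge0 (pi^-1 : R).
  set a := pi^-1 => a20 a0 h.
  have -> : a * c^-1 * (a * pk c u) = a ^+ 2 * (c^-1 * pk c u) by ring.
  by rewrite ler_wpM2l.
have h1 := H d (x - t) d0; have h2 := H e (x - s) e0.
set A := Conj d _ in h1 *; set B := Conj e _ in h2 *.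
have := sqr_ge0 (A - B); have := sqr_ge0 (A + B).
have := sqr_ge0 A; have := sqr_ge0 B.
move: h1 h2; set a := pi^-1 * d^-1 * _; set b := pi^-1 * e^-1 * _.
by rewrite ler_norml !expr2; move=> *; apply/andP; split; nra.
Qed.

(** If [t = s] and [d = e], two poles coincide and the partial fraction coefficients degenerate.
    Later uses meet this condition either for almost every point or through different parameters. *)
Hypothesis ne : t != s \/ d != e.

Let D0 : 0 < (t - s) ^+ 2 + (d - e) ^+ 2.
Proof.
case: ne => h; [rewrite ltr_pwDl ?sqr_ge0//|rewrite ltr_wpDl ?sqr_ge0//];
 by rewrite exprn_even_gt0//= subr_eq0.
Qed.

Let S0 : 0 < (t - s) ^+ 2 + (d + e) ^+ 2.
Proof. by rewrite ltr_wpDl ?sqr_ge0// exprn_gt0// addr_gt0. Qed.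

Let A0 x : 0 < (x - t) ^+ 2 + d ^+ 2. Proof. exact: den_gt0. Qed.
Let B0 x : 0 < (x - s) ^+ 2 + e ^+ 2. Proof. exact: den_gt0. Qed.

Let conv (k l : R -> R) (al be ga : R) : itg (fun x => (pi^-1 * k (x - t)) * (pi^-1 * l (x - s))) ->
  (forall x, k (x - t) * l (x - s) = al * (qk d (x - t) - qk e (x - s)) + be * pk d (x - t)
    + ga * pk e (x - s)) ->
  Int (fun x => (pi^-1 * k (x - t)) * (pi^-1 * l (x - s))) = pi^-1 * (be + ga).
Proof.
move=> kl E; have := @Int_pq _ t s d e al be ga d0 e0.
have E' x : k (x - t) * l (x - s) = pi ^+ 2 * ((pi^-1 * k (x - t)) * (pi^-1 * l (x - s))).
  by have := pi_gt0 R; move: (@pi R) => p p0; field; rewrite gt_eqF.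
have -> : (fun x => al * (qk d (x - t) - qk e (x - s)) + be * pk d (x - t)
    + ga * pk e (x - s)) = (fun x => pi ^+ 2 * ((pi^-1 * k (x - t)) * (pi^-1 * l (x - s)))).
  by apply/funext => x; rewrite -E E'.
move=> /(_ (itgZ _ kl)); rewrite IntZ// => /(congr1 (fun y => (pi ^+ 2)^-1 * y)).
rewrite mulKf ?gt_eqF ?exprn_gt0 ?pi_gt0// => ->.
by have := pi_gt0 R; move: (@pi R) => p p0; field; rewrite gt_eqF.
Qed.

(** On the Fourier side this law and the next two say that [exp (- d |xi|)] and [exp (- e |xi|)]
    multiply, with a factor [- i sgn xi] for each [Conj]. *)
Lemma IntPP : Int (fun x => Pois d (x - t) * Pois e (x - s)) = Pois (d + e) (t - s).
Proof.
(* With poles at [t + i d] and [s + i e], these are the squared distances from the first pole to the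
   second and to its conjugate; the residues produce the coefficients. *)
pose D := (t - s) ^+ 2 + (d - e) ^+ 2; pose S := (t - s) ^+ 2 + (d + e) ^+ 2.
rewrite Pois.unlock (@conv (pk d) (pk e) (2^-1 * ((t - s) / S - (t - s) / D))
  (2^-1 * ((d + e) / S - (d - e) / D)) (2^-1 * ((d + e) / S + (d - e) / D))) //.
- by rewrite ?PoisE; congr (_ * _); rewrite /pk /D /S; field; rewrite !gt_eqF.
- by have := itgPP; rewrite Pois.unlock.
- by move=> x; rewrite /pk /qk /D /S; field; rewrite !gt_eqF.
Qed.

Lemma IntQQ : Int (fun x => Conj d (x - t) * Conj e (x - s)) = Pois (d + e) (t - s).
Proof.
pose D := (t - s) ^+ 2 + (d - e) ^+ 2; pose S := (t - s) ^+ 2 + (d + e) ^+ 2.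
rewrite Conj.unlock (@conv (qk d) (qk e) (2^-1 * ((t - s) / S + (t - s) / D))
  (2^-1 * ((d + e) / S + (d - e) / D)) (2^-1 * ((d + e) / S - (d - e) / D))) //.
- by rewrite ?PoisE; congr (_ * _); rewrite /pk /D /S; field; rewrite !gt_eqF.
- by have := itgQQ; rewrite Conj.unlock.
- by move=> x; rewrite /pk /qk /D /S; field; rewrite !gt_eqF.
Qed.

Lemma IntPQ : Int (fun x => Pois d (x - t) * Conj e (x - s)) = Conj (d + e) (t - s).
Proof.
pose D := (t - s) ^+ 2 + (d - e) ^+ 2; pose S := (t - s) ^+ 2 + (d + e) ^+ 2.
rewrite Pois.unlock Conj.unlock (@conv (pk d) (qk e) (2^-1 * (- (d + e) / S - (d - e) / D))
  (2^-1 * ((t - s) / S + (t - s) / D)) (2^-1 * ((t - s) / S - (t - s) / D))) //.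
- by rewrite ?ConjE; congr (_ * _); rewrite /qk /D /S; field; rewrite !gt_eqF.
- by have := itgPQ; rewrite Pois.unlock Conj.unlock.
- by move=> x; rewrite /pk /qk /D /S; field; rewrite !gt_eqF.
Qed.
End conv.
End Kernels.

Lemma measurable_fun_norm {dd : measure_display} {T : measurableType dd} {R : realType}
  (D : set T) (f : T -> R) :
  measurable_fun D f -> measurable_fun D (fun x => `|f x|).
Proof. by move=> mf; exact: measurableT_comp. Qed.

Ltac mfun := repeat
  match goal with
    | |- measurable_fun _ (fun x => x) => exact: measurable_id
    | |- measurable_fun _ (fun x => x.1) => exact: measurable_fst
    | |- measurable_fun _ (fun x => x.2) => exact: measurable_snd
    | |- measurable_fun _ (fun x => ?c) => exact: measurable_cst
    | H : measurable_fun _ ?f |- measurable_fun _ ?f => exact: H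
    | H : itg ?f |- measurable_fun _ ?f => exact: (itg_meas H)
    | |- measurable_fun _ (fun x => @?a x * @?b x) => apply: (@measurable_funM _ _ _ _ a b)
    | |- measurable_fun _ (fun x => @?a x + - @?b x) => apply: (@measurable_funB _ _ _ _ a b)
    | |- measurable_fun _ (fun x => @?a x + @?b x) => apply: (@measurable_funD _ _ _ _ a b)
    | |- measurable_fun _ (fun x => - @?a x) => apply: (@measurable_funN _ _ _ _ a)
    | |- measurable_fun _ (fun x => @?a x ^+ ?n) => apply: (@measurable_funX _ _ _ _ a n)
    | |- measurable_fun _ (fun x => `| @?a x |) =>
        apply: (@measurable_fun_norm _ _ _ _ a)
    | |- measurable_fun _ (fun x => Pois ?e (@?a x)) =>
        apply: (@measurableT_comp _ _ _ _ _ _ (Pois e) _ a); first by apply: mP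
    | |- measurable_fun _ (fun x => Conj ?e (@?a x)) =>
        apply: (@measurableT_comp _ _ _ _ _ _ (Conj e) _ a); first by apply: mQ
    | H : measurable_fun setT ?f |- measurable_fun _ (fun x => ?f (@?a x)) =>
        apply: (@measurableT_comp _ _ _ _ _ _ f _ a H)
    | H : itg ?f |- measurable_fun _ (fun x => ?f (@?a x)) =>
        apply: (@measurableT_comp _ _ _ _ _ _ f _ a (itg_meas H))
    end.

(** * Convolution *)

Section Conv.
Context {R : realType}.
Notation mu := (@lebesgue_measure R).
Implicit Types (f g h k l : R -> R) (d e t s x u a B : R).

Definition cv k f x : R := Int (fun t => k (x - t) * f t).

Lemma eq_itg f g : f =1 g -> itg f -> itg g.
Proof. by move=> /funext ->. Qed.

Lemma itgM_bdd k f B : measurable_fun [set: R] k -> (forall x, `|k x| <= B) -> itg f ->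
  itg (fun x => k x * f x).
Proof.
move=> mk kB fi; apply: (itg_le _ (itgZ B (itg_abs fi))) => [|x]; first by mfun.
by rewrite normrM ler_wpM2r.
Qed.

Section bdd.
Variables (k : R -> R) (B : R).
Hypotheses (mk : measurable_fun [set: R] k) (kB : forall x, `|k x| <= B).

Lemma mkshift x : measurable_fun [set: R] (fun t => k (x - t)).
Proof. mfun. Qed.

Lemma cv_itg f x : itg f -> itg (fun t => k (x - t) * f t).
Proof. by move=> fi; apply: (@itgM_bdd _ _ B) => //; exact: mkshift. Qed.

Lemma cv_le f x : itg f -> `|cv k f x| <= B * Int (fun t => `|f t|).
Proof.
move=> fi; rewrite -IntZ; last exact: itg_abs.
apply: Int_absle; [exact: cv_itg|by apply: itgZ; exact: itg_abs|].
by move=> t; rewrite normrM ler_wpM2r.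
Qed.

Lemma cv_meas f : itg f -> measurable_fun [set: R] (cv k f).
Proof.
move=> fi.
(* [cv k f] need not be integrable; the positive weight [Pois 1] makes the double integral
   absolutely convergent and is divided out afterwards. *)
pose G x t := Pois 1 (x - 0) * (k (x - t) * f t).
have B0 : 0 <= B by exact: le_trans (kB 0).
have [_ _ Gi _ _] : [/\ forall x, itg (G x), forall y, itg (G^~ y),
      itg (fun x => Int (G x)), itg (fun y => Int (G^~ y)) &
      Int (fun x => Int (G x)) = Int (fun y => Int (G^~ y))].
  apply: (@FubM _ G (fun x => B * Pois 1 (x - 0)) (fun t => `|f t|)).
  - by rewrite /G; mfun.
  - by apply: itgZ; exact: itgP1.
  - exact: itg_abs.
  - by move=> x; rewrite mulr_ge0// Pois_ge0.
  - move=> x t; rewrite !normrM (ger0_norm (Pois_ge0 _ _))// mulrA [B * _]mulrC.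
    by rewrite ler_wpM2r// ler_wpM2l// Pois_ge0.
have -> : cv k f = fun x => (Pois 1 (x - 0))^-1 * Int (G x).
  apply/funext => x; rewrite /G IntZ ?mulKf//; last exact: cv_itg.
  by rewrite gt_eqF// Pois_gt0.
apply: measurable_funM; last exact: itg_meas.
apply: continuous_measurable_fun => x; apply: cvgV.
  by rewrite gt_eqF// Pois_gt0.
apply: (@continuous_comp _ _ _ (fun x => x - 0) (Pois 1)).
  by apply: cvgB => //; exact: cvg_cst.
exact: cont_P.
Qed.

Lemma cvD f g x : itg f -> itg g -> cv k (fun t => f t + g t) x = cv k f x + cv k g x.
Proof.
move=> fi gi; rewrite /cv -IntD; try exact: cv_itg.
by apply: eq_Int => t; rewrite mulrDr.
Qed.

Lemma cvB f g x : itg f -> itg g -> cv k (fun t => f t - g t) x = cv k f x - cv k g x.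
Proof.
move=> fi gi; rewrite /cv -IntB; try exact: cv_itg.
by apply: eq_Int => t; rewrite mulrBr.
Qed.

Lemma cvZ f c x : itg f -> cv k (fun t => c * f t) x = c * cv k f x.
Proof.
move=> fi; rewrite /cv -IntZ; try exact: cv_itg.
by apply: eq_Int => t; rewrite mulrCA.
Qed.

Lemma itg_cvM f g : itg f -> itg g -> itg (fun x => cv k f x * g x).
Proof.
move=> fi gi; apply: (@itgM_bdd _ _ (B * Int (fun t => `|f t|))) => //.
- exact: cv_meas.
- by move=> x; exact: cv_le.
Qed.

Lemma cv_adj f g : itg f -> itg g ->
  Int (fun x => cv k f x * g x) = Int (fun t => f t * Int (fun x => k (x - t) * g x)).
Proof.
move=> fi gi; pose G x t := k (x - t) * f t * g x.
have B0 : 0 <= B by exact: le_trans (kB 0).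
have [Gx Gt _ _ E] : [/\ forall x, itg (G x), forall y, itg (G^~ y),
      itg (fun x => Int (G x)), itg (fun y => Int (G^~ y)) &
      Int (fun x => Int (G x)) = Int (fun y => Int (G^~ y))].
  apply: (@FubM _ G (fun x => B * `|g x|) (fun t => `|f t|)).
  - by rewrite /G; mfun.
  - by apply: itgZ; exact: itg_abs.
  - exact: itg_abs.
  - by move=> x; rewrite mulr_ge0.
  - move=> x t; by rewrite !normrM mulrAC; apply: ler_wpM2r => //; apply: ler_wpM2r.
rewrite (_ : Int (fun x => cv k f x * g x) = Int (fun x => Int (G x))).
  rewrite E; apply: eq_Int => t; rewrite /G -IntZ; last first.
    by apply: (@itgM_bdd _ _ B _ _ gi) => [|y]; [mfun|exact: kB].
  by apply: eq_Int => x; ring.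
apply: eq_Int => x; rewrite mulrC -IntZ; last exact: cv_itg.
by apply: eq_Int => t; rewrite /G; ring.
Qed.

Lemma cv_comp l f x : itg (fun t => l (x - t)) -> itg f ->
  itg (fun s => f s * Int (fun t => l (x - t) * k (t - s))) /\
  cv l (cv k f) x = Int (fun s => f s * Int (fun t => l (x - t) * k (t - s))).
Proof.
move=> li fi; pose G t s := l (x - t) * (k (t - s) * f s).
have B0 : 0 <= B by exact: le_trans (kB 0).
have ml := itg_meas li; set l' := fun t => l (x - t) in li ml *.
have mG : measurable_fun [set: R * R] (fun z : R * R => G z.1 z.2).
  by rewrite /G -/(l' _); apply: (@measurable_funM _ _ _ _ (fun z : R * R => l' z.1)
    (fun z : R * R => k (z.1 - z.2) * f z.2)); mfun.
have [Gx Gt _ GI E] : [/\ forall x, itg (G x), forall y, itg (G^~ y),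
      itg (fun x => Int (G x)), itg (fun y => Int (G^~ y)) &
      Int (fun x => Int (G x)) = Int (fun y => Int (G^~ y))].
  apply: (@FubM _ G (fun t => B * `|l' t|) (fun t => `|f t|)) => //.
  - by apply: itgZ; exact: itg_abs.
  - exact: itg_abs.
  - by move=> t; rewrite mulr_ge0.
  - move=> t s; rewrite !normrM mulrA -/(l' t) [B * _]mulrC ler_wpM2r//.
    by apply: ler_wpM2l.
rewrite (_ : cv l (cv k f) x = Int (fun t => Int (G t))); last first.
  apply: eq_Int => t; rewrite /G IntZ; [by []|exact: cv_itg].
rewrite E; have Gs s : Int (G^~ s) = f s * Int (fun t => l (x - t) * k (t - s)).
  rewrite /G -IntZ; first by apply: eq_Int => t; ring.
  rewrite -/l'; apply: (itg_le _ (itgZ B (itg_abs li))).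
    by apply: (@measurable_funM _ _ _ _ l' (fun t => k (t - s))); [exact: ml|mfun].
  by move=> t; rewrite normrM mulrC; apply: ler_wpM2r.
split; last exact: eq_Int.
exact: eq_itg GI.
Qed.
End bdd.

Lemma ae_neq (a : R) : {ae mu, forall x, x != a}.
Proof.
exists [set a]; split; [exact: measurable_set1|exact: lebesgue_measure_set1|].
by move=> x /= /negP; rewrite negbK => /eqP.
Qed.

Local Notation Po e := (cv (Pois e)).
Local Notation Qo e := (cv (Conj e)).
Definition kb e : R := pi^-1 * e^-1.

Lemma kb_ge0 e : 0 < e -> 0 <= kb e.
Proof. by move=> e0; rewrite mulr_ge0 ?ltW ?pi0// invr_gt0. Qed.

Lemma Pois_nle e u : 0 < e -> `|Pois e u| <= kb e.
Proof. by move=> e0; rewrite ger0_norm ?Pois_ge0// Pois_le. Qed.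

Section ops.
Variables (d e : R).
Hypotheses (d0 : 0 < d) (e0 : 0 < e).

Let PoisC x t : Pois d (x - t) = Pois d (t - x). Proof. exact: P_sym. Qed.

Lemma PoPo f x : itg f -> Po d (Po e f) x = Po (d + e) f x.
Proof.
move=> fi; have [i ->] := cv_comp (mP e0) (fun u => Pois_nle u e0) (itgP2 x d0) fi.
apply: ae_Int; first exact: itg_meas.
  by apply: measurable_funM; [apply: mkshift; apply: mP; rewrite addr_gt0|exact: itg_meas].
(* [IntPP] is at hand for [s != x], which is enough under the integral over [s]. *)
apply: aeS (ae_neq x) => s sx; rewrite mulrC; congr (_ * _).
rewrite -(@IntPP _ x s d e)//; last by left; rewrite eq_sym.
by apply: eq_Int => t; rewrite PoisC.
Qed.

Lemma PoQo f x : itg f -> Po d (Qo e f) x = Qo (d + e) f x.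
Proof.
move=> fi; have [i ->] := cv_comp (mQ e0) (fun u => Conj_le u e0) (itgP2 x d0) fi.
apply: ae_Int; first exact: itg_meas.
  by apply: measurable_funM; [apply: mkshift; apply: mQ; rewrite addr_gt0|exact: itg_meas].
apply: aeS (ae_neq x) => s sx; rewrite mulrC; congr (_ * _).
rewrite -(@IntPQ _ x s d e)//; last by left; rewrite eq_sym.
by apply: eq_Int => t; rewrite PoisC.
Qed.

Lemma Po_itg g : itg g -> itg (Po e g) /\ Int (Po e g) = Int g.
Proof.
move=> gi; pose G t x := Pois e (x - t) * g t.
have Gt t : Int (fun x => `|G t x|) = `|g t|.
  rewrite -[RHS]mulr1 -(IntP1 t e0) -IntZ; last exact: itgP1.
  by apply: eq_Int => x; rewrite /G normrM mulrC (ger0_norm (Pois_ge0 _ e0)).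
have [] : [/\ itg (fun t => Int (G t)), itg (fun y => Int (G^~ y)),
      itg (fun y => Int (fun x => `|G x y|)) &
      Int (fun t => Int (G t)) = Int (fun y => Int (G^~ y))].
  apply: Fub.
  - by rewrite /G; mfun.
  - move=> t; apply: eq_itg (itgZ (g t) (itgP1 t e0)) => x; exact: mulrC.
  - move=> x; apply: (cv_itg (mP e0)) => // u; exact: Pois_nle.
  - apply: eq_itg (itg_abs gi) => t; exact/esym/Gt.
move=> _ i2 _ E; split; first by [].
rewrite -[LHS]E; apply: eq_Int => t; rewrite -[RHS]mulr1 -(IntP1 t e0) -IntZ; last exact: itgP1.
by apply: eq_Int => x; exact: mulrC.
Qed.

Lemma Po_ge0 g x : (forall t, 0 <= g t) -> 0 <= Po e g x.
Proof. by move=> g0; apply: Int_ge0 => t; rewrite mulr_ge0// Pois_ge0. Qed.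

(** The variance of [g] under the probability density [Pois e (x - t)] is nonnegative. *)
Lemma Po_sqr g x : itg (fun t => Pois e (x - t) * g t) ->
  itg (fun t => Pois e (x - t) * g t ^+ 2) ->
  Po e g x ^+ 2 <= Po e (fun t => g t ^+ 2) x.
Proof.
move=> i1 i2; set c := Po e g x.
have : 0 <= Int (fun t => Pois e (x - t) * g t ^+ 2 - 2 * c * (Pois e (x - t) * g t)
    + c ^+ 2 * Pois e (x - t)).
  apply: Int_ge0 => t; have := Pois_ge0 (x - t) e0; set p := Pois _ _ => p0.
  have -> : p * g t ^+ 2 - 2 * c * (p * g t) + c ^+ 2 * p = p * (g t - c) ^+ 2 by ring.
  by rewrite mulr_ge0 ?sqr_ge0.
rewrite (IntD (itgB i2 (itgZ (2 * c) i1)) (itgZ (c ^+ 2) (itgP2 x e0))).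
rewrite (IntB i2 (itgZ (2 * c) i1)) (IntZ _ i1) (IntZ _ (itgP2 x e0)) IntP2//.
rewrite -[Int (fun t => _ * g t ^+ 2)]/(Po e (fun t => g t ^+ 2) x).
rewrite -[Int (fun t => _ * g t)]/c; nra.
Qed.
End ops.

(** Decay like [1 / |x|], uniform for [t] in a bounded set, is what makes products of two conjugate
    transforms integrable. *)
Lemma Conj_decay e a : 0 < e -> 0 <= a -> exists2 C, 0 <= C &
  forall x t, `|t| <= a -> `|Conj e (x - t)| <= C / (1 + `|x|).
Proof.
move=> e0 a0; exists (pi^-1 * (1 + (1 + a) * e^-1)).
  by rewrite mulr_ge0 ?ltW ?pi0// addr_gt0// mulr_gt0 ?invr_gt0//; lra.
move=> x t ta; rewrite ConjE normrM gtr0_norm ?pi0// -mulrA ler_pM2l ?pi0//.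
have x0 : 0 < 1 + `|x| by rewrite ltr_pwDl.
rewrite ler_pdivlMr//.
have h1 : 1 + `|x| <= (1 + a) + `|x - t|.
  by have := ler_normD (x - t) t; rewrite subrK; lra.
apply: (@le_trans _ _ (`|qk e (x - t)| * ((1 + a) + `|x - t|))); first by rewrite ler_wpM2l.
rewrite mulrDr addrC; apply: lerD; last by rewrite mulrC ler_wpM2l ?qk_le//; lra.
rewrite /qk normrM normfV (gtr0_norm (den_gt0 (x - t) e0)) mulrAC -expr2 real_normK ?num_real//.
by rewrite ler_pdivrMr ?den_gt0// mul1r lerDl sqr_ge0.
Qed.

Lemma inv_decay x : (1 + `|x|)^-1 ^+ 2 <= pi * Pois 1 (x - 0).
Proof.
rewrite PoisE mulrA divff ?gt_eqF ?pi_gt0// mul1r /pk subr0 expr1n div1r exprVn.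
have A : 0 < (1 + `|x|) ^+ 2 by rewrite exprn_gt0// ltr_pwDl.
have B : 0 < x ^+ 2 + 1 by rewrite ltr_wpDl ?sqr_ge0.
rewrite lef_pV2 ?posrE//.
have := normr_ge0 x; rewrite -(real_normK (num_real x)); nra.
Qed.

Definition supp a f := forall x, a < `|x| -> f x = 0.

Lemma Qo_decay e f a : 0 < e -> 0 <= a -> itg f -> supp a f ->
  exists2 C, 0 <= C & forall x, `|Qo e f x| <= C / (1 + `|x|).
Proof.
move=> e0 a0 fi fa; have [C C0 CP] := Conj_decay e0 a0.
exists (C * Int (fun t => `|f t|)); first by rewrite mulr_ge0// Int_ge0.
move=> x; rewrite mulrAC -IntZ; last exact: itg_abs.
apply: Int_absle.
- exact: (cv_itg (mQ e0) (fun u => Conj_le u e0)).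
- by apply: itgZ; exact: itg_abs.
- move=> t; rewrite normrM; have [ta|ta] := leP `|t| a.
    by rewrite ler_wpM2r// CP.
  by rewrite fa// normr0 !mulr0.
Qed.

(** Two exchanges of integrals reduce the inner product to [IntQQ]. The compact supports supply the
    majorants of order [1 / (1 + x^2)] that both exchanges need. *)
Lemma QoQo d e f g a : 0 < d -> 0 < e -> 0 <= a -> itg f -> itg g -> supp a f -> supp a g ->
  itg (fun x => Qo d f x * Qo e g x) /\
  Int (fun x => Qo d f x * Qo e g x) = Int (fun t => f t * Po (d + e) g t).
Proof.
move=> d0 e0 a0 fi gi fa ga.
have [C C0 CP] := Conj_decay d0 a0.
have [D D0 DP] := Conj_decay e0 a0.
have [D' D'0 D'P] := Qo_decay e0 a0 gi ga.
have mg := itg_meas gi.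
have mQg : measurable_fun [set: R] (Qo e g) by apply: (cv_meas (mQ e0) (fun u => Conj_le u e0)).
have dec A B x : A <= C / (1 + `|x|) -> 0 <= A -> 0 <= B -> forall D1, B <= D1 / (1 + `|x|) -> 0 <= D1 ->
    A * B <= C * D1 * (pi * Pois 1 (x - 0)).
  move=> hA A0 B0 D1 hB D10; apply: (@le_trans _ _ ((C / (1 + `|x|)) * (D1 / (1 + `|x|)))).
    exact: ler_pM.
  have -> : C / (1 + `|x|) * (D1 / (1 + `|x|)) = C * D1 * (1 + `|x|)^-1 ^+ 2.
    by rewrite expr2; ring.
  by apply: ler_wpM2l; [exact: mulr_ge0|exact: inv_decay].
pose G x t := Conj d (x - t) * f t * Qo e g x.
have [Gx Gt i1 _ E] : [/\ forall x, itg (G x), forall y, itg (G^~ y),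
      itg (fun x => Int (G x)), itg (fun y => Int (G^~ y)) &
      Int (fun x => Int (G x)) = Int (fun y => Int (G^~ y))].
  apply: (@FubM _ G (fun x => C * D' * (pi * Pois 1 (x - 0))) (fun t => `|f t|)).
  - by rewrite /G; mfun.
  - by apply: itgZ; apply: itgZ; exact: itgP1.
  - exact: itg_abs.
  - move=> x; apply: mulr_ge0; first exact: mulr_ge0.
    apply: mulr_ge0; [exact: pi_ge0|exact: Pois_ge0].
  - move=> x t; rewrite /G !normrM mulrAC; have [ta|ta] := leP `|t| a.
      apply: ler_wpM2r; first exact: normr_ge0.
      exact: (dec _ _ _ (CP _ _ ta) (normr_ge0 _) (normr_ge0 _) _ (D'P x) D'0).
    by rewrite (fa t ta) normr0 !mulr0.
have GxE x : Int (G x) = Qo d f x * Qo e g x.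
  rewrite mulrC -IntZ; last exact: (cv_itg (mQ d0) (fun u => Conj_le u d0)).
  by apply: eq_Int => t; rewrite /G; ring.
split; first exact: eq_itg i1.
rewrite -(eq_Int GxE) E; apply: eq_Int => t; rewrite /G.
have [ta|ta] := leP `|t| a; last first.
  rewrite (fa t ta) mul0r -[RHS]Int0; by apply: eq_Int => x; rewrite mulr0 mul0r.
pose H x s := Conj d (x - t) * (Conj e (x - s) * g s).
have [Hx Hs i3 i2 E'] : [/\ forall x, itg (H x), forall y, itg (H^~ y),
      itg (fun x => Int (H x)), itg (fun y => Int (H^~ y)) &
      Int (fun x => Int (H x)) = Int (fun y => Int (H^~ y))].
  apply: (@FubM _ H (fun x => C * D * (pi * Pois 1 (x - 0))) (fun t => `|g t|)).
  - by rewrite /H; mfun.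
  - by apply: itgZ; apply: itgZ; exact: itgP1.
  - exact: itg_abs.
  - move=> x; apply: mulr_ge0; first exact: mulr_ge0.
    apply: mulr_ge0; [exact: pi_ge0|exact: Pois_ge0].
  - move=> x s; rewrite /H !normrM mulrA; have [sa|sa] := leP `|s| a.
      apply: ler_wpM2r; first exact: normr_ge0.
      exact: (dec _ _ _ (CP _ _ ta) (normr_ge0 _) (normr_ge0 _) _ (DP _ _ sa) D0).
    by rewrite (ga s sa) normr0 !mulr0.
have HxE x : Int (H x) = Conj d (x - t) * Qo e g x.
  by rewrite -IntZ; [by []|exact: (cv_itg (mQ e0) (fun u => Conj_le u e0) _ gi)].
have HsE s : Int (H^~ s) = g s * Int (fun x => Conj d (x - t) * Conj e (x - s)).
  rewrite -IntZ; last exact: itgQQ.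
  by apply: eq_Int => x; rewrite /H; ring.
transitivity (f t * Int (fun x => Int (H x))).
  rewrite (eq_Int HxE) -IntZ; first by apply: eq_Int => x; ring.
  exact: eq_itg i3.
have de0 : 0 < d + e by exact: addr_gt0.
congr (_ * _); rewrite E'; apply: ae_Int; [exact: (itg_meas i2)|by mfun|].
apply: aeS (ae_neq t) => s st; rewrite HsE mulrC; congr (_ * _).
have ts : t != s \/ d != e by left; rewrite eq_sym.
exact: (IntQQ d0 e0 ts).
Qed.

End Conv.

(** * Almost everywhere convergent subsequences *)

Section L2.
Context {R : realType}.
Notation mu := (@lebesgue_measure R).
Implicit Types (f g h k l : R -> R) (d e t s x a B : R).

(** The sum of the [g n] has integral at most 2, hence is finite almost everywhere, and it bounds
    each term. *)
Lemma ae_sum_bounded (g : nat -> R -> R) :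
  (forall n, itg (g n)) -> (forall n x, 0 <= g n x) ->
  (forall n, Int (g n) <= 2^-1 ^+ n) ->
  {ae mu, forall x, exists M, forall n, g n x <= M}.
Proof.
move=> gi g0 gM.
have S2 : (\int[mu]_x (\sum_(0 <= n <oo) (g n x)%:E) < +oo)%E.
  rewrite integral_nneseries//; last 2 first.
  - by move=> n; apply/measurable_EFinP; exact: itg_meas.
  - by move=> n x _; rewrite lee_fin.
  apply: (@le_lt_trans _ _ 2%:E); last exact: ltry.
  apply: lime_le.
    by apply: is_cvg_nneseries => n _ _; apply: integral_ge0 => x _; rewrite lee_fin.
  apply: nearW => n.
  rewrite (eq_bigr (fun n => (Int (g n))%:E)); last by move=> i _; rewrite IntE.
  rewrite sumEFin lee_fin.
  apply: (@le_trans _ _ (\sum_(0 <= i < n) 2^-1 ^+ i)); first exact: ler_sum.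
  suff -> : \sum_(0 <= i < n) 2^-1 ^+ i = 2 - 2 * 2^-1 ^+ n :> R.
    by rewrite gerBl mulr_ge0// exprn_ge0.
  elim: n => [|n IH]; first by rewrite big_nil expr0; ring.
  by rewrite big_nat_recr//= IH exprS; field.
have mS : measurable_fun [set: R] (fun x => \sum_(0 <= n <oo) (g n x)%:E)%E.
  apply: ge0_emeasurable_sum; first by move=> n x _ _; rewrite lee_fin.
  by move=> n _; apply/measurable_EFinP; exact: itg_meas.
have S0 x : (0 <= \sum_(0 <= n <oo) (g n x)%:E)%E.
  by apply: nneseries_ge0 => n _ _; rewrite lee_fin.
have Si : mu.-integrable setT (fun x => \sum_(0 <= n <oo) (g n x)%:E)%E.
  by apply/integrableP; split => //; under eq_integral do rewrite gee0_abs//.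
have := integrable_ae measurableT Si; apply: aeS => x /(_ I) xfin.
exists (fine (\sum_(0 <= n <oo) (g n x)%:E)%E) => n.
rewrite -lee_fin fineK//.
apply: (le_trans _ (nneseries_lim_ge n.+1 _)); last by move=> i _ _; rewrite lee_fin.
rewrite sumEFin lee_fin big_nat_recr//= lerDr; exact: sumr_ge0.
Qed.

(** The increments are at most [sqrt M / 2 ^ n]; the cruder [M + 1] replaces the square root. *)
Lemma geo_cvg (u : nat -> R) (M : R) :
  (forall n, (4 ^+ n * (u n.+1 - u n) ^+ 2) <= M) -> cvgn u.
Proof.
move=> uM.
have M0 : 0 <= M by apply: le_trans (uM 0%N); rewrite expr0 mul1r sqr_ge0.
have H n : `|telescope u n| <= geometric (M + 1) (2^-1) n.
  rewrite /telescope /geometric/=.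
  have := uM n; set y := u n.+1 - u n => h.
  rewrite exprVn ler_pdivlMr ?exprn_gt0// mulrC.
  have : (2 ^+ n * `|y|) ^+ 2 <= M.
    apply: le_trans h; rewrite exprMn real_normK ?num_real// -exprM mulnC exprM.
    by have -> : 2 ^+ 2 = 4 :> R by ring.
  set z := 2 ^+ n * `|y|.
  have : 0 <= z by rewrite mulr_ge0// exprn_ge0.
  nra.
have c1 : cvgn (series (telescope u)).
  apply: normed_cvg; apply: (series_le_cvg _ _ H).
  - by move=> n; exact: normr_ge0.
  - by move=> n; exact: le_trans (H n).
  - by apply: is_cvg_geometric_series; rewrite ger0_norm//; lra.
have -> : u = (fun n => u 0%N + series (telescope u) n) by apply/funext => n; exact: eq_sum_telescope.
by apply: is_cvgD => //; exact: is_cvg_cst.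
Qed.

Lemma L2_ae_subseq (u : nat -> R -> R) :
  (forall n, measurable_fun [set: R] (u n)) ->
  (forall m n, itg (fun x => (u m x - u n x) ^+ 2)) ->
  (forall eta, 0 < eta -> exists N, forall m n, (N <= m)%N -> (N <= n)%N ->
     Int (fun x => (u m x - u n x) ^+ 2) <= eta) ->
  exists phi : nat -> nat, exists2 h : R -> R, measurable_fun [set: R] h &
    (forall n, (n <= phi n)%N) /\
    {ae mu, forall x, u (phi n) x @[n --> \oo] --> h x}.
Proof.
move=> mu_ ui uC.
(* Accuracy [8 ^- j] leaves a summable [2 ^- j] after multiplication by the weight [4 ^ j] of
   [geo_cvg]. *)
have /choice[N HN] : forall j : nat, exists N, forall m n, (N <= m)%N -> (N <= n)%N ->
     Int (fun x => (u m x - u n x) ^+ 2) <= 8^-1 ^+ j.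
  by move=> j; apply: uC; rewrite exprn_gt0// invr_gt0.
(* Adding up the thresholds puts both [phi j] and [phi j.+1] beyond [N j], so that consecutive terms
   are compared at accuracy [j]. *)
pose phi j := (j + \sum_(0 <= i < j.+1) N i)%N.
have phiN j : (N j <= phi j)%N.
  by rewrite /phi big_nat_recr//=; lia.
have phiN' j : (N j <= phi j.+1)%N.
  by rewrite /phi big_nat_recr//= big_nat_recr//=; lia.
pose v n := u (phi n).
have vae : {ae mu, forall x, cvgn (v ^~ x)}.
  have : {ae mu, forall x, exists M, forall n, 4 ^+ n * (v n.+1 x - v n x) ^+ 2 <= M}.
    apply: ae_sum_bounded.
    - by move=> n; apply: itgZ; exact: ui.
    - by move=> n x; rewrite mulr_ge0 ?sqr_ge0// exprn_ge0.
    - move=> n; rewrite IntZ; last exact: ui.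
      apply: (@le_trans _ _ (4 ^+ n * 8^-1 ^+ n)).
        by rewrite ler_wpM2l ?exprn_ge0//; apply: HN.
      by rewrite -exprMn (_ : 4 * 8^-1 = 2^-1)//; field.
  by apply: aeS => x [M HM]; exact: geo_cvg HM.
(* The upper limit is measurable and agrees with the limit wherever the latter exists. *)
exists phi, (fun x => fine (limn_esup (fun n => (v n x)%:E))).
  apply: measurableT_comp; first exact: fine_measurable.
  by apply: measurable_fun_limn_esup => n; apply/measurable_EFinP; exact: mu_.
split; first by move=> n; rewrite /phi leq_addr.
apply: aeS vae => x /cvg_ex[l vl].
rewrite (@cvg_limn_einf_sup _ (fun n => (v n x)%:E) l%:E _).2//.
by apply: cvg_EFin => //; exact: nearW.
Qed.
End L2.

(** * Lebesgue points and truncated Hilbert transforms *)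

Section Lebesgue.
Context {R : realType}.
Notation mu := (@lebesgue_measure R).
Implicit Types (f g h k l : R -> R) (d e t s x a B : R).

Definition near_ball x r t : R := (\1_(ball x r : set R) t).

Lemma near_ballE x r t : near_ball x r t = (`|x - t| < r)%R%:R.
Proof.
rewrite /near_ball indicE; congr (nat_of_bool _)%:R.
by apply/idP/idP => [|h]; [move/set_mem|apply: mem_set].
Qed.

Lemma near_ball_ge0 x r t : 0 <= near_ball x r t.
Proof. by rewrite near_ballE. Qed.

Lemma mnear_ball x r : measurable_fun [set: R] (near_ball x r).
Proof. by apply: measurable_indic; exact: measurable_ball. Qed.

Lemma near_ball_Pois x r t : near_ball x r t <= pi * (r ^+ 2 + 1) * Pois 1 (x - t).
Proof.
rewrite near_ballE PoisE; have pp := pi_gt0 R; have h2 := den_gt0 (x - t) ltr01.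
have -> : pi * (r ^+ 2 + 1) * (pi^-1 * pk 1 (x - t)) = (r ^+ 2 + 1) * pk 1 (x - t).
  by move: pp; move: (@pi R) => p p0; field; rewrite gt_eqF.
case: ltP => xr; last by rewrite mulr_ge0 ?pk_ge0// addr_ge0 ?sqr_ge0.
rewrite /pk mulr1n mulrA mulr1 ler_pdivlMr// mul1r expr1n lerD2r.
by rewrite -(real_normK (num_real (x - t))) lerXn2r ?nnegrE// ?(ltW xr)// (le_trans _ (ltW xr)).
Qed.

Lemma itg_near_ball x r : itg (near_ball x r).
Proof.
apply: (itg_le _ (itgZ (pi * (r ^+ 2 + 1)) (itgP2 x ltr01))) => [|t].
  exact: mnear_ball.
by rewrite ger0_norm ?near_ball_ge0// near_ball_Pois.
Qed.

Lemma lebesgue_ptP h x : lebesgue_pt h x ->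
  forall eta, 0 < eta -> exists2 rho, 0 < rho & forall r, 0 < r -> r <= rho ->
  (\int[mu]_(t in ball x r) `|h t - h x|%:E <= (2 * eta * r)%:E)%E.
Proof.
rewrite /lebesgue_pt /davg /iavg => H eta eta0.
move/fine_cvgP: H => [H1 /cvgrPdist_lt /(_ _ eta0) H2].
have [d /= d0 dH] : \forall r \near 0^'+,
   ((mu (ball x r))^-1 * \int[mu]_(y in ball x r) `|((center (h x) \o h) y)%:E|)%E \is a fin_num
   /\ fine ((mu (ball x r))^-1 * \int[mu]_(y in ball x r) `|((center (h x) \o h) y)%:E|)%E < eta.
  near=> r; split; first by near: r.
  have : `|0 - fine ((mu (ball x r))^-1 * \int[mu]_(y in ball x r) `|((center (h x) \o h) y)%:E|)%E| < eta.
    by near: r.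
  by rewrite sub0r normrN; apply: le_lt_trans; exact: ler_norm.
exists (d / 2); first by rewrite divr_gt0.
move=> r r0 rd.
have [] := dH r _ r0.
  rewrite /ball/= sub0r normrN gtr0_norm//; lra.
move=> fn lt.
have : ((mu (ball x r))^-1 * \int[mu]_(y in ball x r) `|((center (h x) \o h) y)%:E| <= eta%:E)%E.
  by rewrite -(fineK fn) lee_fin ltW.
rewrite lebesgue_measure_ball ?(ltW r0)//.
have r2 : 0 < r *+ 2 by rewrite mulrn_wgt0.
rewrite inver gt_eqF// lee_pdivrMl//.
rewrite (_ : (_ * _)%E = (2 * eta * r)%:E)//.
by rewrite -EFinM; congr EFin; ring.
Unshelve. all: by end_near.
Qed.

Section dyadic.
Variables (g : R -> R) (x rho eta : R).
Hypotheses (rho0 : 0 < rho) (eta0 : 0 <= eta) (mg : measurable_fun [set: R] g)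
  (g0 : forall t, 0 <= g t)
  (gi : itg (fun t => Pois 1 (x - t) * g t))
  (gr : forall r, 0 < r -> r <= rho -> Int (fun t => near_ball x r t * g t) <= 2 * eta * r).

Lemma itg_Pg e : 0 < e -> itg (fun t => Pois e (x - t) * g t).
Proof.
move=> e0; apply: (itg_le _ (itgZ (e + e^-1) gi)) => [|t]; first by mfun.
rewrite ger0_norm ?mulr_ge0 ?Pois_ge0// mulrA ler_wpM2r// !PoisE [leRHS]mulrCA ler_pM2l ?pi0//.
have h1 := den_gt0 (x - t) e0; have h2 := den_gt0 (x - t) ltr01.
rewrite /pk ler_pdivrMr// mul1r mulrAC ler_pdivlMr//.
have -> : (e + e^-1) * ((x - t) ^+ 2 + e ^+ 2) =
  e * (x - t) ^+ 2 + e * e ^+ 2 + (x - t) ^+ 2 / e + e by field; rewrite gt_eqF.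
have q := sqr_ge0 (x - t).
have : 0 <= e * e ^+ 2 by rewrite mulr_ge0 ?sqr_ge0// ltW.
have : 0 <= (x - t) ^+ 2 / e by rewrite divr_ge0// ltW.
by rewrite expr1n; nra.
Qed.

Let itg_bPg r e : 0 < e -> itg (fun t => near_ball x r t * (Pois e (x - t) * g t)).
Proof.
move=> e0; apply: (@itgM_bdd _ _ _ 1) => //; first exact: mnear_ball.
  by move=> t; rewrite near_ballE; case: ltP; rewrite ?normr0 ?normr1.
exact: itg_Pg.
Qed.

Lemma itg_bg r : itg (fun t => near_ball x r t * g t).
Proof.
apply: (itg_le _ (itgZ (pi * (r ^+ 2 + 1)) gi)) => [|t].
  by apply: measurable_funM => //; exact: mnear_ball.
rewrite ger0_norm ?mulr_ge0 ?near_ball_ge0// mulrA ler_wpM2r//.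
exact: near_ball_Pois.
Qed.

(** On the shell between the radii [2 ^ N * e] and [2 ^ N.+1 * e] the kernel is at most
    [4 ^- N / (pi * e)], while [g] has integral at most [4 * eta * 2 ^ N * e]. The contributions are
    geometric, and [16 - 8 * 2^-1 ^+ N] grows by exactly that amount. The radius is capped because
    [gr] stops at [rho]. *)
Lemma dyadic_bound e N : 0 < e ->
  Int (fun t => near_ball x (Num.min (2 ^+ N * e) rho) t * (Pois e (x - t) * g t))
  <= eta * pi^-1 * (16 - 8 * 2^-1 ^+ N).
Proof.
move=> e0; pose r N := Num.min (2 ^+ N * e) rho.
have r0 n : 0 < r n by rewrite /r lt_min rho0 mulr_gt0// exprn_gt0.
have rr n : r n <= rho by rewrite /r ge_min lexx orbT.
elim: N => [|N IH].
  rewrite -/(r 0%N); apply: (@le_trans _ _ (Int (fun t => kb e * (near_ball x (r 0%N) t * g t)))).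
    apply: Int_le => [||t]; first exact: itg_bPg.
      by apply: itgZ; exact: itg_bg.
    rewrite mulrCA; apply: ler_wpM2r; last exact: Pois_le.
    by rewrite mulr_ge0 ?near_ball_ge0.
  rewrite IntZ; last exact: itg_bg.
  apply: (@le_trans _ _ (kb e * (2 * eta * r 0%N))).
    by rewrite ler_wpM2l ?kb_ge0// gr.
  apply: (@le_trans _ _ (kb e * (2 * eta * e))).
    apply: ler_wpM2l; first exact: kb_ge0.
    apply: ler_wpM2l; first by rewrite mulr_ge0.
    by rewrite /r ge_min expr0 mul1r lexx.
  have -> : kb e * (2 * eta * e) = eta * pi^-1 * 2.
    by rewrite /kb; set p := pi^-1; field; rewrite gt_eqF.
  rewrite ler_wpM2l ?mulr_ge0// ?ltW ?pi0// expr0; lra.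
rewrite -/(r N.+1) -/(r N) in IH *.
pose K := 4 * kb e * 4^-1 ^+ N.+1.
have K0 : 0 <= K.
  apply: mulr_ge0; last by apply: exprn_ge0; rewrite invr_ge0.
  by apply: mulr_ge0 => //; exact: kb_ge0.
apply: (@le_trans _ _ (Int (fun t => near_ball x (r N) t * (Pois e (x - t) * g t) +
    K * (near_ball x (r N.+1) t * g t)))).
  apply: Int_le => [||t]; first exact: itg_bPg.
    by apply: itgD; [exact: itg_bPg|apply: itgZ; exact: itg_bg].
  rewrite !near_ballE; case: (ltP _ (r N.+1)) => h1; last first.
    by rewrite !mul0r mulr0 addr0 !mulr_ge0 ?Pois_ge0.
  rewrite !mul1r; case: (ltP _ (r N)) => h2.
    by rewrite mul1r lerDl mulr_ge0.
  rewrite mul0r add0r ler_wpM2r//.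
  have h3 : 2 ^+ N * e <= `|x - t|.
    move: h2; rewrite /r ge_min => /orP[//|h2].
    by have := lt_le_trans h1 (rr N.+1); rewrite ltNge h2.
  rewrite PoisE /K /kb !mulrA [4 * _]mulrC -!mulrA ler_pM2l ?pi0// /pk.
  have D := den_gt0 (x - t) e0.
  rewrite ler_pdivrMr//.
  have -> : 4 * (e^-1 * (4^-1 ^+ N.+1)) = e^-1 / 4 ^+ N.
    by rewrite exprS exprVn; field; rewrite !gt_eqF// exprn_gt0.
  have f4 : (0 : R) < 4 ^+ N by rewrite exprn_gt0.
  rewrite -invfM mulrC ler_pdivlMr ?mulr_gt0//.
  have : (2 ^+ N * e) ^+ 2 <= `|x - t| ^+ 2.
    by rewrite lerXn2r ?nnegrE ?mulr_ge0 ?exprn_ge0// ltW.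
  rewrite real_normK ?num_real// exprMn -exprM mulnC exprM (_ : 2 ^+ 2 = 4 :> R); last by ring.
  have -> : e * (e * 4 ^+ N) = 4 ^+ N * e ^+ 2 by ring.
  have := sqr_ge0 e; lra.
rewrite IntD; [|exact: itg_bPg|by apply: itgZ; exact: itg_bg].
rewrite IntZ; last exact: itg_bg.
apply: (@le_trans _ _ (eta * pi^-1 * (16 - 8 * 2^-1 ^+ N) + K * (2 * eta * (2 ^+ N.+1 * e)))).
  apply: lerD => //; rewrite ler_wpM2l//.
  apply: (@le_trans _ _ (2 * eta * r N.+1)); first exact: gr.
  by rewrite ler_wpM2l ?mulr_ge0// /r ge_min lexx.
have -> : K * (2 * eta * (2 ^+ N.+1 * e)) = eta * pi^-1 * (8 * 2^-1 ^+ N.+1).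
  rewrite /K /kb; set p := pi^-1.
  have -> : 4^-1 = 2^-1 * 2^-1 :> R by field.
  rewrite exprMn exprVn; field; rewrite !gt_eqF// exprn_gt0//.
have p1 : 0 <= eta * pi^-1 by rewrite mulr_ge0 ?(ltW pi0).
rewrite -mulrDr; apply: ler_wpM2l => //; rewrite exprS. lra.
Qed.

(** Within [rho] the dyadic bound applies. Beyond it, [Pois e] is at most [e * (1 + 1 / rho ^ 2)]
    times [Pois 1], and the factor [e] makes that part vanish in the limit. *)
Lemma Lebesgue_pt_bound e : 0 < e ->
  Int (fun t => Pois e (x - t) * g t) <=
  16 * eta * pi^-1 + e * ((1 + (rho ^+ 2)^-1) * Int (fun t => Pois 1 (x - t) * g t)).
Proof.
move=> e0.
pose N := Num.truncn (rho / e).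
have rN : rho <= 2 ^+ N * e.
  rewrite -ler_pdivrMr//; apply: (le_trans (ltW (truncnS_gt _))).
  by rewrite -natrX ler_nat; exact: ltn_expl.
have := dyadic_bound N e0; rewrite (min_idPr rN) => H.
pose C := (1 + (rho ^+ 2)^-1).
apply: (@le_trans _ _ (Int (fun t => near_ball x rho t * (Pois e (x - t) * g t) +
    e * C * (Pois 1 (x - t) * g t)))).
  apply: Int_le => [||t]; first exact: itg_Pg.
    by apply: itgD; [exact: itg_bPg|apply: itgZ].
  rewrite near_ballE; case: ltP => h; rewrite ?mul1r ?mul0r ?add0r.
    by rewrite lerDl !mulr_ge0 ?Pois_ge0// ?(ltW e0)// /C addr_ge0// invr_ge0 sqr_ge0.
  rewrite mulrA ler_wpM2r// !PoisE [leRHS]mulrCA ler_pM2l ?pi0// /pk.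
  have h1 := den_gt0 (x - t) e0; have h2 := den_gt0 (x - t) ltr01.
  rewrite -mulrA ler_pM2l// mul1r -lef_pV2 ?posrE ?invr_gt0// ?mulr_gt0 ?invr_gt0//; last first.
    by rewrite /C addr_gt0// invr_gt0 exprn_gt0.
  have C0 : 0 < C by rewrite /C addr_gt0// invr_gt0 exprn_gt0.
  rewrite invfM !invrK mulrC ler_pdivrMr//.
  have hh : rho ^+ 2 <= (x - t) ^+ 2.
    by rewrite -(real_normK (num_real (x - t))) lerXn2r ?nnegrE// ltW.
  have r2 : 0 < rho ^+ 2 by rewrite exprn_gt0.
  have : 1 <= (x - t) ^+ 2 * (rho ^+ 2)^-1 by rewrite ler_pdivlMr// mul1r.
  have := sqr_ge0 e; have : 0 <= e ^+ 2 * (rho ^+ 2)^-1 by rewrite divr_ge0 ?sqr_ge0.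
  rewrite /C expr1n; lra.
rewrite IntD; [|exact: itg_bPg|exact: itgZ].
rewrite IntZ//; apply: lerD; last by rewrite mulrA.
apply: (le_trans H).
have -> : 16 * eta * pi^-1 = eta * pi^-1 * 16 by ring.
rewrite ler_wpM2l ?mulr_ge0// ?ltW ?pi0//.
have : (0 : R) < 2^-1 ^+ N by rewrite exprn_gt0.
lra.
Qed.
End dyadic.

End Lebesgue.

Section Lebesgue.
Context {R : realType}.
Notation mu := (@lebesgue_measure R).
Local Notation Po e := (cv (Pois e)).
Local Notation Qo e := (cv (Conj e)).
Implicit Types (f g h k l : R -> R) (d e t s x a B : R).

Lemma itg_Pois_L2 e x h : 0 < e -> measurable_fun [set: R] h -> itg (fun t => h t ^+ 2) ->
  itg (fun t => Pois e (x - t) * h t).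
Proof.
move=> e0 mh hi.
apply: (itg_le _ (itgD (itgP2 x e0) (cv_itg (mP e0) (fun u => Pois_nle u e0) x hi))).
  by mfun.
move=> t; have p0 := Pois_ge0 (x - t) e0; rewrite normrM (ger0_norm p0).
rewrite [leRHS](_ : _ = Pois e (x - t) * (1 + h t ^+ 2)); last by ring.
apply: ler_wpM2l => //.
have := sqr_ge0 (`|h t| - 1); rewrite -(real_normK (num_real (h t))).
have := sqr_ge0 `|h t|; nra.
Qed.

Lemma locally_integrable_L2 h : measurable_fun [set: R] h -> itg (fun t => h t ^+ 2) ->
  locally_integrable [set: R] h.
Proof.
move=> mh hi; split => //; first exact: openT.
move=> K _ cK.
have mK := compact_measurable cK.
have m1 : measurable_fun [set: R] (fun x => `|h x|) by mfun.
have m2 : measurable_fun [set: R] (fun x => 1 + h x ^+ 2) by mfun.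
have m3 : measurable_fun [set: R] (fun x => h x ^+ 2) by mfun.
apply: (@le_lt_trans _ _ (\int[mu]_(x in K) (1 + h x ^+ 2)%:E)%E).
  apply: ge0_le_integral => //.
  - by apply/measurable_EFinP; apply: measurable_funTS; exact: m1.
  - by apply/measurable_EFinP; apply: measurable_funTS; exact: m2.
  - move=> x _; rewrite lee_fin.
    have := sqr_ge0 (`|h x| - 1); rewrite -(real_normK (num_real (h x))).
    have := sqr_ge0 `|h x|; nra.
under eq_integral do rewrite EFinD.
rewrite ge0_integralD//; last 2 first.
  - by move=> x _; rewrite lee_fin sqr_ge0.
  - by apply/measurable_EFinP; apply: measurable_funTS; exact: m3.
rewrite integral_cst// mul1e lte_add_pinfty//; first exact: compact_finite_measure.
apply: (le_lt_trans _ (itg_lty hi)).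
under [leRHS]eq_integral do rewrite ger0_norm ?sqr_ge0//.
apply: ge0_subset_integral => //.
  by apply/measurable_EFinP; exact: m3.
by move=> x _; rewrite lee_fin sqr_ge0.
Qed.

(** Lebesgue points with averages against the Poisson kernel instead of intervals: any kernel
    dominated by [Pois e] then inherits the limit directly. *)
Definition Leb_pt h x := forall eta, 0 < eta -> exists2 d, 0 < d & forall e, 0 < e -> e < d ->
  Int (fun t => Pois e (x - t) * `|h t - h x|) <= eta.

Lemma ae_Leb_pt h : measurable_fun [set: R] h -> itg (fun t => h t ^+ 2) ->
  {ae mu, forall x, Leb_pt h x}.
Proof.
move=> mh hi; have := lebesgue_differentiation (locally_integrable_L2 mh hi).
apply: aeS => x /lebesgue_ptP H eta eta0.
(* [Lebesgue_pt_bound] returns [16 / pi] times this, at most [eta / 2] because [pi >= 2]; the other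
   half is for the far part. *)
have e16 : 0 < eta / 16 by rewrite divr_gt0.
have [rho rho0 Hr] := H _ e16.
pose g t := `|h t - h x|.
have mg : measurable_fun [set: R] g by rewrite /g; mfun.
have gi : itg (fun t => Pois 1 (x - t) * g t).
  apply: (itg_le _ (itgD (itg_abs (itg_Pois_L2 x ltr01 mh hi)) (itgZ `|h x| (itgP2 x ltr01)))).
    by mfun.
  move=> t; rewrite /g !normrM normr_id (ger0_norm (Pois_ge0 _ ltr01)).
  rewrite [leRHS](_ : _ = Pois 1 (x - t) * (`|h t| + `|h x|)); last by ring.
  by apply: ler_wpM2l; [exact: Pois_ge0|exact: ler_normB].
have gr r : 0 < r -> r <= rho -> Int (fun t => near_ball x r t * g t) <= 2 * (eta / 16) * r.
  move=> r0 rr; rewrite -lee_fin -IntE; last exact: (itg_bg mg (fun t => normr_ge0 _) gi).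
  apply: le_trans (Hr r r0 rr); rewrite le_eqVlt; apply/orP; left; apply/eqP.
  rewrite [RHS]integral_mkcond; apply: eq_integral => t _.
  rewrite /near_ball restrict_EFin/= patchE indicE; case: (t \in _); rewrite ?mul1r ?mul0r//.
have B e (e0 : 0 < e) := Lebesgue_pt_bound rho0 (ltW e16) mg
  (fun t => normr_ge0 _) gi gr e0.
pose K := (1 + (rho ^+ 2)^-1) * Int (fun t => Pois 1 (x - t) * g t).
have K0 : 0 <= K.
  rewrite /K mulr_ge0 ?addr_ge0 ?invr_ge0 ?sqr_ge0//.
  by apply: Int_ge0 => t; rewrite mulr_ge0 ?Pois_ge0// /g.
have pp : pi^-1 <= 2^-1 :> R by rewrite lef_pV2 ?posrE ?pi_gt0// pi_ge2.
exists (eta / (2 * (K + 1))).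
  by rewrite divr_gt0// mulr_gt0// ltr_wpDl.
move=> e e0 ed; apply: (le_trans (B e e0)); rewrite -/K.
have : e * (K + 1) <= eta / 2.
  move: ed; rewrite ltr_pdivlMr ?mulr_gt0 ?ltr_wpDl// => h1.
  rewrite ler_pdivlMr// -mulrA [(K + 1) * 2]mulrC; exact: ltW.
have -> : 16 * (eta / 16) * pi^-1 = eta * pi^-1 by congr (_ * _); field.
have : eta * pi^-1 <= eta * 2^-1 by rewrite ler_pM2l.
rewrite mulrDr mulr1; lra.
Qed.

Lemma Po_Leb h x eta : measurable_fun [set: R] h -> itg (fun t => h t ^+ 2) ->
  Leb_pt h x -> 0 < eta ->
  exists2 d, 0 < d & forall e, 0 < e -> e < d -> `|Po e h x - h x| <= eta.
Proof.
move=> mh hi H /H[d d0 Hd]; exists d => // e e0 ed; apply: le_trans (Hd e e0 ed).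
rewrite -[X in _ - X]mulr1 -(IntP2 x e0) -IntZ; last exact: itgP2.
rewrite -IntB; [|exact: itg_Pois_L2|by apply: itgZ; exact: itgP2].
have E t : Pois e (x - t) * h t - h x * Pois e (x - t) = Pois e (x - t) * (h t - h x) by ring.
have i : itg (fun t => Pois e (x - t) * (h t - h x)).
  apply: (eq_itg E); apply: itgB; [exact: itg_Pois_L2|by apply: itgZ; exact: itgP2].
rewrite (eq_Int E); apply: (le_trans (Int_abs i)).
by rewrite le_eqVlt; apply/orP; left; apply/eqP/eq_Int => t; rewrite normrM ger0_norm ?Pois_ge0.
Qed.

Lemma refl_measure x (A : set R) : measurable A ->
  mu ((fun t => x - t) @^-1` A) = mu A.
Proof.
move=> mA.
have mT : measurable_fun [set: R] (fun t : R => x - t) by mfun.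
rewrite -[LHS]/(pushforward mu (fun t : R => x - t : measurableTypeR R) A).
apply/esym/lebesgue_measure_unique => //= _ [[c d]] _ <-.
rewrite /pushforward.
have -> : (fun t : R => x - t) @^-1` `]c, d]%classic = `[x - d, x - c[%classic.
  by apply/seteqP; split => t /=; rewrite !in_itv/= => /andP[? ?]; apply/andP; split; lra.
rewrite !lebesgue_measure_itv/= !lte_fin ltrD2l ltrN2; case: ifP => // _.
by rewrite -!EFinB; congr EFin; ring.
Qed.

Lemma Int_refl g x : itg (fun t => g (x - t)) -> measurable_fun [set: R] g ->
  Int (fun t => g (x - t)) = Int g.
Proof.
move=> gi mg.
pose T : measurableTypeR R -> measurableTypeR R := fun t => x - t.
have mT : measurable_fun [set: measurableTypeR R] T.
  by have m : measurable_fun [set: R] (fun t : R => x - t) by mfun; exact: m.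
pose G : measurableTypeR R -> \bar R := EFin \o g.
have mE : measurable_fun [set: measurableTypeR R] G by exact/measurable_EFinP.
have gi' : mu.-integrable (T @^-1` setT) (G \o T).
  by move: gi; rewrite itgE.
have := @integral_pushforward _ _ _ _ _ _ mT mu setT _ mE gi' measurableT.
rewrite preimage_setT => E.
rewrite !IntEfine; congr fine; rewrite -[LHS]E.
apply: eq_measure_integral => A mA _; exact: refl_measure.
Qed.

(** The kernel of the truncated Hilbert transform minus the smoothed one. It is odd and dominated by
    [Pois e], which is what carries convergence of [Qo e f] over to the principal value. *)
Definition trunc_diff e u : R := ((e < `|u|)%R%:R / (pi * u)) - Conj e u.

Lemma trunc_diff_le e u : 0 < e -> `|trunc_diff e u| <= Pois e u.
Proof.
move=> e0; rewrite /trunc_diff ConjE PoisE invfM mulrCA -mulrBr normrM gtr0_norm ?pi0//.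
rewrite ler_pM2l ?pi0// /qk /pk; have D := den_gt0 u e0.
case: ltP => h.
  have u0 : u != 0 by rewrite -normr_gt0 (lt_trans e0).
  have -> : 1%:R / u - u / (u ^+ 2 + e ^+ 2) = (e / (u ^+ 2 + e ^+ 2)) * (e / u).
    by field; rewrite u0 gt_eqF.
  rewrite normrM ger0_norm ?divr_ge0 ?(ltW e0) ?(ltW D)// ler_piMr//.
    by rewrite divr_ge0 ?(ltW e0) ?(ltW D).
  by rewrite normrM normfV gtr0_norm// ler_pdivrMr ?normr_gt0// mul1r ltW.
rewrite mul0r sub0r normrN normrM normfV (gtr0_norm D).
by rewrite ler_pM2r ?invr_gt0.
Qed.

Lemma trunc_diff_odd e u : trunc_diff e (- u) = - trunc_diff e u.
Proof.
rewrite /trunc_diff normrN mulrN invrN mulrN.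
have -> : Conj e (- u) = - Conj e u by rewrite -sub0r Q_anti subr0.
by ring.
Qed.

Lemma measurable_trunc_diff e : 0 < e -> measurable_fun [set: R] (trunc_diff e).
Proof.
move=> e0.
have mi : measurable_fun [set: R] (fun u : R => u^-1).
  (* At [u = 0] both sides vanish, the inverse of 0 being 0. *)
  have -> : (fun u : R => u^-1) = fun u => u * expR (- ln (u ^+ 2)).
    apply/funext => u; have [->|u0] := eqVneq u 0; first by rewrite invr0 mul0r.
    rewrite expRN lnK ?posrE ?exprn_even_gt0// expr2 invfM mulrA divff// mul1r//.
  apply: measurable_funM; first exact: measurable_id.
  apply: measurableT_comp; first exact: measurable_expR.
  apply: measurableT_comp => //; apply: measurableT_comp; first exact: measurable_ln.
  by mfun.
have mb : measurable_fun [set: R] (fun u : R => (e < `|u|)%R%:R : R).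
  have -> : (fun u : R => (e < `|u|)%R%:R : R) = fun u => if e < `|u| then 1 else 0.
    by apply/funext => u; case: ltP.
  apply: measurable_fun_ifT; [|exact: measurable_cst|exact: measurable_cst].
  by apply: measurable_fun_ltr; mfun.
have -> : trunc_diff e = fun u => (e < `|u|)%R%:R * (pi^-1 * u^-1) - Conj e (u - 0).
  by apply/funext => u; rewrite /trunc_diff subr0 invfM.
apply: measurable_funB; last by mfun.
by apply: measurable_funM => //; apply: measurable_funM.
Qed.

Lemma Int_trunc_diff e x : 0 < e ->
  itg (fun t => trunc_diff e (x - t)) /\ Int (fun t => trunc_diff e (x - t)) = 0.
Proof.
move=> e0; have m := measurable_trunc_diff e0.
have i y : itg (fun t => trunc_diff e (y - t)).
  apply: (itg_le _ (itgP2 y e0)); first by mfun.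
  by move=> t; exact: trunc_diff_le.
split; first exact: i.
have m' : measurable_fun [set: R] (fun u => trunc_diff e (0 - u)) by mfun.
have E1 := Int_refl (i x) m.
have E2 : Int (fun u => trunc_diff e (0 - u)) = Int (trunc_diff e) by exact: Int_refl (i 0) m.
have E3 : Int (fun u => trunc_diff e (0 - u)) = - Int (trunc_diff e).
  rewrite -mulN1r -IntZ.
    by apply: eq_Int => u; rewrite sub0r trunc_diff_odd mulN1r.
  apply: eq_itg (itgZ (-1) (i 0)) => u.
  by rewrite mulN1r sub0r trunc_diff_odd opprK.
rewrite E1; move: E3; rewrite E2; lra.
Qed.

Lemma trunc_hilbertE f e x : 0 < e -> itg f ->
  trunc_hilbert f e x = cv (trunc_diff e) f x + Qo e f x.
Proof.
move=> e0 fi; have m := measurable_trunc_diff e0.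
have b u : `|trunc_diff e u| <= kb e.
  exact: le_trans (trunc_diff_le u e0) (Pois_le u e0).
rewrite -IntD; [|exact: (cv_itg m b x fi)|exact: (cv_itg (mQ e0) (fun u => Conj_le u e0) x fi)].
have E t : trunc_diff e (x - t) * f t + Conj e (x - t) * f t =
   pi^-1 * (((fun t => f t / (x - t)) \_ [set t | e < `|x - t|]) t).
  rewrite -mulrDl /trunc_diff subrK patchE invfM.
  case: ltP => h; last first.
    by rewrite memNset ?mulr0 ?mul0r//= => /lt_geF; rewrite h.
  by rewrite mem_set// mul1r mulrAC mulrA.
rewrite (eq_Int E) IntZ ?Int_restrict//.
have i := itgD (cv_itg m b x fi) (cv_itg (mQ e0) (fun u => Conj_le u e0) x fi).
apply: (eq_itg _ (itgZ pi i)) => t; rewrite E mulrA divff ?mul1r// gt_eqF ?pi_gt0//.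
Qed.

(** Since [trunc_diff] has integral 0, the constant [f x] may be subtracted from [f]; domination by
    [Pois e] then brings in [Leb_pt]. *)
Lemma trunc_cv_Leb f x eta : itg f ->
  measurable_fun [set: R] f -> itg (fun t => f t ^+ 2) -> Leb_pt f x -> 0 < eta ->
  exists2 d, 0 < d & forall e, 0 < e -> e < d -> `|cv (trunc_diff e) f x| <= eta.
Proof.
move=> fi mf fi2 H /H[d d0 Hd]; exists d => // e e0 ed; apply: le_trans (Hd e e0 ed).
have m := measurable_trunc_diff e0.
have b u : `|trunc_diff e u| <= kb e.
  exact: le_trans (trunc_diff_le u e0) (Pois_le u e0).
have [i I0] := Int_trunc_diff x e0.
have -> : cv (trunc_diff e) f x = Int (fun t => trunc_diff e (x - t) * (f t - f x)).
  rewrite -[LHS]subr0 -[X in _ - X](mulr0 (f x)) -I0 -IntZ// -IntB; [|exact: (cv_itg m b x fi)|exact: itgZ].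
  by apply: eq_Int => t; ring.
have P1 : itg (fun t => Pois e (x - t) * (f t - f x)).
  have := itgB (itg_Pois_L2 x e0 mf fi2) (itgZ (f x) (itgP2 x e0)).
  by apply: eq_itg => t; ring.
have P2 : itg (fun t => Pois e (x - t) * `|f t - f x|).
  apply: eq_itg (itg_abs P1) => t; rewrite normrM ger0_norm ?Pois_ge0//.
apply: Int_absle => //.
  apply: (itg_le _ P2); first by mfun.
  by move=> t; rewrite normrM ler_wpM2r// trunc_diff_le.
by move=> t; rewrite normrM ler_wpM2r// trunc_diff_le.
Qed.

End Lebesgue.

(** * The Hilbert transform on L2 *)

Section HilbertL2.
Context {R : realType}.
Notation mu := (@lebesgue_measure R).
Local Notation Po e := (cv (Pois e)).
Local Notation Qo e := (cv (Conj e)).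
Implicit Types (f g h k l : R -> R) (d e t s x a B : R).

Lemma itg_sqrB f g : measurable_fun [set: R] f -> measurable_fun [set: R] g ->
  itg (fun x => f x ^+ 2) -> itg (fun x => g x ^+ 2) -> itg (fun x => (f x - g x) ^+ 2).
Proof.
move=> mf mg fi gi; apply: (itg_le _ (itgD (itgZ 2 fi) (itgZ 2 gi))); first by mfun.
move=> x; rewrite ger0_norm ?sqr_ge0//.
by have := sqr_ge0 (f x + g x); rewrite !expr2; nra.
Qed.

Definition eps n : R := n.+1%:R^-1.

Lemma eps_gt0 n : 0 < eps n.
Proof. by rewrite invr_gt0. Qed.

Lemma cvg_eps : eps n @[n --> \oo] --> 0.
Proof. exact: cvg_harmonic. Qed.

Lemma eps_lt d : 0 < d -> exists N, forall n, (N <= n)%N -> eps n < d.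
Proof.
move=> d0; have /cvgrPdist_lt /(_ _ d0)[N _ HN] := cvg_eps.
by exists N => n Nn; have := HN n Nn; rewrite /= sub0r normrN gtr0_norm ?eps_gt0.
Qed.

Lemma Cauchy_arith (A B C : R) : C <= B -> A - 2 * B + C <= A - C.
Proof. lra. Qed.

Lemma sup_arith (A B C D eta : R) : D - eta < C -> C <= B -> A <= D -> A - B <= eta.
Proof. lra. Qed.

Lemma dist_arith (A B C c : R) : `|A| <= c / 2 -> `|B - C| <= c / 2 -> `|C - (A + B)| <= c.
Proof. by rewrite !ler_norml; lra. Qed.

Lemma mid_arith d e : d != e -> d <= e -> 0 < e - (d + e) / 2.
Proof. by rewrite le_eqVlt => /negbTE -> /=; lra. Qed.

Variables (f : R -> R) (a : R).
Hypotheses (a0 : 0 <= a) (fi : itg f) (f2 : itg (fun t => f t ^+ 2)) (fa : supp a f).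

Let mf : measurable_fun [set: R] f. Proof. exact: itg_meas. Qed.

Let mQf e : 0 < e -> measurable_fun [set: R] (Qo e f).
Proof. by move=> e0; apply: (cv_meas (mQ e0) (fun u => Conj_le u e0) fi). Qed.

Definition N2 e := Int (fun x => Qo e f x ^+ 2).

Lemma itg_Qo2 e : 0 < e -> itg (fun x => Qo e f x ^+ 2).
Proof.
move=> e0; have [i _] := QoQo e0 e0 a0 fi fi fa fa.
by apply: eq_itg i => x; rewrite expr2.
Qed.

Lemma N2_le e : 0 < e -> N2 e <= Int (fun x => f x ^+ 2).
Proof.
move=> e0; have ee : 0 < e + e by exact: addr_gt0.
have [_ E] := QoQo e0 e0 a0 fi fi fa fa.
have -> : N2 e = Int (fun t => f t * Po (e + e) f t).
  by rewrite -E; apply: eq_Int => x; rewrite expr2.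
have [i2 I2] := Po_itg ee f2.
have mPf : measurable_fun [set: R] (Po (e + e) f).
  exact: (cv_meas (mP ee) (fun u => Pois_nle u ee) fi).
have J t : f t * Po (e + e) f t <= 2^-1 * (f t ^+ 2 + Po (e + e) (fun t => f t ^+ 2) t).
  have := Po_sqr ee (cv_itg (mP ee) (fun u => Pois_nle u ee) t fi)
     (cv_itg (mP ee) (fun u => Pois_nle u ee) t f2).
  have := sqr_ge0 (f t - Po (e + e) f t); rewrite !expr2; nra.
have J' t : `|f t * Po (e + e) f t| <= 2^-1 * (f t ^+ 2 + Po (e + e) (fun t => f t ^+ 2) t).
  have := Po_sqr ee (cv_itg (mP ee) (fun u => Pois_nle u ee) t fi)
     (cv_itg (mP ee) (fun u => Pois_nle u ee) t f2).
  rewrite ler_norml; have := sqr_ge0 (f t - Po (e + e) f t).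
  by have := sqr_ge0 (f t + Po (e + e) f t); rewrite !expr2 => *; apply/andP; split; nra.
have iR := itgZ 2^-1 (itgD f2 i2).
have iL : itg (fun t => f t * Po (e + e) f t) by apply: (itg_le _ iR) => //; mfun.
apply: (le_trans (Int_le iL iR J)).
by rewrite (IntZ _ (itgD f2 i2)) (IntD f2 i2) I2; lra.
Qed.

(** [Qo (d + e) f] is a Poisson average of [Qo e f], and averaging contracts the norm. *)
Lemma N2_anti d e : 0 < d -> 0 < e -> N2 (d + e) <= N2 e.
Proof.
move=> d0 e0; have de : 0 < d + e by exact: addr_gt0.
have [i I] := Po_itg d0 (itg_Qo2 e0).
rewrite /N2 -I; apply: Int_le => [||x]; [exact: itg_Qo2|exact: i|].
rewrite -(PoQo d0 e0 x fi); apply: Po_sqr => //.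
- exact: (itg_Pois_L2 x d0 (mQf e0) (itg_Qo2 e0)).
- exact: (cv_itg (mP d0) (fun u => Pois_nle u d0) x (itg_Qo2 e0)).
Qed.

(* [<Q_d f, Q_e f> = <f, P_(d+e) f>] is monotone in [d + e]; hence the norms are
   Cauchy and so are the functions. *)
Lemma Qo_Cauchy_N2 d e : 0 < d -> d <= e ->
  Int (fun x => (Qo d f x - Qo e f x) ^+ 2) <= N2 d - N2 e.
Proof.
move=> d0 de; have e0 : 0 < e by exact: lt_le_trans de.
have [i E] := QoQo d0 e0 a0 fi fi fa fa.
(* The inner product depends on [d + e] alone, so it is the squared norm at the midpoint. *)
pose m := (d + e) / 2; have m0 : 0 < m by rewrite divr_gt0// addr_gt0.
have [_ E'] := QoQo m0 m0 a0 fi fi fa fa.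
have mm : m + m = d + e by rewrite /m; field.
have NE : Int (fun x => Qo d f x * Qo e f x) = N2 m.
  by rewrite E -mm -E'; apply: eq_Int => x; rewrite expr2.
have -> : Int (fun x => (Qo d f x - Qo e f x) ^+ 2) = N2 d - 2 * N2 m + N2 e.
  rewrite -NE /N2 -(IntZ _ i) -(IntB (itg_Qo2 d0) (itgZ 2 i)).
  rewrite -(IntD (itgB (itg_Qo2 d0) (itgZ 2 i)) (itg_Qo2 e0)).
  by apply: eq_Int => x; ring.
have : N2 e <= N2 m.
  have [de'|ne] := eqVneq d e; first by rewrite /m de' (_ : (e + e) / 2 = e); [exact: lexx|field].
  by have := N2_anti (mid_arith ne de) m0; rewrite subrK.
exact: Cauchy_arith.
Qed.

(** As [e] decreases to 0, [N2 e] increases and stays below the squared norm of [f]; the threshold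
    is a point where it is within [eta] of its supremum. *)
Lemma Qo_Cauchy eta : 0 < eta -> exists2 d0, 0 < d0 & forall d e, 0 < d -> 0 < e ->
  d < d0 -> e < d0 -> Int (fun x => (Qo d f x - Qo e f x) ^+ 2) <= eta.
Proof.
move=> eta0.
pose S := [set N2 e | e in [set e : R | 0 < e]].
have S1 : has_sup S.
  split; first by exists (N2 1), 1 => //=.
  by exists (Int (fun x => f x ^+ 2)) => _ [e /= e0 <-]; exact: N2_le.
have [_ [c /= c0 <-] Hc] := sup_adherent eta0 S1.
have up e : 0 < e -> N2 e <= sup S by move=> e0; apply: sup_upper_bound => //; exists e.
exists c => // d e d0 e0 dc ec.
wlog de : d e d0 e0 dc ec / d <= e => [H|].
  have [h|h] := leP d e; first exact: H.
  rewrite (eq_Int (g := fun x => (Qo e f x - Qo d f x) ^+ 2)); first exact: H (ltW h).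
  by move=> x; rewrite -sqrrN opprB.
apply: (le_trans (Qo_Cauchy_N2 d0 de)).
apply: (sup_arith Hc _ (up d d0)).
by have := @N2_anti (c - e) e; rewrite subrK subr_gt0; apply.
Qed.

Let sub_exists : exists phi : nat -> nat, exists2 h : R -> R, measurable_fun [set: R] h &
    (forall n, (n <= phi n)%N) /\
    {ae mu, forall x, Qo (eps (phi n)) f x @[n --> \oo] --> h x}.
Proof.
apply: (L2_ae_subseq (u := fun n => Qo (eps n) f)).
- by move=> n; exact: mQf (eps_gt0 n).
- move=> m n; apply: itg_sqrB; [exact: mQf (eps_gt0 m)|exact: mQf (eps_gt0 n)|exact: itg_Qo2 (eps_gt0 m)|exact: itg_Qo2 (eps_gt0 n)].
- move=> eta /Qo_Cauchy[d0 d00 H]; have [N HN] := eps_lt d00; exists N => m n Nm Nn.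
  by apply: H; rewrite ?eps_gt0// HN.
Qed.

(** The key is [QP]: [Qo e f] is the Poisson integral of the limit [h]. So at a Lebesgue point of
    [h] the whole family converges and not just a subsequence, and where [f] also has a Lebesgue
    point the principal value exists with the same limit. *)
Theorem hilbert_L2 : exists2 h : R -> R, measurable_fun [set: R] h &
  [/\ itg (fun x => h x ^+ 2), Int (fun x => h x ^+ 2) <= Int (fun x => f x ^+ 2),
    {ae mu, forall x, hilbert f x = h x},
    {ae mu, forall x, Qo (eps n) f x @[n --> \oo] --> h x} &
    forall eta, 0 < eta -> exists2 d, 0 < d & forall e, 0 < e -> e < d ->
      Int (fun x => (Qo e f x - h x) ^+ 2) <= eta ].
Proof.
have [phi [h mh [phin Hae]]] := sub_exists.
exists h => //.
have Q2 n := itg_Qo2 (eps_gt0 n).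
have [hi hI] : itg (fun x => h x ^+ 2) /\ Int (fun x => h x ^+ 2) <= Int (fun x => f x ^+ 2).
  apply: (Fatou_Int (F := fun n x => Qo (eps (phi n)) f x ^+ 2)).
  - by move=> n; exact: Q2.
  - by move=> n x; exact: sqr_ge0.
  - by mfun.
  - by move=> x; exact: sqr_ge0.
  - by apply: aeS Hae => x Hx; apply: cvgM.
  - by move=> n; apply: N2_le (eps_gt0 _).
have hL2 eta : 0 < eta -> exists2 d, 0 < d & forall e, 0 < e -> e < d ->
    Int (fun x => (Qo e f x - h x) ^+ 2) <= eta.
  move=> /Qo_Cauchy[d0 d00 H]; exists d0 => // e e0 ed.
  have [N HN] := eps_lt d00.
  have mQ := mQf e0.
  apply: (Fatou_Int (F := fun n x => (Qo e f x - Qo (eps (phi (n + N))) f x) ^+ 2) _ _ _ _ _ _).2.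
  - move=> n; apply: itg_sqrB; [exact: mQf|exact: mQf (eps_gt0 _)|exact: itg_Qo2|exact: Q2].
  - by move=> n x; exact: sqr_ge0.
  - by mfun.
  - by move=> x; exact: sqr_ge0.
  - apply: aeS Hae => x Hx.
    have Hx' : Qo (eps (phi (n + N))) f x @[n --> \oo] --> h x.
      by move: Hx; rewrite -(cvg_shiftn N).
    have : Qo e f x - Qo (eps (phi (n + N))) f x @[n --> \oo] --> Qo e f x - h x.
      by apply: cvgB => //; exact: cvg_cst.
    by move=> H1; apply: cvgM.
  - move=> n; apply: H => //; first exact: eps_gt0.
    by apply: HN; apply: leq_trans (phin _); exact: leq_addl.
(* Let [n] tend to infinity in [Qo (e + eps n) f = Po e (Qo (eps n) f)], by dominated convergence on
   the left and by [L^2] convergence on the right. *)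
have QP e x : 0 < e -> Qo e f x = Po e h x.
  move=> e0.
  have c1 : Qo (e + eps n) f x @[n --> \oo] --> Qo e f x.
    have m' := mkshift (mQ e0) x.
    apply: (DCT (g := fun t => kb e * `|f t|) _ _ _ _ _).2.
    - by move=> n /=; have en : 0 < e + eps n by [rewrite addr_gt0 ?eps_gt0]; mfun.
    - by mfun.
    - by apply: itgZ; exact: itg_abs.
    - apply: aeT => t; apply: cvgM; last exact: cvg_cst.
      rewrite ConjE (_ : (fun n => Conj (e + eps n) (x - t)) =
        fun n => pi^-1 * ((x - t) / ((x - t) ^+ 2 + (e + eps n) ^+ 2))); last first.
        by apply/funext => n; rewrite ConjE.
      apply: cvgM; first exact: cvg_cst.
      apply: cvgM; first exact: cvg_cst.
      apply: cvgV; first by rewrite gt_eqF// den_gt0.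
      apply: cvgD; first exact: cvg_cst.
      have : e + eps n @[n --> \oo] --> e.
        by rewrite -[X in _ --> X]addr0; apply: cvgD; [exact: cvg_cst|exact: cvg_eps].
      by move=> H1; apply: cvgM.
    - move=> n; apply: aeT => t; rewrite normrM ler_wpM2r//.
      have en : 0 < e + eps n by rewrite addr_gt0 ?eps_gt0.
      apply: (le_trans (Conj_le _ en)); rewrite /kb ler_pM2l ?pi0//.
      by rewrite lef_pV2 ?posrE// lerDl ltW ?eps_gt0.
  have c2 : Qo (e + eps n) f x @[n --> \oo] --> Po e h x.
    apply/cvgrPdist_le => eta eta0.
    have K0 : 0 < eta ^+ 2 / (kb e + 1).
      by rewrite divr_gt0 ?exprn_gt0// ltr_wpDl// kb_ge0.
    have [d d0 Hd] := hL2 _ K0.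
    have [N HN] := eps_lt d0.
    exists N => // n /= Nn.
    rewrite -(PoQo e0 (eps_gt0 n) x fi).
    have mQn := mQf (eps_gt0 n).
    have g2 : itg (fun t => (Qo (eps n) f t - h t) ^+ 2) by apply: itg_sqrB => //; exact: Q2.
    have iB := itgB (itg_Pois_L2 x e0 mQn (Q2 n)) (itg_Pois_L2 x e0 mh hi).
    have -> : Po e h x - Po e (Qo (eps n) f) x = - Po e (fun t => Qo (eps n) f t - h t) x.
      rewrite -opprB; congr (- _); rewrite -IntB; [|exact: (itg_Pois_L2 x e0 mQn (Q2 n))|exact: (itg_Pois_L2 x e0 mh hi)].
      by apply: eq_Int => t; ring.
    rewrite normrN -(ler_pXn2r (_ : 0 < 2)%N)// ?nnegrE ?(ltW eta0)//.
    rewrite real_normK ?num_real//.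
    have ig : itg (fun t => Pois e (x - t) * (Qo (eps n) f t - h t)).
      by apply: eq_itg iB => t; ring.
    have ig2 := cv_itg (mP e0) (fun u => Pois_nle u e0) x g2.
    apply: (le_trans (Po_sqr e0 ig ig2)).
    apply: (le_trans (ler_norm _)).
    apply: (le_trans (cv_le (mP e0) (fun u => Pois_nle u e0) x g2)).
    rewrite (eq_Int (g := fun t => (Qo (eps n) f t - h t) ^+ 2)); last first.
      by move=> t; rewrite ger0_norm ?sqr_ge0.
    apply: (@le_trans _ _ (kb e * (eta ^+ 2 / (kb e + 1)))).
      by apply: ler_wpM2l; [exact: kb_ge0|apply: Hd (eps_gt0 n) (HN n Nn)].
    rewrite mulrCA ler_piMr ?sqr_ge0// ler_pdivrMr ?mul1r ?lerDl//.
    by rewrite ltr_wpDl// kb_ge0.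
  exact: (cvg_unique _ c1 c2).
have aeL := aeS2 (fun x (A : Leb_pt f x) (B : Leb_pt h x) => conj A B)
  (ae_Leb_pt mf f2) (ae_Leb_pt mh hi).
split => //.
- apply: aeS aeL => x [Lf Lh].
  rewrite /hilbert; apply/cvg_lim => //; apply/cvgrPdist_le => eta eta0.
  have e2 : 0 < eta / 2 by rewrite divr_gt0.
  have [d1 d10 H1] := trunc_cv_Leb fi mf f2 Lf e2.
  have [d2 d20 H2] := Po_Leb mh hi Lh e2.
  near=> e.
  have e0 : 0 < e by near: e; exact: nbhs_right_gt.
  have h1 : e < d1 by near: e; exact: nbhs_right_lt.
  have h2 : e < d2 by near: e; exact: nbhs_right_lt.
  rewrite (trunc_hilbertE x e0 fi) (QP e x e0).
  exact: (dist_arith (H1 e e0 h1) (H2 e e0 h2)).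
- apply: aeS aeL => x [_ Lh]; apply/cvgrPdist_le => eta eta0.
  have [d2 d20 H2] := Po_Leb mh hi Lh eta0.
  have [N HN] := eps_lt d20; exists N => // n /= Nn.
  by rewrite (QP _ x (eps_gt0 n)) distrC H2 ?eps_gt0// HN.
Unshelve. all: by end_near.
Qed.
End HilbertL2.

(** * Tricomi's identity and power bounds *)

Section Tricomi.
Context {R : realType}.
Notation mu := (@lebesgue_measure R).
Local Notation Po e := (cv (Pois e)).
Local Notation Qo e := (cv (Conj e)).
Implicit Types (f g h k l : R -> R) (d e t s x a B M : R).

Section identity.
Variables (e x : R) (f : R -> R).
Hypotheses (e0 : 0 < e) (fi : itg f).

(** The quadratic form of [f] with kernel [K]. It does not change when [t] and [s] are swapped in
    [K], so identities between such forms need only hold for symmetrized kernels. *)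
Definition Dint (K : R -> R -> R) := Int (fun t => Int (fun s => K t s * (f t * f s))).

Definition bker (K : R -> R -> R) := measurable_fun [set: R * R] (fun z => K z.1 z.2) /\
  exists B, forall t s, `|K t s| <= B.

Lemma bkerM K L : bker K -> bker L -> bker (fun t s => K t s * L t s).
Proof.
move=> [mK [B HB]] [mL [C HC]]; split.
  exact: (@measurable_funM _ _ _ _ (fun z : R * R => K z.1 z.2) (fun z : R * R => L z.1 z.2)).
by exists (B * C) => t s; rewrite normrM ler_pM.
Qed.

Lemma bkerD K L : bker K -> bker L -> bker (fun t s => K t s + L t s).
Proof.
move=> [mK [B HB]] [mL [C HC]]; split.
  exact: (@measurable_funD _ _ _ _ (fun z : R * R => K z.1 z.2) (fun z : R * R => L z.1 z.2)).
by exists (B + C) => t s; rewrite (le_trans (ler_normD _ _))// lerD.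
Qed.

Lemma bkerZ c K : bker K -> bker (fun t s => c * K t s).
Proof.
move=> [mK [B HB]]; split.
  apply: (@measurable_funM _ _ _ _ (fun z : R * R => c) (fun z : R * R => K z.1 z.2)); [exact: measurable_cst|exact: mK].
by exists (`|c| * B) => t s; rewrite normrM ler_wpM2l.
Qed.

Lemma Dint_facts K : bker K ->
  [/\ forall t, itg (fun s => K t s * (f t * f s)),
      itg (fun t => Int (fun s => K t s * (f t * f s))) &
      Dint K = Dint (fun t s => K s t)].
Proof.
move=> [mK [B HB]].
have B0 : 0 <= B by exact: le_trans (HB 0 0).
have mff : measurable_fun [set: R * R] (fun z : R * R => f z.1 * f z.2) by mfun.
have m2 : measurable_fun [set: R * R] (fun z : R * R => K z.1 z.2 * (f z.1 * f z.2)).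
  exact: (@measurable_funM _ _ _ _ (fun z : R * R => K z.1 z.2) (fun z : R * R => f z.1 * f z.2)).
have [Gt _ i1 _ E] : [/\ forall t, itg (fun s => K t s * (f t * f s)),
    forall s, itg (fun t => K t s * (f t * f s)),
      itg (fun t => Int (fun s => K t s * (f t * f s))),
      itg (fun s => Int (fun t => K t s * (f t * f s))) &
      Int (fun t => Int (fun s => K t s * (f t * f s))) = Int (fun s => Int (fun t => K t s * (f t * f s)))].
  apply: (@FubM _ (fun t s => K t s * (f t * f s)) (fun t => B * `|f t|) (fun t => `|f t|)).
  - exact: m2.
  - by apply: itgZ; exact: itg_abs.
  - exact: itg_abs.
  - by move=> t; rewrite mulr_ge0.
  - by move=> t s; rewrite !normrM -mulrA ler_wpM2r ?mulr_ge0.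
split; [exact: Gt|exact: i1|].
rewrite /Dint E; apply: eq_Int => s; apply: eq_Int => t; by rewrite [f s * _]mulrC.
Qed.

Lemma DintD K L : bker K -> bker L -> Dint (fun t s => K t s + L t s) = Dint K + Dint L.
Proof.
move=> /Dint_facts[Kt Ki _] /Dint_facts[Lt Li _]; rewrite /Dint -IntD; [|exact: Ki|exact: Li].
apply: eq_Int => t; rewrite -IntD; [|exact: Kt|exact: Lt].
by apply: eq_Int => s; rewrite mulrDl.
Qed.

Lemma DintZ c K : bker K -> Dint (fun t s => c * K t s) = c * Dint K.
Proof.
move=> /Dint_facts[Kt Ki _]; rewrite /Dint -IntZ; last exact: Ki.
apply: eq_Int => t; rewrite -IntZ; last exact: Kt.
by apply: eq_Int => s; rewrite -mulrA.
Qed.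

Let Px t := Pois e (x - t).
Let Qx t := Conj e (x - t).

Let bP1 : bker (fun t s => Px t).
Proof. by split; [rewrite /Px; mfun|exists (kb e) => t s; exact: Pois_nle]. Qed.
Let bP2 : bker (fun t s => Px s).
Proof. by split; [rewrite /Px; mfun|exists (kb e) => t s; exact: Pois_nle]. Qed.
Let bQ1 : bker (fun t s => Qx t).
Proof. by split; [rewrite /Qx; mfun|exists (kb e) => t s; exact: Conj_le]. Qed.
Let bQ2 : bker (fun t s => Qx s).
Proof. by split; [rewrite /Qx; mfun|exists (kb e) => t s; exact: Conj_le]. Qed.
Let bP3 : bker (fun t s => Pois e (t - s)).
Proof. by split; [mfun|exists (kb e) => t s; exact: Pois_nle]. Qed.
Let bQ3 : bker (fun t s => Conj e (t - s)).
Proof. by split; [mfun|exists (kb e) => t s; exact: Conj_le]. Qed.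

Let Dprod k l : measurable_fun [set: R] k -> measurable_fun [set: R] l ->
  (exists B, forall x, `|k x| <= B) -> (exists B, forall x, `|l x| <= B) ->
  Int (fun t => k t * f t) * Int (fun t => l t * f t) = Dint (fun t s => k t * l s).
Proof.
move=> mk ml [B HB] [C HC].
have ki : itg (fun t => k t * f t) by exact: (itgM_bdd mk HB fi).
have li : itg (fun t => l t * f t) by exact: (itgM_bdd ml HC fi).
rewrite mulrC -IntZ; last exact: ki.
apply: eq_Int => t; rewrite mulrC -IntZ; last exact: li.
by apply: eq_Int => s; ring.
Qed.

Let Dcv k l : measurable_fun [set: R] l -> (exists B, forall x, `|l x| <= B) ->
  Int (fun t => k t * (f t * cv l f t)) = Dint (fun t s => k t * l (t - s)).
Proof.
move=> ml [B HB]; apply: eq_Int => t; rewrite mulrA -IntZ; last exact: (cv_itg ml HB t fi).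
by apply: eq_Int => s; ring.
Qed.

(** The factor [pi * e] makes [pi * e * Pois e] at most 1, so this cubic expression in the Poisson
    kernel is of the size of the quadratic ones. *)
Definition Scub : R := Po e (fun t => f t * (pi * e * Po e (fun s => Px s * f s) t)) x.

Let ScubE : Scub = Dint (fun t s => pi * e * (Px t * Px s * Pois e (t - s))).
Proof.
have i : itg (fun s => Px s * f s) by exact: (cv_itg (mP e0) (fun u => Pois_nle u e0) x fi).
rewrite /Scub; apply: eq_Int => t; rewrite 2!mulrA mulrA -IntZ.
  by apply: eq_Int => s; rewrite /Px; ring.
exact: (cv_itg (mP e0) (fun u => Pois_nle u e0) t i).
Qed.

(* The cubic term does not disappear as [e -> 0]: its double integral is 1/3, which
   brings the total mass of the right-hand side to 1. *)
Lemma Tricomi_kernel t s : Qx t * Qx s - (Qx t * Conj e (t - s) + Qx s * Conj e (s - t)) =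
  2^-1 * (Px t * Px s) + 2^-1 * (Px t * Pois e (t - s) + Px s * Pois e (s - t))
  - 3 / 2 * (pi * e * (Px t * Px s * Pois e (t - s))).
Proof.
rewrite /Px /Qx !ConjE !PoisE /pk /qk.
have := pi_gt0 R; move: (@pi R) => p p0.
have := den_gt0 (x - t) e0; have := den_gt0 (x - s) e0; have := den_gt0 (t - s) e0.
have := den_gt0 (s - t) e0.
move=> h1 h2 h3 h4; field.
by rewrite !gt_eqF.
Qed.

Lemma Tricomi_eps : Qo e f x ^+ 2 - 2 * Qo e (fun t => f t * Qo e f t) x =
  2^-1 * Po e f x ^+ 2 + Po e (fun t => f t * Po e f t) x - 3 / 2 * Scub.
Proof.
have mPx : measurable_fun [set: R] Px by rewrite /Px; mfun.
have mQx : measurable_fun [set: R] Qx by rewrite /Qx; mfun.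
have bP : exists B, forall y, `|Px y| <= B by exists (kb e) => y; exact: Pois_nle.
have bQ : exists B, forall y, `|Qx y| <= B by exists (kb e) => y; exact: Conj_le.
have bP' : exists B, forall y, `|Pois e y| <= B by exists (kb e) => y; exact: Pois_nle.
have bQ' : exists B, forall y, `|Conj e y| <= B by exists (kb e) => y; exact: Conj_le.
have E1 : Qo e f x ^+ 2 = Dint (fun t s => Qx t * Qx s) by rewrite expr2 -Dprod.
have E2 : Po e f x ^+ 2 = Dint (fun t s => Px t * Px s) by rewrite expr2 -Dprod.
have E3 : Qo e (fun t => f t * Qo e f t) x = Dint (fun t s => Qx t * Conj e (t - s)).
  exact: (Dcv Qx (mQ e0) bQ').
have E4 : Po e (fun t => f t * Po e f t) x = Dint (fun t s => Px t * Pois e (t - s)).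
  exact: (Dcv Px (mP e0) bP').
have k1 := bkerM bQ1 bQ3; have k2 := bkerM bP1 bP3.
have bQ3' : bker (fun t s => Conj e (s - t)).
  by split; [mfun|exists (kb e) => t s; exact: Conj_le].
have bP3' : bker (fun t s => Pois e (s - t)).
  by split; [mfun|exists (kb e) => t s; exact: Pois_nle].
have k1' := bkerM bQ2 bQ3'; have k2' := bkerM bP2 bP3'.
(* The two copies are shared between the kernel and its transpose, which is the symmetric form that
   [Tricomi_kernel] resolves. *)
have E3' : 2 * Qo e (fun t => f t * Qo e f t) x =
    Dint (fun t s => Qx t * Conj e (t - s) + Qx s * Conj e (s - t)).
  rewrite (DintD k1 k1') E3 mulr_natl mulr2n; congr (_ + _).
  by have [_ _ ->] := Dint_facts k1.
have E4' : Po e (fun t => f t * Po e f t) x =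
    2^-1 * Dint (fun t s => Px t * Pois e (t - s) + Px s * Pois e (s - t)).
  rewrite (DintD k2 k2') E4.
  have [_ _ <-] := Dint_facts k2; by field.
have b3 := bkerM (bkerM bP1 bP2) bP3.
rewrite E1 E2 E3' E4' ScubE.
have bQQ := bkerM bQ1 bQ2; have bPP := bkerM bP1 bP2.
have kD := bkerD k1 k1'; have kD2 := bkerD k2 k2'.
rewrite -[X in _ - X]mul1r -mulNr -(DintZ _ kD) -(DintD bQQ (bkerZ (-1) kD)).
rewrite -(DintZ _ bPP) -(DintZ _ kD2) -(DintD (bkerZ _ bPP) (bkerZ _ kD2)).
rewrite -[X in _ = _ + X]mulNr -(DintZ _ (bkerZ _ b3)) -(DintD (bkerD (bkerZ _ bPP) (bkerZ _ kD2)) (bkerZ _ (bkerZ _ b3))).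
apply: eq_Int => t; apply: eq_Int => s; congr (_ * _).
rewrite mulN1r (Tricomi_kernel t s) mulNr; by [].
Qed.

End identity.
End Tricomi.

(** * Poisson bounds for the remainder in Tricomi's identity *)

Section Bounds.
Context {R : realType}.
Notation mu := (@lebesgue_measure R).
Local Notation Po e := (cv (Pois e)).
Local Notation Qo e := (cv (Conj e)).
Implicit Types (f g h : R -> R) (d e t s x a B M N : R).

Lemma absM_arith (p q y : R) : p ^+ 2 <= q -> `|y * p| <= 2^-1 * y ^+ 2 + 2^-1 * q.
Proof.
move=> pq; rewrite ler_norml; have := sqr_ge0 (y - p); have := sqr_ge0 (y + p).
by rewrite !expr2 in pq * => *; apply/andP; split; nra.
Qed.

Lemma rem_arith (s p q r u v : R) : 0 <= p -> `|s| <= q -> `|r| <= 2^-1 * u + 2^-1 * v ->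
  q <= u -> p <= q -> 0 <= v -> `|2^-1 * p + r - 3 / 2 * s| <= 3 * (u + v).
Proof. by rewrite !ler_norml; lra. Qed.

Definition bsupp a M f := [/\ measurable_fun [set: R] f, forall x, `|f x| <= M & supp a f].

Lemma bsupp_itg a M f : bsupp a M f -> itg f.
Proof.
move=> [mf fM fa]; apply: (itg_le mf (itgZ M (itg_near_ball 0 (a + 1)))) => x.
rewrite near_ballE sub0r normrN; case: ltP => h; first by rewrite mulr1.
by rewrite mulr0 (fa x) ?normr0//; apply: lt_le_trans h; rewrite ltrDl.
Qed.

Lemma bsuppM a M N f g : bsupp a M f -> measurable_fun [set: R] g -> (forall x, `|g x| <= N) ->
  bsupp a (M * N) (fun x => f x * g x).
Proof.
move=> [mf fM fa] mg gN; split; first by mfun.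
  by move=> x; rewrite normrM ler_pM.
by move=> x /fa ->; rewrite mul0r.
Qed.

Lemma bsuppX a M f n : bsupp a M f -> bsupp a (M ^+ n.+1) (fun x => f x ^+ n.+1).
Proof.
move=> [mf fM fa]; split; first by mfun.
  by move=> x; rewrite normrX lerXn2r ?nnegrE// (le_trans _ (fM x)).
by move=> x /fa ->; rewrite expr0n.
Qed.

Lemma bsupp_abs a M f : bsupp a M f -> bsupp a M (fun x => `|f x|).
Proof.
move=> [mf fM fa]; split; first by mfun.
  by move=> x; rewrite normr_id.
by move=> x /fa ->; rewrite normr0.
Qed.

Lemma pow2S k : (2 ^ k = (2 ^ k).-1.+1)%N.
Proof. by rewrite prednK// expn_gt0. Qed.

Lemma bsupp_pow2 a M f k : bsupp a M f -> bsupp a (M ^+ (2 ^ k)) (fun x => f x ^+ (2 ^ k)).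
Proof. rewrite pow2S; exact: bsuppX. Qed.

(** Jensen's inequality for dyadic exponents, by iterating [Po_sqr]. *)
Lemma Po_pow e x g M k : 0 < e -> measurable_fun [set: R] g -> (forall t, 0 <= g t) ->
  (forall t, g t <= M) -> Po e g x ^+ (2 ^ k) <= Po e (fun t => g t ^+ (2 ^ k)) x.
Proof.
move=> e0 mg g0 gM.
have M0 : 0 <= M by exact: le_trans (g0 0) (gM 0).
have i n : itg (fun t => Pois e (x - t) * g t ^+ n).
  have mgn : measurable_fun [set: R] (fun t => g t ^+ n) by mfun.
  have gn t : `|g t ^+ n| <= M ^+ n by rewrite ger0_norm ?exprn_ge0// lerXn2r ?nnegrE.
  by apply: eq_itg (itgM_bdd mgn gn (itgP2 x e0)) => t; rewrite mulrC.
elim: k => [|k IH].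
  by rewrite expn0 expr1; apply: Int_le; [exact: eq_itg (i 1%N)|exact: eq_itg (i 1%N)|].
rewrite expnSr exprM.
have g2k t : 0 <= g t ^+ (2 ^ k) by rewrite exprn_ge0.
apply: (@le_trans _ _ (Po e (fun t => g t ^+ (2 ^ k)) x ^+ 2)).
  rewrite lerXn2r ?nnegrE ?exprn_ge0//; exact: Po_ge0.
apply: (le_trans (Po_sqr e0 (i _) _)).
  by apply: eq_itg (i (2 ^ k * 2)%N) => t; rewrite exprM.
by rewrite le_eqVlt; apply/orP; left; apply/eqP/eq_Int => t; rewrite exprM.
Qed.

Lemma Po_bnd e g M x : 0 < e -> measurable_fun [set: R] g -> (forall t, `|g t| <= M) -> `|Po e g x| <= M.
Proof.
move=> e0 mg gM.
have i : itg (fun t => Pois e (x - t) * g t).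
  by apply: eq_itg (itgM_bdd mg gM (itgP2 x e0)) => t; rewrite mulrC.
rewrite -[leRHS]mulr1 -(IntP2 x e0) -IntZ; last exact: itgP2.
apply: Int_absle; [exact: i|by apply: itgZ; exact: itgP2|].
by move=> t; rewrite normrM (ger0_norm (Pois_ge0 _ e0)) mulrC ler_wpM2r ?Pois_ge0.
Qed.

Lemma Po_le e f g x : 0 < e -> itg f -> itg g -> (forall t, f t <= g t) -> Po e f x <= Po e g x.
Proof.
move=> e0 fi gi fg.
apply: Int_le; [exact: (cv_itg (mP e0) (fun u => Pois_nle u e0) x fi)|exact: (cv_itg (mP e0) (fun u => Pois_nle u e0) x gi)|].
by move=> t; rewrite ler_wpM2l ?Pois_ge0.
Qed.

Lemma Po_abs e f x : 0 < e -> itg f -> `|Po e f x| <= Po e (fun t => `|f t|) x.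
Proof.
move=> e0 fi; apply: Int_absle.
- exact: (cv_itg (mP e0) (fun u => Pois_nle u e0) x fi).
- exact: (cv_itg (mP e0) (fun u => Pois_nle u e0) x (itg_abs fi)).
- by move=> t; rewrite normrM (ger0_norm (Pois_ge0 _ e0)).
Qed.

Lemma Po_meas e f : 0 < e -> itg f -> measurable_fun [set: R] (Po e f).
Proof. by move=> e0 fi; exact: (cv_meas (mP e0) (fun u => Pois_nle u e0) fi). Qed.

Lemma Qo_meas e f : 0 < e -> itg f -> measurable_fun [set: R] (Qo e f).
Proof. by move=> e0 fi; exact: (cv_meas (mQ e0) (fun u => Conj_le u e0) fi). Qed.

Section cubic.
Variables (e a M : R) (f : R -> R).
Hypotheses (e0 : 0 < e) (fb : bsupp a M f).

Let fi : itg f. Proof. exact: bsupp_itg fb. Qed.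
Let af t := `|f t|.
Let ab : bsupp a M af. Proof. exact: bsupp_abs. Qed.
Let ai : itg af. Proof. exact: bsupp_itg ab. Qed.

Lemma piePois_le u : pi * e * Pois e u <= 1.
Proof.
have := Pois_le u e0 => h.
have -> : 1 = pi * e * (pi^-1 * e^-1) :> R.
  by rewrite mulrACA divff ?gt_eqF ?pi_gt0// divff ?gt_eqF// mulr1.
by apply: ler_wpM2l => //; rewrite mulr_ge0 ?pi_ge0// ltW.
Qed.

Lemma Scub_inner g x t : itg g ->
  `|pi * e * Po e (fun s => Pois e (x - s) * g s) t| <= Po e (fun s => `|g s|) x.
Proof.
move=> gi.
have pe : 0 <= pi * e by rewrite mulr_ge0 ?pi_ge0// ltW.
have i := cv_itg (mP e0) (fun u => Pois_nle u e0) x gi.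
have i2 := cv_itg (mP e0) (fun u => Pois_nle u e0) t i.
have i3 := cv_itg (mP e0) (fun u => Pois_nle u e0) x (itg_abs gi).
rewrite -(IntZ _ i2); apply: Int_absle; [exact: itgZ i2|exact: i3|].
move=> s; rewrite mulrA normrM ger0_norm; last by rewrite mulr_ge0 ?Pois_ge0.
rewrite normrM (ger0_norm (Pois_ge0 _ e0)) -[leRHS]mul1r.
by apply: ler_wpM2r; [rewrite mulr_ge0 ?Pois_ge0|exact: piePois_le].
Qed.

Lemma Scub_le x : `|Scub e x f| <= Po e af x ^+ 2.
Proof.
have i := cv_itg (mP e0) (fun u => Pois_nle u e0) x fi.
have mV := Po_meas e0 i.
pose V t := pi * e * Po e (fun s => Pois e (x - s) * f s) t.
have mV' : measurable_fun [set: R] V by rewrite /V; mfun.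
have VB t : `|V t| <= Po e af x by exact: Scub_inner.
have fV : itg (fun t => f t * V t).
  by apply: eq_itg (itgM_bdd mV' VB fi) => t; rewrite mulrC.
apply: (le_trans (Po_abs x e0 fV)).
rewrite expr2 -[leRHS](cvZ (mP e0) (fun u => Pois_nle u e0) _ x ai).
apply: Po_le => //; [exact: itg_abs|exact: itgZ|].
by move=> t; rewrite normrM mulrC ler_wpM2r.
Qed.

(** The product is at most half of [f ^ 2 + Po e (f ^ 2)]; averaging the second term once more
    doubles its parameter, by [PoPo]. *)
Lemma PofPof_le x : `|Po e (fun t => f t * Po e f t) x| <=
  2^-1 * Po e (fun t => f t ^+ 2) x + 2^-1 * Po (e + e) (fun t => f t ^+ 2) x.
Proof.
have f2b : bsupp a (M ^+ 2) (fun t => f t ^+ 2) by exact: bsuppX.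
have f2i := bsupp_itg f2b.
have mPf := Po_meas e0 fi.
have [mf fM _] := fb.
have PM t : `|Po e f t| <= M by exact: Po_bnd.
have fP := bsupp_itg (bsuppM fb mPf PM).
rewrite -(PoPo e0 e0 x f2i).
have [P2i _] := Po_itg e0 f2i.
rewrite -(cvZ (mP e0) (fun u => Pois_nle u e0) _ x f2i) -(cvZ (mP e0) (fun u => Pois_nle u e0) _ x P2i).
rewrite -(cvD (mP e0) (fun u => Pois_nle u e0) x (itgZ _ f2i) (itgZ _ P2i)).
apply: (le_trans (Po_abs x e0 fP)).
apply: Po_le => //; [exact: itg_abs|by apply: itgD; exact: itgZ|].
move=> t; have Pg : itg (fun s => Pois e (t - s) * f s) by exact: (cv_itg (mP e0) (fun u => Pois_nle u e0) t fi).
have Pg2 : itg (fun s => Pois e (t - s) * f s ^+ 2) by exact: (cv_itg (mP e0) (fun u => Pois_nle u e0) t f2i).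
exact: (absM_arith _ (Po_sqr e0 Pg Pg2)).
Qed.

(** A bound by Poisson averages of [f ^ 2] serves twice: pointwise it is at most [6 * M ^+ 2],
    uniformly in [e], and by Jensen it is controlled in every dyadic power norm. *)
Lemma Tricomi_rem_le x : `|Qo e f x ^+ 2 - 2 * Qo e (fun t => f t * Qo e f t) x| <=
  3 * (Po e (fun t => f t ^+ 2) x + Po (e + e) (fun t => f t ^+ 2) x).
Proof.
rewrite (Tricomi_eps x e0 fi).
have S := Scub_le x; have F := PofPof_le x.
have [maf aM _] := ab.
have A2 : Po e af x ^+ 2 <= Po e (fun t => f t ^+ 2) x.
  have := @Po_pow e x af M 1 e0 maf (fun t => normr_ge0 _) (fun t => le_trans (ler_norm _) (aM t)).
  rewrite expn1 => h; apply: (le_trans h).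
  by rewrite le_eqVlt; apply/orP; left; apply/eqP/eq_Int => t; rewrite /af real_normK ?num_real.
have A1 : Po e f x ^+ 2 <= Po e af x ^+ 2.
  rewrite -[leLHS](real_normK (num_real _)) lerXn2r ?nnegrE//; last exact: Po_abs.
  by apply: (Po_ge0 e0) => t; exact: normr_ge0.
have A0 : 0 <= Po (e + e) (fun t => f t ^+ 2) x.
  by apply: Po_ge0; [exact: addr_gt0|move=> t; exact: sqr_ge0].
exact: (rem_arith (sqr_ge0 _) S F A2 A1 A0).
Qed.
End cubic.
End Bounds.

(** * Boundedness in dyadic power norms *)

Section Powers.
Context {R : realType}.
Notation mu := (@lebesgue_measure R).
Local Notation Po e := (cv (Pois e)).
Local Notation Qo e := (cv (Conj e)).
Implicit Types (f g h : R -> R) (d e t s x a B M N : R).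

Lemma powD3_le (x y z : R) m : 0 <= x -> 0 <= y -> 0 <= z ->
  (x + y + z) ^+ m <= 3 ^+ m * (x ^+ m + y ^+ m + z ^+ m).
Proof.
move=> x0 y0 z0.
have H (t : R) : 0 <= t -> x + y + z <= 3 * t ->
    t ^+ m <= x ^+ m + y ^+ m + z ^+ m -> (x + y + z) ^+ m <= 3 ^+ m * (x ^+ m + y ^+ m + z ^+ m).
  move=> t0 h1 h2; apply: (@le_trans _ _ ((3 * t) ^+ m)).
    by rewrite lerXn2r ?nnegrE ?mulr_ge0 ?addr_ge0.
  by rewrite exprMn ler_wpM2l ?exprn_ge0.
have X := exprn_ge0 m x0; have Y := exprn_ge0 m y0; have Z := exprn_ge0 m z0.
have [xy|xy] := leP x y; have [yz|yz] := leP y z; have [xz|xz] := leP x z.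
all: try by (apply: (H z); lra).
all: try by (apply: (H y); lra).
all: by (apply: (H x); lra).
Qed.

Lemma even_norm (y : R) k : (0 < k)%N -> y ^+ (2 ^ k) = `|y| ^+ (2 ^ k).
Proof. by case: k => // k _; rewrite expnS !exprM real_normK ?num_real. Qed.

Lemma even_pow_ge0 (y : R) k : (0 < k)%N -> 0 <= y ^+ (2 ^ k).
Proof. by move=> k0; rewrite even_norm// exprn_ge0. Qed.

Lemma Tricomi_pow_arith (T u A B : R) k : (0 < k)%N -> 0 <= A -> 0 <= B ->
  `|T ^+ 2 - 2 * u| <= 3 * (A + B) ->
  T ^+ (2 ^ k.+1) <= 6 ^+ (2 ^ k) * u ^+ (2 ^ k) +
    9 ^+ (2 ^ k) * (A ^+ (2 ^ k) + B ^+ (2 ^ k)).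
Proof.
move=> k0 A0 B0 H; rewrite expnS exprM; set m := (2 ^ k)%N.
have h : T ^+ 2 <= 2 * `|u| + 3 * A + 3 * B.
  by move: H; have := ler_norm u; rewrite ler_norml; lra.
apply: (@le_trans _ _ ((2 * `|u| + 3 * A + 3 * B) ^+ m)).
  by rewrite lerXn2r ?nnegrE ?sqr_ge0 ?addr_ge0 ?mulr_ge0.
apply: (le_trans (powD3_le _ _ _ _)); rewrite ?mulr_ge0//.
rewrite (even_norm u k0) -/m !exprMn.
have -> : 6 = 3 * 2 :> R by ring.
have -> : 9 = 3 * 3 :> R by ring.
rewrite !exprMn; move: (`|u| ^+ m) (A ^+ m) (B ^+ m) (3 ^+ m) (2 ^+ m) => *.
by rewrite le_eqVlt; apply/orP; left; apply/eqP; ring.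
Qed.

(** With the weight [K = C + 1], the term [C * Z] costs at most half of [X], which is moved to the
    left. *)
Lemma absorb_arith (X Y Z C c9 K : R) : 0 <= C -> 0 <= Y -> 0 <= X -> K = C + 1 ->
  Z <= 2^-1 * (K * Y + K^-1 * X) -> X <= C * Z + c9 * (Y + Y) -> X <= (K ^+ 2 + 4 * c9) * Y.
Proof.
move=> C0 Y0 X0 KC hZ hX.
have K0 : 0 < K by rewrite KC; lra.
have h1 : C * Z <= C * (2^-1 * (K * Y + K^-1 * X)) by rewrite ler_wpM2l.
have h2 : C * (K^-1 * X) <= X.
  rewrite mulrA ler_piMl// ler_pdivrMr// mul1r KC; lra.
have h3 : C * (K * Y) <= K ^+ 2 * Y.
  by rewrite mulrA ler_wpM2r// expr2 ler_pM2r// KC; lra.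
have h4 : C * (2^-1 * (K * Y + K^-1 * X)) = 2^-1 * (C * (K * Y)) + 2^-1 * (C * (K^-1 * X)) by ring.
have h5 : (K ^+ 2 + 4 * c9) * Y = K ^+ 2 * Y + 4 * (c9 * Y) by ring.
have h6 : c9 * (Y + Y) = 2 * (c9 * Y) by ring.
rewrite h5; rewrite h6 in hX; rewrite h4 in h1.
move: h1 h2 h3 hX; move: (C * (K * Y)) (C * (K^-1 * X)) (K ^+ 2 * Y) (c9 * Y) (C * Z) => *; lra.
Qed.

Lemma Qo_bnd e f x : 0 < e -> itg f -> `|Qo e f x| <= kb e * Int (fun t => `|f t|).
Proof. by move=> e0 fi; exact: (cv_le (mQ e0) (fun u => Conj_le u e0) x fi). Qed.

Lemma itg_pow f M k : measurable_fun [set: R] f -> (forall x, `|f x| <= M) -> itg (fun x => f x ^+ 2) ->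
  (0 < k)%N -> itg (fun x => f x ^+ (2 ^ k)).
Proof.
move=> mf fM f2; case: k => // k _.
have m : measurable_fun [set: R] (fun x => f x ^+ (2 ^ k.+1 - 2)) by mfun.
have M0 : 0 <= M by exact: le_trans (fM 0).
have b x : `|f x ^+ (2 ^ k.+1 - 2)| <= M ^+ (2 ^ k.+1 - 2).
  by rewrite normrX lerXn2r ?nnegrE.
apply: eq_itg (itgM_bdd m b f2) => x; rewrite -exprD subnK// expnS.
by rewrite leq_pmulr// expn_gt0.
Qed.

Lemma itg_Qo_pow e a M f k : 0 < e -> 0 <= a -> bsupp a M f -> (0 < k)%N ->
  itg (fun x => Qo e f x ^+ (2 ^ k)).
Proof.
move=> e0 a0 fb k0; have fi := bsupp_itg fb; have f2 := bsupp_itg (bsuppX 1 fb).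
have [_ _ fa] := fb.
exact: (itg_pow (Qo_meas e0 fi) (fun x => Qo_bnd x e0 fi) (itg_Qo2 a0 fi fa e0) k0).
Qed.

(* Squaring with Tricomi's identity doubles the exponent. *)
Lemma Qo_pow k : (0 < k)%N -> exists2 C, 0 <= C & forall e f a M, 0 < e -> 0 <= a ->
  bsupp a M f -> Int (fun x => Qo e f x ^+ (2 ^ k)) <= C * Int (fun x => f x ^+ (2 ^ k)).
Proof.
elim: k => // -[_ _|k IH _].
  exists 1 => // e f a M e0 a0 fb; rewrite mul1r.
  have [_ _ fa] := fb.
  exact: (N2_le a0 (bsupp_itg fb) (bsupp_itg (bsuppX 1 fb)) fa e0).
have [C C0 HC] := IH isT; have k0 : (0 < k.+1)%N by [].
set m := (2 ^ k.+1)%N in HC *.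
pose K := 6 ^+ m * C + 1; pose D := K ^+ 2 + 4 * 9 ^+ m.
have K0 : 0 < K by rewrite ltr_wpDl// mulr_ge0// exprn_ge0.
exists D; first by rewrite addr_ge0 ?sqr_ge0// mulr_ge0// exprn_ge0.
move=> e f a M e0 a0 fb.
have fi := bsupp_itg fb; have [mf fM fa] := fb.
pose T := Qo e f; have mT : measurable_fun [set: R] T by exact: Qo_meas.
have TB x : `|T x| <= kb e * Int (fun t => `|f t|) by exact: Qo_bnd.
have fTb := bsuppM fb mT TB; have fTi := bsupp_itg fTb.
pose u := Qo e (fun t => f t * T t).
have f2b := bsuppX 1 fb; have f2i := bsupp_itg f2b; have [mf2 f2M _] := f2b.
pose A := Po e (fun t => f t ^+ 2); pose B := Po (e + e) (fun t => f t ^+ 2).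
have ee : 0 < e + e by exact: addr_gt0.
have f20 t : 0 <= f t ^+ 2 by exact: sqr_ge0.
have A0 x : 0 <= A x by exact: Po_ge0.
have B0 x : 0 <= B x by exact: Po_ge0.
(* Absorbing part of this integral is legitimate only because it is known beforehand to be
   finite. *)
have Tp := itg_Qo_pow e0 a0 fb (isT : (0 < k.+2)%N).
have up : itg (fun x => u x ^+ m) by exact: (itg_Qo_pow e0 a0 fTb k0).
have g2b : bsupp a (M ^+ (2 ^ k.+2)) (fun x => f x ^+ (2 ^ k.+2)) by exact: bsupp_pow2.
have g2i := bsupp_itg g2b.
have g2E : (fun x => f x ^+ (2 ^ k.+2)) = (fun x => (f x ^+ 2) ^+ m).
  by apply/funext => x; rewrite [in LHS]expnS exprM.
have PP c (c0 : 0 < c) : itg (fun x => Po c (fun t => f t ^+ 2) x ^+ m) /\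
    Int (fun x => Po c (fun t => f t ^+ 2) x ^+ m) <= Int (fun x => f x ^+ (2 ^ k.+2)).
  have [i I] := Po_itg c0 g2i.
  have h x : Po c (fun t => f t ^+ 2) x ^+ m <= Po c (fun x => f x ^+ (2 ^ k.+2)) x.
    rewrite g2E; exact: (@Po_pow _ c x (fun t => f t ^+ 2) _ k.+1 c0 mf2 f20 (fun t => le_trans (ler_norm _) (f2M t))).
  have mPc := Po_meas c0 f2i.
  have j : itg (fun x => Po c (fun t => f t ^+ 2) x ^+ m).
    apply: (itg_le _ i); first by mfun.
    by move=> x; rewrite ger0_norm ?exprn_ge0//; exact: Po_ge0.
  by split; [exact: j|rewrite -I; exact: Int_le j i h].
have [Ai AI] := PP e e0; have [Bi BI] := PP (e + e) ee.
have H x : T x ^+ (2 ^ k.+2) <= 6 ^+ m * u x ^+ m + 9 ^+ m * (A x ^+ m + B x ^+ m).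
  exact: (Tricomi_pow_arith k0 (A0 x) (B0 x) (Tricomi_rem_le e0 fb x)).
have iR := itgD (itgZ (6 ^+ m) up) (itgZ (9 ^+ m) (itgD Ai Bi)).
have HI := Int_le Tp iR H.
rewrite (IntD (itgZ (6 ^+ m) up) (itgZ (9 ^+ m) (itgD Ai Bi))) (IntZ _ up) (IntZ _ (itgD Ai Bi)) (IntD Ai Bi) in HI.
(* The bound on [f * T] depends on [e], but the constant [C] of the induction hypothesis does not
   depend on that bound. *)
have uI : Int (fun x => u x ^+ m) <= C * Int (fun x => (f x * T x) ^+ m) by exact: (HC _ _ _ _ e0 a0 fTb).
have fTm : itg (fun x => (f x * T x) ^+ m) by exact: (bsupp_itg (bsupp_pow2 k.+1 fTb)).
have iK := itgZ 2^-1 (itgD (itgZ K g2i) (itgZ K^-1 Tp)).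
have ZI : Int (fun x => (f x * T x) ^+ m) <=
    2^-1 * (K * Int (fun x => f x ^+ (2 ^ k.+2)) + K^-1 * Int (fun x => T x ^+ (2 ^ k.+2))).
  rewrite -(IntZ _ g2i) -(IntZ _ Tp) -(IntD (itgZ K g2i) (itgZ K^-1 Tp)) -(IntZ _ (itgD (itgZ K g2i) (itgZ K^-1 Tp))).
  apply: (Int_le fTm iK) => x; rewrite exprMn [in leRHS]expnSr !exprM -/m.
  move: (f x ^+ m) (T x ^+ m) => y z.
  have : 0 <= K^-1 * (K * y - z) ^+ 2 by rewrite mulr_ge0 ?sqr_ge0// invr_ge0 ltW.
  have -> : K^-1 * (K * y - z) ^+ 2 = K * y ^+ 2 - 2 * (y * z) + K^-1 * z ^+ 2.
    by field; rewrite gt_eqF.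
  by move: (K * y ^+ 2) (K^-1 * z ^+ 2) (y * z) => p q r pqr; rewrite -subr_ge0 (_ : _ - r = 2^-1 * (p - 2 * r + q)); [rewrite mulr_ge0|field].
apply: (absorb_arith _ _ _ (erefl K) ZI).
- by rewrite mulr_ge0// exprn_ge0.
- by apply: Int_ge0 => x; exact: even_pow_ge0.
- by apply: Int_ge0 => x; exact: even_pow_ge0.
- apply: (le_trans HI); apply: lerD.
    by rewrite -mulrA ler_wpM2l ?exprn_ge0.
  by rewrite ler_wpM2l ?exprn_ge0//; exact: lerD.
Qed.
End Powers.

(** * Convergence in dyadic power norms and against the density *)

Section Cauchy.
Context {R : realType}.
Notation mu := (@lebesgue_measure R).
Local Notation Po e := (cv (Pois e)).
Local Notation Qo e := (cv (Conj e)).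
Implicit Types (f g h : R -> R) (d e t s x a B M N : R).

(** Where [|y| >= L] the next dyadic power wins, elsewhere the square does. So a bound at [2 ^ k.+1]
    and the Cauchy property in [L^2] give the Cauchy property at [2 ^ k]. *)
Lemma interp_le (y L : R) k : 1 <= L -> (0 < k)%N ->
  y ^+ (2 ^ k) <= L^-1 * y ^+ (2 ^ k.+1) + L ^+ (2 ^ k - 2) * y ^+ 2.
Proof.
move=> L1 k0; have L0 : 0 < L by exact: lt_le_trans L1.
have k2 : (2 <= 2 ^ k)%N by rewrite -{1}(expn1 2) leq_exp2l.
have p1 : 0 <= y ^+ (2 ^ k.+1) by exact: even_pow_ge0.
have [h|h] := leP L `|y|.
  apply: (@le_trans _ _ (L^-1 * y ^+ (2 ^ k.+1))); last first.
    by rewrite lerDl mulr_ge0 ?sqr_ge0 ?exprn_ge0// ltW.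
  rewrite mulrC ler_pdivlMr// expnSr exprM expr2 ler_wpM2l ?even_pow_ge0//.
  rewrite even_norm//; apply: (le_trans h).
  rewrite -{1}[`|y|]expr1 ler_weXn2l//; first exact: le_trans L1 h.
  by rewrite expn_gt0.
apply: (@le_trans _ _ (L ^+ (2 ^ k - 2) * y ^+ 2)); last first.
  by rewrite lerDr mulr_ge0// invr_ge0 ltW.
have -> : y ^+ (2 ^ k) = `|y| ^+ (2 ^ k - 2) * y ^+ 2.
  by rewrite -(real_normK (num_real y)) -exprD subnK// -even_norm.
by rewrite ler_wpM2r ?sqr_ge0// lerXn2r ?nnegrE ?(ltW L0)// ltW.
Qed.

Lemma sub_pow_le (y z : R) k : (0 < k)%N ->
  (y - z) ^+ (2 ^ k) <= 3 ^+ (2 ^ k) * (y ^+ (2 ^ k) + z ^+ (2 ^ k)).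
Proof.
move=> k0; rewrite (even_norm (y - z) k0) (even_norm y k0) (even_norm z k0).
have := @powD3_le _ `|y| `|z| 0 (2 ^ k) (normr_ge0 _) (normr_ge0 _) (lexx _).
rewrite !addr0 expr0n expn_eq0 /= addr0; apply: le_trans.
by rewrite lerXn2r ?nnegrE ?addr_ge0// ler_normB.
Qed.

Lemma Qo_Cauchy_pow f a M k : 0 <= a -> bsupp a M f -> (0 < k)%N -> forall eta, 0 < eta ->
  exists2 d0, 0 < d0 & forall d e, 0 < d -> 0 < e -> d < d0 -> e < d0 ->
  Int (fun x => (Qo d f x - Qo e f x) ^+ (2 ^ k)) <= eta.
Proof.
move=> a0 fb k0 eta eta0.
have fi := bsupp_itg fb; have f2i := bsupp_itg (bsuppX 1 fb); have [mf fM fa] := fb.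
have [C C0 HC] := @Qo_pow R k.+1 isT.
pose F := Int (fun x => f x ^+ (2 ^ k.+1)).
have F0 : 0 <= F by apply: Int_ge0 => x; exact: even_pow_ge0.
pose D := 3 ^+ (2 ^ k.+1) * (C * F + C * F).
have D0 : 0 <= D by rewrite mulr_ge0 ?exprn_ge0// addr_ge0// mulr_ge0.
(* [D] bounds the power [2 ^ k.+1] of any difference, and this [L] reduces its share to half of
   [eta]. *)
pose L := 1 + 2 * D / eta.
have L1 : 1 <= L by rewrite lerDl; apply: divr_ge0; [exact: mulr_ge0|exact: ltW].
have L0 : 0 < L by exact: lt_le_trans L1.
have LD : L^-1 * D <= eta / 2.
  rewrite mulrC ler_pdivrMr// /L mulrDr mulr1 [eta / 2 * _]mulrC.
  rewrite (_ : 2 * D / eta * (eta / 2) = D); first by rewrite lerDr divr_ge0// ltW.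
  by field; rewrite gt_eqF.
pose L2 := L ^+ (2 ^ k - 2).
have L20 : 0 < L2 by rewrite exprn_gt0.
have e0' : 0 < eta / 2 / L2 by rewrite !divr_gt0.
have [d0 d00 H] := Qo_Cauchy a0 fi f2i fa e0'.
exists d0 => // d e dp ep dd ed.
have Hde := H d e dp ep dd ed.
have i j (c : R) (c0 : 0 < c) : (0 < j)%N -> itg (fun x => Qo c f x ^+ (2 ^ j)).
  by move=> j0; exact: (itg_Qo_pow c0 a0 fb j0).
have md := Qo_meas dp fi; have me := Qo_meas ep fi.
have i2 j : (0 < j)%N -> itg (fun x => (Qo d f x - Qo e f x) ^+ (2 ^ j)).
  move=> j0; apply: (itg_le _ (itgZ (3 ^+ (2 ^ j)) (itgD (i j d dp j0) (i j e ep j0)))).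
    by mfun.
  by move=> x; rewrite ger0_norm ?even_pow_ge0//; exact: sub_pow_le.
have iR := itgD (itgZ L^-1 (i2 k.+1 isT)) (itgZ L2 (i2 1%N isT)).
apply: (le_trans (Int_le (i2 k k0) iR (fun x => interp_le _ L1 k0))).
rewrite (IntD (itgZ L^-1 (i2 k.+1 isT)) (itgZ L2 (i2 1%N isT))) (IntZ _ (i2 k.+1 isT)) (IntZ _ (i2 1%N isT)).
rewrite [leRHS]splitr; apply: lerD.
  apply: le_trans LD; rewrite ler_wpM2l ?invr_ge0 ?(ltW L0)//.
  have id := i k.+1 d dp isT; have ie := i k.+1 e ep isT.
  apply: (le_trans (Int_le (i2 k.+1 isT) (itgZ (3 ^+ (2 ^ k.+1)) (itgD id ie)) (fun x => sub_pow_le (Qo d f x) (Qo e f x) (isT : (0 < k.+1)%N)))).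
  rewrite (IntZ _ (itgD id ie)) (IntD id ie) /D ler_wpM2l ?exprn_ge0//.
  by apply: lerD; [exact: (HC _ _ _ _ dp a0 fb)|exact: (HC _ _ _ _ ep a0 fb)].
by rewrite mulrC -ler_pdivlMr//.
Qed.

Section weight.
Variables (w : R -> R) (q : R) (k : nat).
Hypotheses (mw : measurable_fun [set: R] w) (w0 : forall x, 0 <= w x) (wi : itg w)
  (wq : itg (fun x => w x `^ q)) (q1 : 1 < q) (k0 : (0 < k)%N)
  (kq : 1 <= (q - 1) * (2 ^ k).-1%:R).

(** A form of Young's inequality obtained by comparing [z] with [(lam * |y|) ^+ (2 ^ k).-1]. The
    hypothesis [kq] says that [2 ^ k] is at least the exponent conjugate to [q]; when it is larger,
    the summand [z] takes care of [z <= 1]. *)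
Lemma weight_le (y z lam : R) : 0 < lam -> 0 <= z ->
  `|y| * z <= lam ^+ (2 ^ k).-1 * y ^+ (2 ^ k) + lam^-1 * (z + z `^ q).
Proof.
move=> l0 z0; set n := (2 ^ k).-1; have nE : (2 ^ k)%N = n.+1 by rewrite /n prednK// expn_gt0.
have A0 : 0 <= lam ^+ n * y ^+ (2 ^ k).
  by rewrite mulr_ge0 ?even_pow_ge0// exprn_ge0// ltW.
have B0 : 0 <= lam^-1 * (z + z `^ q) by rewrite mulr_ge0 ?invr_ge0 ?(ltW l0)// addr_ge0// powR_ge0.
have [h|h] := leP z ((lam * `|y|) ^+ n).
  apply: (@le_trans _ _ (lam ^+ n * y ^+ (2 ^ k))); last by rewrite lerDl.
  rewrite (even_norm _ k0) nE exprS mulrCA -exprMn; exact: ler_wpM2l.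
apply: (@le_trans _ _ (lam^-1 * (z + z `^ q))); last by rewrite lerDr.
rewrite [leRHS]mulrC ler_pdivlMr// (_ : `|y| * z * lam = lam * `|y| * z); last by ring.
have [z1|z1] := leP z 1.
  have : lam * `|y| <= 1.
    rewrite leNgt; apply/negP => h1; have : 1 <= (lam * `|y|) ^+ n by rewrite exprn_ege1// ltW.
    by move=> /(le_trans z1); rewrite leNgt h.
  move=> h1; apply: (@le_trans _ _ z); first by rewrite ler_piMl.
  by rewrite lerDl powR_ge0.
have : lam * `|y| <= z `^ (q - 1).
  rewrite leNgt; apply/negP => h1.
  have : (z `^ (q - 1)) ^+ n <= (lam * `|y|) ^+ n.
    by rewrite lerXn2r ?nnegrE ?powR_ge0 ?mulr_ge0// ltW.
  move=> /le_lt_trans /(_ h); rewrite -powR_mulrn ?powR_ge0// -powRrM.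
  apply/negP; rewrite -leNgt -{1}[z]powRr1// ler_powR// ltW//.
move=> h1; apply: (@le_trans _ _ (z `^ (q - 1) * z)); first exact: ler_wpM2r.
rewrite -{2}[z]powRr1// -powRD; last by apply/implyP => _; rewrite gt_eqF// (lt_trans ltr01 z1).
by rewrite subrK lerDr.
Qed.

(** A large [lam] in [weight_le] makes the share of [w] small, and [del] then offsets the power of
    [lam]. *)
Lemma weight_small (eta : R) : 0 < eta -> exists2 del, 0 < del &
  forall phi : R -> R, measurable_fun [set: R] phi -> itg (fun x => phi x ^+ (2 ^ k)) ->
  Int (fun x => phi x ^+ (2 ^ k)) <= del ->
  Int (fun x => `|phi x| * w x) <= eta.
Proof.
move=> eta0.
have wi2 := itgD wi wq.
pose A := Int (fun x => w x + w x `^ q).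
have A0 : 0 <= A by apply: Int_ge0 => x; rewrite addr_ge0// powR_ge0.
pose lam := 1 + 2 * A / eta.
have l0 : 0 < lam by rewrite ltr_pwDl//; apply: divr_ge0; [exact: mulr_ge0|exact: ltW].
have LA : lam^-1 * A <= eta / 2.
  rewrite mulrC ler_pdivrMr// /lam mulrDr mulr1 [eta / 2 * _]mulrC.
  rewrite (_ : 2 * A / eta * (eta / 2) = A); first by rewrite lerDr divr_ge0// ltW.
  by field; rewrite gt_eqF.
have ln0 : 0 < lam ^+ (2 ^ k).-1 by rewrite exprn_gt0.
exists (eta / 2 / lam ^+ (2 ^ k).-1); first by rewrite !divr_gt0.
move=> phi mphi pi_ hphi.
have iR := itgD (itgZ (lam ^+ (2 ^ k).-1) pi_) (itgZ lam^-1 wi2).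
have iL : itg (fun x => `|phi x| * w x).
  apply: (itg_le _ iR); first by mfun.
  by move=> x; rewrite ger0_norm ?mulr_ge0//; exact: weight_le.
apply: (le_trans (Int_le iL iR (fun x => weight_le _ l0 (w0 x)))).
rewrite (IntD (itgZ (lam ^+ (2 ^ k).-1) pi_) (itgZ lam^-1 wi2)) (IntZ _ pi_) (IntZ _ wi2).
rewrite [leRHS]splitr; apply: lerD => //.
by rewrite mulrC -ler_pdivlMr.
Qed.

Lemma weight_itg (phi : R -> R) : measurable_fun [set: R] phi -> itg (fun x => phi x ^+ (2 ^ k)) ->
  itg (fun x => phi x * w x).
Proof.
move=> mphi pi_.
have iR := itgD (itgZ (1 ^+ (2 ^ k).-1) pi_) (itgZ 1^-1 (itgD wi wq)).
apply: (itg_le _ iR); first by mfun.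
by move=> x; rewrite normrM (ger0_norm (w0 x)); exact: weight_le.
Qed.
End weight.
End Cauchy.

(** * The potential of the equilibrium measure *)

Section null_modification.
Local Open Scope ereal_scope.
Context d (T : measurableType d) (R : realType) (m : {measure set T -> \bar R}).

Import HBNNSimple.

(** A simple function below [f], cut to the complement of [N], lies below [g] and keeps its
    integral. Measurability is thus asked of simple functions only. *)
Let ge0_integral_null_le (N : set T) (f g : T -> \bar R) : measurable N -> m N = 0 ->
  (forall x, 0 <= f x) -> (forall x, 0 <= g x) -> (forall x, ~ N x -> f x = g x) ->
  \int[m]_x f x <= \int[m]_x g x.
Proof.
move=> mN N0 f0 g0 fg.
rewrite ge0_integralTE// ge0_integralTE//.
apply: ge_ereal_sup => _ /= [h hf <-].
pose k := mul_nnsfun h (indic_nnsfun R (measurableC mN)).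
have kE x : k x = (h x * \1_(~` N) x)%R by [].
apply: (@le_trans _ _ (sintegral m k)); last first.
  apply: ereal_sup_ubound; exists k => // x; rewrite kE indicE.
  have [xN|xN] := boolP (x \in ~` N); last by rewrite mulr0.
  by rewrite mulr1 -fg; [exact: hf|move: xN; rewrite inE].
rewrite -!integralT_nnsfun le_eqVlt; apply/orP; left; apply/eqP.
apply: ge0_ae_eq_integral => //.
- exact/measurable_EFinP.
- exact/measurable_EFinP.
- by move=> x _; rewrite lee_fin.
- by move=> x _; rewrite lee_fin.
- exists N; split => // x /not_implyP[_] hk.
  have [xN|xN] := boolP (x \in ~` N); first by case: hk; rewrite kE indicE xN mulr1.
  by apply: contrapT; move: xN; rewrite notin_setE.
Qed.

Let ge0_integral_null (N : set T) (f g : T -> \bar R) : measurable N -> m N = 0 ->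
  (forall x, 0 <= f x) -> (forall x, 0 <= g x) -> (forall x, ~ N x -> f x = g x) ->
  \int[m]_x f x = \int[m]_x g x.
Proof.
move=> mN N0 f0 g0 fg; apply/eqP; rewrite eq_le !(@ge0_integral_null_le N)//.
by move=> x /fg.
Qed.

(** Stated for arbitrary integrands because it is applied to ones built from [hilbert], about whose
    measurability nothing has been established. *)
Lemma integral_null_eq (N : set T) (f g : T -> \bar R) : measurable N -> m N = 0 ->
  (forall x, ~ N x -> f x = g x) -> \int[m]_x f x = \int[m]_x g x.
Proof.
move=> mN N0 fg; rewrite integralE [RHS]integralE; congr (_ - _).
- by apply: (ge0_integral_null mN N0) => // x /fg; rewrite !funeposE => ->.
- by apply: (ge0_integral_null mN N0) => // x /fg; rewrite !funenegE => ->.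
Qed.

End null_modification.

(** * Probability measures given by densities *)

Section Density.
Local Open Scope ereal_scope.
Context {R : realType}.
Notation mu := (@lebesgue_measure R).
Variable v : R -> R.
Hypotheses (mv : measurable_fun [set: R] v) (v0 : forall x, (0 <= v x)%R) (v1 : \int[mu]_x (v x)%:E = 1).

(** Turns a density into a measure, so that densities can compete in the minimization of the
    energy. *)
Definition dens (A : set (measurableTypeR R)) : \bar R := \int[mu]_(x in A) (v x)%:E.

Let mv' : measurable_fun [set: measurableTypeR R] (EFin \o v).
Proof. exact/measurable_EFinP. Qed.

Let dens0 : dens set0 = 0. Proof. by rewrite /dens integral_set0. Qed.

Let dens_ge0 A : 0 <= dens A.
Proof. by apply: integral_ge0 => x _; rewrite lee_fin. Qed.

Let dens_sigma_additive : semi_sigma_additive dens.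
Proof.
move=> /= F mF tF mUF; rewrite /dens; apply: cvg_toP.
  apply: ereal_nondecreasing_is_cvgn => m n mn.
  apply: lee_sum_nneg_natr => // k _ _; apply: integral_ge0 => /= x Fkx.
  by rewrite lee_fin.
rewrite ge0_integral_bigcup//=.
- exact: measurable_funTS mv'.
- by move=> x _; rewrite lee_fin.
Qed.

HB.instance Definition _ := isMeasure.Build _ _ _ dens dens0 dens_ge0 dens_sigma_additive.

Let dens_setT : dens setT = 1%:E. Proof. exact: v1. Qed.

HB.instance Definition _ := @Measure_isProbability.Build _ _ R dens dens_setT.

Definition dens_prob : probability (measurableTypeR R) R := dens.
End Density.

Section Change.
Local Open Scope ereal_scope.
Context {R : realType}.
Notation mu := (@lebesgue_measure R).

(** The Radon-Nikodym derivative of [nu] has the same integral as [v] over every measurable set, so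
    they agree almost everywhere and its change of variables carries over to [v]. *)
Lemma integral_density (nu : probability (measurableTypeR R) R) (v : R -> R) (g : R -> \bar R) :
  measurable_fun [set: R] v -> (forall x, (0 <= v x)%R) ->
  (forall A : set (measurableTypeR R), measurable A -> nu A = \int[mu]_(x in A) (v x)%:E) ->
  measurable_fun [set: R] g -> (forall x, 0 <= g x) ->
  \int[nu]_x g x = \int[mu]_x (g x * (v x)%:E).
Proof.
move=> mv v0 nuE mg g0.
have numu : nu `<< mu.
  apply/null_content_dominatesP => A mA A0.
  rewrite nuE//; apply: null_set_integral => //.
  by apply: measurable_funTS; exact/measurable_EFinP.
have vi : mu.-integrable setT (EFin \o v).
  apply/integrableP; split; first exact/measurable_EFinP.
  under eq_integral do rewrite /= ger0_norm//.
  by have := nuE setT measurableT; rewrite probability_setT => <-; rewrite ltry.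
pose f := Radon_Nikodym_SigmaFinite.f nu mu.
have fi : mu.-integrable setT f by exact: Radon_Nikodym_SigmaFinite.f_integrable.
have fv : ae_eq mu setT f (EFin \o v).
  apply: integral_ae_eq => //; first exact: (measurable_int mu).
  move=> A _ mA; rewrite -(nuE _ mA).
  by rewrite -Radon_Nikodym_SigmaFinite.f_integral.
rewrite -(Radon_Nikodym_SigmaFinite.change_of_variables numu g0 measurableT)//.
have f0 := Radon_Nikodym_SigmaFinite.f_ge0 numu.
apply: ge0_ae_eq_integral => //.
- by apply: emeasurable_funM => //; exact: (measurable_int mu).
- by apply: emeasurable_funM => //; exact/measurable_EFinP.
- by move=> x _; rewrite mule_ge0.
- by move=> x _; rewrite mule_ge0// lee_fin.
- exact: ae_eqe_mul2l.
Qed.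

(** An infinite integral of [g] is allowed: the negative part of [g - c] still has integral at most
    [|c|]. *)
Lemma integral_subc (nu : probability (measurableTypeR R) R) (g : R -> \bar R) (c : R) :
  measurable_fun [set: R] g -> (forall x, 0 <= g x) ->
  \int[nu]_x (g x - c%:E) = \int[nu]_x g x - c%:E.
Proof.
move=> mg g0.
have cI (r : R) : \int[nu]_x r%:E = r%:E.
  rewrite (@integral_cst _ _ _ nu _ (@measurableT _ _) r%:E).
  by rewrite [X in _ * X](_ : _ = 1) ?mule1//; exact: probability_setT.
have ci : nu.-integrable setT (cst c%:E).
  by apply: (@finite_measure_integrable_cst _ _ _ nu setT c); exact: measurableT.
have mg' : measurable_fun [set: measurableTypeR R] g by exact: mg.
have [oo|] := boolP (\int[nu]_x g x \is a fin_num).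
  have gi : nu.-integrable setT g.
    apply/integrableP; split => //; under eq_integral do rewrite gee0_abs//.
    by rewrite ltey_eq oo.
  have E := @integralB _ _ _ nu _ (@measurableT _ _) g (cst c%:E) gi ci.
  by rewrite [LHS]E cI.
rewrite ge0_fin_numE ?integral_ge0// -leNgt leye_eq => /eqP goo.
rewrite goo addye//.
have m1 : measurable_fun [set: measurableTypeR R] (fun x => g x - c%:E).
  by apply: emeasurable_funB => //; exact: measurable_cst.
rewrite integralE.
have neg : \int[nu]_x (fun x => g x - c%:E)^\- x <= `|c|%:E.
  rewrite -[leRHS]cI.
  apply: ge0_le_integral => //.
  - exact: measurable_funeneg.
  - move=> x _; rewrite funenegE ge_max lee_fin normr_ge0 andbT.
    have := g0 x; case: (g x) => [r| |] //=; last by rewrite leNye.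
    by rewrite !lee_fin opprB => r0; have := ler_norm c; lra.
have pos : \int[nu]_x (fun x => g x - c%:E)^\+ x = +oo.
  apply/eqP; rewrite -leye_eq -(@leeD2rE _ `|c|%:E)// addye// -goo.
  rewrite -[X in _ + X]cI -ge0_integralD//; last exact: measurable_funepos.
  apply: ge0_le_integral => //.
    by apply: emeasurable_funD; [exact: measurable_funepos|exact: measurable_cst].
  move=> x _; apply: (@le_trans _ _ ((g x - c%:E) + `|c|%:E)).
    case: (g x) => [r| |]//; rewrite -EFinB -EFinD lee_fin.
    by have := ler_norm c; lra.
  by rewrite leeD2r// funeposE le_max lexx.
rewrite pos addye//; apply/eqP => h.
have : \int[nu]_x (fun x => g x - c%:E)^\- x < +oo by exact: le_lt_trans neg (ltry _).
by rewrite -[X in X < _]oppeK h.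
Qed.
End Change.

(** * The logarithmic kernel *)

Section LogKernel.
Context {R : realType}.
Notation mu := (@lebesgue_measure R).
Implicit Types (f g h v : R -> R) (d e t s x y a B M N : R).

(* If [D >= 1] bounds the diameter of E, this is [ln D - ln `|u|] for differences of
   points of E, so the energy only changes by a constant; also, [ln 0 = 0] makes the
   kernel finite on the diagonal. *)
Definition kap D (u : R) : R := Num.max 0 (ln D - ln `|u|).

Lemma kap_ge0 D u : 0 <= kap D u.
Proof. by rewrite /kap le_max lexx. Qed.

Lemma kap_even D x y : kap D (x - y) = kap D (y - x).
Proof. by rewrite /kap distrC. Qed.

Lemma measurable_kap D : measurable_fun [set: R] (kap D).
Proof.
apply: measurable_maxr; first exact: measurable_cst.
apply: measurable_funB; first exact: measurable_cst.
by apply: measurableT_comp; [exact: measurable_ln|exact: normr_measurable].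
Qed.

Lemma kapE D u : 1 <= D -> `|u| <= D -> kap D u = ln D - ln `|u|.
Proof.
move=> D1 uD; have D0 : 0 < D by exact: lt_le_trans D1.
rewrite /kap; apply/max_idPr; rewrite subr_ge0.
have [->|u0] := eqVneq u 0; first by rewrite normr0 ln0// ln_ge0.
by rewrite ler_ln ?posrE ?normr_gt0.
Qed.

Lemma ln_tangent (p z : R) : 0 < p -> 0 < z -> ln p <= ln z + (p - z) / z.
Proof.
move=> p0 z0; rewrite -lerBlDl -ln_div ?posrE//.
have -> : p / z = 1 + (p - z) / z by field; rewrite gt_eqF.
by apply: le_ln1Dx; rewrite ltr_pdivlMr//; lra.
Qed.

(** Average the two tangent inequalities at the mean point [z]; the linear terms cancel. *)
Lemma ln_concave (l p r : R) : 0 <= l -> l <= 1 -> 0 < p -> 0 < r ->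
  l * ln p + (1 - l) * ln r <= ln (l * p + (1 - l) * r).
Proof.
move=> l0 l1 p0 r0; set z := l * p + (1 - l) * r.
have z0 : 0 < z.
  rewrite /z; move: l0; rewrite le_eqVlt => /predU1P[<-|l0]; first by rewrite mul0r add0r subr0 mul1r.
  by rewrite ltr_pwDl ?mulr_gt0// mulr_ge0 ?subr_ge0// ltW.
have h1 := ln_tangent p0 z0; have h2 := ln_tangent r0 z0.
have h3 : l * ln p <= l * (ln z + (p - z) / z) by rewrite ler_wpM2l.
have h4 : (1 - l) * ln r <= (1 - l) * (ln z + (r - z) / z) by rewrite ler_wpM2l ?subr_ge0.
apply: (le_trans (lerD h3 h4)); rewrite le_eqVlt; apply/orP; left; apply/eqP.
have : l * ((p - z) / z) + (1 - l) * ((r - z) / z) = ((l * p + (1 - l) * r) - z) / z.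
  by field; rewrite gt_eqF.
rewrite -/z subrr mul0r; move: (ln z) ((p - z) / z) ((r - z) / z) => A b c bc.
by rewrite -[RHS]addr0 -bc; ring.
Qed.

Lemma kap_convex D (l p r : R) : 0 <= l -> l <= 1 -> 0 < p -> 0 < r ->
  kap D (l * p + (1 - l) * r) <= l * kap D p + (1 - l) * kap D r.
Proof.
move=> l0 l1 p0 r0; have z0 : 0 <= l * p + (1 - l) * r.
  by rewrite addr_ge0 ?mulr_ge0 ?subr_ge0 ?(ltW p0) ?(ltW r0).
have k0 : 0 <= l * kap D p + (1 - l) * kap D r.
  by rewrite addr_ge0// mulr_ge0 ?kap_ge0// subr_ge0.
rewrite {1}/kap ge_max k0/= ger0_norm//.
have h := ln_concave l0 l1 p0 r0.
have hp : l * (ln D - ln p) <= l * kap D p.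
  by rewrite ler_wpM2l// /kap gtr0_norm// le_max lexx orbT.
have hr : (1 - l) * (ln D - ln r) <= (1 - l) * kap D r.
  by rewrite ler_wpM2l ?subr_ge0// /kap gtr0_norm// le_max lexx orbT.
apply: le_trans (lerD hp hr).
rewrite (_ : l * (ln D - ln p) + (1 - l) * (ln D - ln r) = ln D - (l * ln p + (1 - l) * ln r)); last by ring.
by rewrite lerB.
Qed.

(** The coefficient [c] does not depend on [x], so the inequality can be integrated against a
    density that vanishes between [l] and [r]. *)
Lemma kap_convex_out D l r y : l < y -> y < r ->
  exists2 c, 0 <= c <= 1 & forall x, (x < l) || (r < x) ->
  kap D (x - y) <= c * kap D (x - l) + (1 - c) * kap D (x - r).
Proof.
move=> ly yr; have lr : 0 < r - l by rewrite subr_gt0 (lt_trans ly).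
exists ((r - y) / (r - l)).
  by rewrite divr_ge0 ?(ltW lr) ?subr_ge0 ?(ltW yr)//= ler_pdivrMr// mul1r lerB// ltW.
move=> x; set c := (r - y) / (r - l).
have c0 : 0 <= c by rewrite divr_ge0 ?(ltW lr) ?subr_ge0 ?(ltW yr).
have c1 : c <= 1 by rewrite ler_pdivrMr// mul1r lerB// ltW.
have E : c * l + (1 - c) * r = y by rewrite /c; field; rewrite gt_eqF.
move=> /orP[h|h].
- rewrite !(kap_even _ x) -{1}E (_ : _ - x = c * (l - x) + (1 - c) * (r - x)); last by ring.
  by apply: kap_convex => //; rewrite subr_gt0// (lt_trans h)// (lt_trans ly).
- rewrite -{1}E (_ : x - _ = c * (x - l) + (1 - c) * (x - r)); last by ring.
  by apply: kap_convex => //; rewrite subr_gt0// (lt_trans _ h)// (lt_trans ly).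
Qed.

(** The rate one half turns [z = ln D - ln |u|] into a multiple of [|u|^(-1/2)], which is integrable
    at 0. *)
Lemma expr_le_expR (n : nat) (z : R) : 0 <= z ->
  z ^+ n.+1 <= (2 * n.+1%:R) ^+ n.+1 * expR (z / 2).
Proof.
move=> z0; have n0 : (0 : R) < 2 * n.+1%:R by rewrite mulr_gt0.
have -> : expR (z / 2) = expR (z / (2 * n.+1%:R)) ^+ n.+1.
  rewrite -expRM_natl; congr expR; move: (n.+1%:R : R) (ltr0n R n.+1) => a a0.
  by field; rewrite gt_eqF.
rewrite -exprMn lerXn2r ?nnegrE// ?mulr_ge0 ?expR_ge0 ?(ltW n0)//.
have h : z / (2 * n.+1%:R) <= expR (z / (2 * n.+1%:R)).
  by apply: le_trans (expR_ge1Dx _); rewrite lerDr.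
have := ler_wpM2l (ltW n0) h; rewrite [X in X <= _ -> _]mulrC mulfVK ?gt_eqF//.
Qed.

(* The integrable majorant is a multiple of [|u|^(-1/2)], obtained by Fatou's
   lemma from the derivative of [u (u^2 + e^2)^(-1/4)]. *)
Lemma itg_kap_pow D (m : nat) : 1 <= D -> itg (fun u => kap D u ^+ m.+1).
Proof.
move=> D1; have D0 : 0 < D by exact: lt_le_trans D1.
pose L n (u : R) : R := 2^-1 * ln ((u - 0) ^+ 2 + eps n ^+ 2).
pose F n u := u * expR (- 2^-1 * L n u).
pose G n u := expR (- 2^-1 * L n u) * (1 - 2^-1 * (u * (u / (u ^+ 2 + eps n ^+ 2)))).
have dF n u : is_derive u (1 : R) (F n) (G n u).
  have d1 := is_derive_lnq 0 u (@eps_gt0 R n).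
  have d2 := is_deriveZ (- 2^-1) d1.
  have d3 := @is_derive1_comp R _ _ u _ _ (is_derive_expR _) d2.
  have d4 := is_deriveM (is_derive_id u (1 : R)) d3.
  apply: (is_derive_eq d4); rewrite /G /L /qk /GRing.scale/= subr0.
  by move: (expR _) (u / _) => A B; ring.
have cL n : continuous (L n).
  move=> u; apply: cvgM; first exact: cvg_cst.
  have h : {for u, continuous (@ln R \o (fun u : R => (u - 0) ^+ 2 + eps n ^+ 2))}.
    apply: continuous_comp; last by apply: continuous_ln; exact: den_gt0 (@eps_gt0 R n).
    apply: cvgD; last exact: cvg_cst.
    by apply: cvgM; apply: cvgB; (exact: cvg_id || exact: cvg_cst).
  exact: h.
have cG n : continuous (G n).
  move=> u; apply: cvgM.
    have h : {for u, continuous (@expR R \o (fun u : R => - 2^-1 * L n u))}.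
      apply: continuous_comp; last exact: continuous_expR.
      by apply: cvgM; [exact: cvg_cst|exact: cL].
    exact: h.
  apply: cvgB; first exact: cvg_cst.
  apply: cvgM; first exact: cvg_cst.
  apply: cvgM; first exact: cvg_id.
  apply: cvgM; first exact: cvg_id.
  apply: cvgV; first by rewrite gt_eqF// den_gt0// eps_gt0.
  by apply: cvgD; [exact: exprn_continuous|exact: cvg_cst].
pose I := `[- D, D]%classic : set R.
have mI : measurable I by exact: measurable_itv.
have G0 n u : 0 <= G n u.
  rewrite mulr_ge0 ?expR_ge0// subr_ge0 mulrA -expr2 ?mulrA.
  have d0 := den_gt0 u (@eps_gt0 R n).
  rewrite (_ : 2^-1 * u * u = 2^-1 * u ^+ 2); last by ring.
  rewrite ler_pdivrMr// mul1r.
  by have := sqr_ge0 u; have := sqr_ge0 (eps n : R); move: (u ^+ 2) (_ ^+ 2) => a b; lra.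
have GI0 n u : 0 <= (G n \_ I) u by rewrite patchE; case: ifP.
have GI n : Int (G n \_ I) <= 2 * D.
  rewrite Int_restrict (FTC_itv _ (dF n) (cG n)); last by rewrite gtrN.
  have e : L n (- D) = L n D by rewrite /L !subr0 sqrrN.
  have : expR (- 2^-1 * L n D) <= 1.
    rewrite -expR0 ler_expR mulNr oppr_le0 mulr_ge0// /L subr0 mulr_ge0// ln_ge0//.
    by rewrite (le_trans (_ : 1 <= D ^+ 2)) ?expr_ge1 ?(ltW D0)// lerDl sqr_ge0.
  rewrite /F e; move: (expR _) => A; rewrite -(ler_pM2l D0) mulr1 mulNr.
  by move: (D * A) => c; lra.
have Gi n : itg (G n \_ I).
  rewrite itgE -restrict_EFin; apply: (iffLR (@integrable_mkcond _ _ _ mu I (EFin \o G n) mI)).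
  by apply: continuous_compact_integrable; [exact: segment_compact|exact: continuous_subspaceT].
(* The limit of [G n] away from 0, that is half of [|u|^(-1/2)]. *)
pose H (u : R) := expR (- 2^-1 * ln `|u|) * 2^-1.
have mH : measurable_fun [set: R] H.
  apply: measurable_funM; last exact: measurable_cst.
  apply: measurableT_comp; first exact: measurable_expR.
  apply: measurable_funM; first exact: measurable_cst.
  by apply: measurableT_comp; [exact: measurable_ln|exact: normr_measurable].
have H0 u : 0 <= H u by rewrite mulr_ge0 ?expR_ge0.
have HI0 u : 0 <= (H \_ I) u by rewrite patchE; case: ifP.
have [Hi _] : itg (H \_ I) /\ Int (H \_ I) <= 2 * D.
  apply: (Fatou_Int Gi GI0 _ HI0 _ GI).
    by apply/(measurable_restrictT _ _).1 => //; exact: measurable_funTS.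
  apply: aeS (ae_neq 0) => u u0; rewrite !patchE.
  rewrite (_ : (fun n => (G n \_ I) u) = fun n => if u \in I then G n u else 0); last first.
    by apply/funext => n; rewrite patchE.
  case: ifP => _; last exact: cvg_cst.
  have u2 : 0 < u ^+ 2 by rewrite exprn_even_gt0.
  have h1 : (fun n => u ^+ 2 + eps n ^+ 2) @ \oo --> u ^+ 2.
    rewrite -[u ^+ 2 in X in _ --> X]addr0; apply: cvgD; first exact: cvg_cst.
    by rewrite -(mulr0 (0 : R)); apply: cvgM; exact: cvg_eps.
  have lnE : ln `|u| = 2^-1 * ln (u ^+ 2).
    by rewrite -(real_normK (num_real u)) lnXn ?normr_gt0// -[ln _ *+ 2]mulr_natl mulrA mulVf// mul1r.
  have h2 : (fun n => L n u) @ \oo --> ln `|u|.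
    rewrite lnE /L subr0; apply: cvgM; first exact: cvg_cst.
    exact: (continuous_cvg _ (continuous_ln u2) h1).
  apply: cvgM.
    have h3 : (fun n => - 2^-1 * L n u) @ \oo --> - 2^-1 * ln `|u|.
      apply: cvgM; first exact: cvg_cst.
      exact: h2.
    exact: (continuous_cvg _ (@continuous_expR R (- 2^-1 * ln `|u|)) h3).
  rewrite [X in _ --> X](_ : _ = 1 - 2^-1 * (u * (u / u ^+ 2))); last by field.
  apply: cvgB; first exact: cvg_cst.
  have h4 : (fun n => (u ^+ 2 + eps n ^+ 2)^-1) @ \oo --> (u ^+ 2)^-1.
    by apply: cvgV => //; rewrite gt_eqF.
  have h5 : (fun n => u / (u ^+ 2 + eps n ^+ 2)) @ \oo --> u / (u ^+ 2).
    by apply: cvgM; [exact: cvg_cst|exact: h4].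
  have h6 : (fun n => u * (u / (u ^+ 2 + eps n ^+ 2))) @ \oo --> u * (u / (u ^+ 2)).
    by apply: cvgM; [exact: cvg_cst|exact: h5].
  by apply: cvgM; [exact: cvg_cst|exact: h6].
have Hi' := itgZ ((2 * m.+1%:R) ^+ m.+1 * (2 * expR (ln D / 2))) Hi.
have mk : measurable_fun [set: R] (fun u => kap D u ^+ m.+1).
  by apply: measurable_funX; exact: measurable_kap.
apply: (itg_le mk Hi') => u.
rewrite ger0_norm ?exprn_ge0 ?kap_ge0// patchE; case: ifP => [/set_mem|/negbT /negP uI].
  rewrite /I/= in_itv/= -ler_norml => uD.
  apply: (le_trans (expr_le_expR m (kap_ge0 D u))).
  rewrite -!mulrA; apply: ler_wpM2l; first by rewrite exprn_ge0// mulr_ge0.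
  rewrite kapE// /H mulrDl expRD mulNr [ln `|u| / 2]mulrC -mulNr.
  by move: (expR _) (expR _) => A B; rewrite le_eqVlt; apply/orP; left; apply/eqP; field.
rewrite mulr0 /kap (_ : Num.max _ _ = 0) ?expr0n//; apply/max_idPl; rewrite subr_le0.
have uD : D < `|u|.
  rewrite ltNge; apply/negP => uD; apply: uI; rewrite inE /I/= in_itv/= -ler_norml//.
by rewrite ler_ln ?posrE// ?ltW// (lt_trans D0).
Qed.
End LogKernel.

(** * Constancy of the potential for a minimizing density *)

Section Potential.
Context {R : realType}.
Notation mu := (@lebesgue_measure R).
Implicit Types (f g h v : R -> R) (d e t s x y a B M N : R).

Lemma itg_refl g x : itg g -> itg (fun t => g (x - t)).
Proof.
move=> gi; have mg := itg_meas gi.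
pose T : measurableTypeR R -> measurableTypeR R := fun t => x - t.
have mT : measurable_fun [set: measurableTypeR R] T.
  by have m : measurable_fun [set: R] (fun t : R => x - t) by mfun; exact: m.
pose G : measurableTypeR R -> \bar R := fun u => `|g u|%:E.
have mE : measurable_fun [set: measurableTypeR R] G.
  by apply/measurable_EFinP; exact: measurable_fun_norm.
rewrite itgE; apply/integrableP; split.
  by apply/measurable_EFinP; mfun.
have := @ge0_integral_pushforward _ _ _ _ _ _ mT mu setT G measurableT mE (fun y _ => _).
rewrite preimage_setT => E.
rewrite -[X in (X < _)%E]E; last by move=> y; rewrite lee_fin.
apply: le_lt_trans (itg_lty gi).
rewrite le_eqVlt; apply/orP; left; apply/eqP.
by apply: eq_measure_integral => A mA _; exact: refl_measure.
Qed.

(* The energy is a quadratic polynomial in [s] along the segment from [w] to [v]. *)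
Lemma quad_min_arith (Q B C : R) :
  (forall s, 0 < s -> s <= 1 -> Q <= (1 - s) ^+ 2 * Q + 2 * s * (1 - s) * B + s ^+ 2 * C) ->
  Q <= B.
Proof.
move=> H; rewrite leNgt; apply/negP => BQ.
(* With [s = (Q - B) / P], the quadratic term of the bracket is at most [Q - B], less than the
   linear gain [2 * (Q - B)]; [P] is large enough to keep [s <= 1]. *)
pose P := `|Q - 2 * B + C| + (Q - B) + 1.
have P0 : 0 < P by rewrite ltr_wpDl// addr_ge0// subr_ge0 ltW.
pose s := (Q - B) / P.
have s0 : 0 < s by rewrite divr_gt0 ?subr_gt0.
have s1 : s <= 1.
  rewrite ler_pdivrMr// mul1r /P -addrA [_ + (_ + 1)]addrC -addrA lerDl addr_ge0//.
have := H s s0 s1.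
have -> : (1 - s) ^+ 2 * Q + 2 * s * (1 - s) * B + s ^+ 2 * C =
  Q + s * (s * (Q - 2 * B + C) - 2 * (Q - B)) by ring.
rewrite lerDl pmulr_rge0// subr_ge0; apply/negP; rewrite -ltNge.
apply: (@le_lt_trans _ _ (s * P)).
  rewrite ler_wpM2l ?(ltW s0)// /P; have := ler_norm (Q - 2 * B + C).
  by move: (Q - 2 * B + C) => z; lra.
by rewrite /s divfK ?gt_eqF//; lra.
Qed.

Variables (E : set R) (w : R -> R) (q D a : R) (k : nat).
Hypotheses (mw : measurable_fun [set: R] w) (w0 : forall x, 0 <= w x) (wi : itg w)
  (wq : itg (fun x => w x `^ q)) (k0 : (0 < k)%N)
  (kq : 1 <= (q - 1) * (2 ^ k).-1%:R).
Hypotheses (D1 : 1 <= D) (mE : measurable E) (Ea : forall x, E x -> `|x| <= a)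
  (wE : forall x, ~ E x -> w x = 0) (w1 : Int w = 1).

(** For [y] in [E] and [v] of mass 1 carried by [E], this is the logarithmic potential of [v] plus
    [ln D], provided [D] bounds the diameter. *)
Definition Upot v y : R := Int (fun x => kap D (x - y) * v x).

(* The bound by [w + M] makes all potentials and energies finite. *)
Definition admissible v M := [/\ measurable_fun [set: R] v, forall x, 0 <= v x,
  forall x, ~ E x -> v x = 0, forall x, v x <= w x + M & 0 <= M].

Let mk y : measurable_fun [set: R] (fun x => kap D (x - y)).
Proof. by apply: mshift; exact: measurable_kap. Qed.

Let ki n y : itg (fun x => kap D (x - y) ^+ n.+1).
Proof.
have E1 x : kap D (y - x) ^+ n.+1 = kap D (x - y) ^+ n.+1 by rewrite kap_even.
exact: (eq_itg E1 (itg_refl y (itg_kap_pow n D1))).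
Qed.

Let KM y : Int (fun x => kap D (x - y) ^+ (2 ^ k)) = Int (fun x => kap D x ^+ (2 ^ k)).
Proof.
have mkk : measurable_fun [set: R] (fun x => kap D x ^+ (2 ^ k)).
  by apply: measurable_funX; exact: measurable_kap.
rewrite -(@Int_refl _ (fun x => kap D x ^+ (2 ^ k)) y) //; last first.
  by rewrite pow2S; exact: (itg_refl y (itg_kap_pow _ D1)).
by apply: eq_Int => x; rewrite kap_even.
Qed.

Let k1 y : itg (fun x => kap D (x - y)).
Proof. exact: (ki 0 y). Qed.

Let w_Upot y : itg (fun x => kap D (x - y) * w x).
Proof.
apply: (weight_itg mw w0 wi wq k0 kq); first exact: mk.
by rewrite pow2S; exact: ki.
Qed.

Let KM1 y : Int (fun x => kap D (x - y)) = Int (kap D).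
Proof.
rewrite -(@Int_refl _ (kap D) y) //; last first.
- exact: measurable_kap.
- exact: (itg_refl y (itg_kap_pow 0 D1)).
by apply: eq_Int => x; rewrite kap_even.
Qed.

Lemma itg_Upot v M y : admissible v M -> itg (fun x => kap D (x - y) * v x).
Proof.
case=> mv v0 _ vM _; have i := itgD (w_Upot y) (itgZ M (k1 y)).
apply: (itg_le _ i); first by apply: measurable_funM; [exact: mk|exact: mv].
move=> x; rewrite normrM (ger0_norm (kap_ge0 _ _)) (ger0_norm (v0 x)).
by rewrite [M * _]mulrC -mulrDr ler_wpM2l ?kap_ge0.
Qed.

Lemma Upot_ge0 v M y : admissible v M -> 0 <= Upot v y.
Proof. by case=> _ v0 _ _ _; apply: Int_ge0 => x; rewrite mulr_ge0 ?kap_ge0. Qed.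

(** [weight_le] separates the kernel from the density, and the integral of a power of the kernel
    does not depend on [y]. *)
Lemma Upot_bnd v M : admissible v M -> exists C, forall y, `|Upot v y| <= C.
Proof.
move=> av; exists (Int (fun x => kap D x ^+ (2 ^ k)) + Int (fun x => w x + w x `^ q)
  + M * Int (kap D)) => y.
rewrite (ger0_norm (Upot_ge0 y av)); have [mv v0 _ vM _] := av.
have i := itgD (w_Upot y) (itgZ M (k1 y)).
have l : Upot v y <= Int (fun x => kap D (x - y) * w x + M * kap D (x - y)).
  apply: (Int_le (itg_Upot y av) i) => x.
  by rewrite [M * _]mulrC -mulrDr ler_wpM2l ?kap_ge0.
apply: (le_trans l); rewrite (IntD (w_Upot y) (itgZ M (k1 y))) (IntZ _ (k1 y)) KM1 lerD2r.
have ik : itg (fun x => kap D (x - y) ^+ (2 ^ k)) by rewrite pow2S; exact: ki.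
have iw := itgD wi wq.
have i2 := itgD (itgZ (1 ^+ (2 ^ k).-1) ik) (itgZ 1^-1 iw).
rewrite -(KM y) -(IntD ik iw); apply: (Int_le (w_Upot y) (itgD ik iw)) => x.
have := weight_le k0 kq (kap D (x - y)) ltr01 (w0 x).
by rewrite (ger0_norm (kap_ge0 _ _)) expr1n invr1 !mul1r.
Qed.

Let mk2 v : measurable_fun [set: R] v ->
  measurable_fun [set: R * R] (fun z => kap D (z.1 - z.2) * v z.1).
Proof.
move=> mv; apply: measurable_funM; last exact: (measurableT_comp mv measurable_fst).
apply: (measurableT_comp (measurable_kap D)); apply: measurable_funB.
  exact: measurable_fst.
exact: measurable_snd.
Qed.

Lemma Upot_meas v M : admissible v M -> measurable_fun [set: R] (Upot v).
Proof.
move=> av; have [mv v0 _ _ _] := av; apply/measurable_EFinP.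
have : measurable_fun setT (fubini_G mu (fun z : R * R => (kap D (z.1 - z.2) * v z.1)%:E)).
  apply: measurable_fun_fubini_tonelli_G => //.
    by apply/measurable_EFinP; exact: mk2.
  by move=> z; rewrite lee_fin mulr_ge0// kap_ge0.
congr measurable_fun; apply/funext => y; rewrite /fubini_G/=.
by rewrite (IntE (itg_Upot y av)).
Qed.

Lemma adm_itg v M : admissible v M -> itg v.
Proof.
case=> mv v0 vE vM M0.
have i := itgD wi (itgZ M (itg_near_ball 0 (a + 1))).
apply: (itg_le mv i) => x; rewrite (ger0_norm (v0 x)) near_ballE sub0r normrN.
have [xE|xE] := pselect (E x); last by rewrite vE// addr_ge0// mulr_ge0.
by rewrite (le_lt_trans (Ea xE)) ?ltrDl// mulr1.
Qed.

Lemma itg_UpotM u v M N : admissible u M -> admissible v N -> itg (fun y => Upot u y * v y).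
Proof.
move=> au av; have [C HC] := Upot_bnd au.
exact: (itgM_bdd (Upot_meas au) HC (adm_itg av)).
Qed.

Lemma Upot_sym u v M N : admissible u M -> admissible v N ->
  Int (fun y => Upot u y * v y) = Int (fun x => Upot v x * u x).
Proof.
move=> au av; have [mu_ u0 _ _ _] := au; have [mv v0 _ _ _] := av.
pose G y x := v y * (kap D (x - y) * u x).
have i1 y : itg (G y) by apply: itgZ; exact: itg_Upot au.
have i2 x : itg (G^~ x).
  apply: eq_itg (itgZ (u x) (itg_Upot x av)) => y.
  by rewrite /G (kap_even _ y); ring.
have E1 y : Int (G y) = Upot u y * v y by rewrite (IntZ _ (itg_Upot y au)) mulrC.
have E2 x : Int (G^~ x) = Upot v x * u x.
  rewrite mulrC -(IntZ _ (itg_Upot x av)); apply: eq_Int => y.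
  by rewrite /G (kap_even _ y); ring.
have G0 y x : 0 <= G y x by rewrite !mulr_ge0// kap_ge0.
have mG : measurable_fun [set: R * R] (fun z => G z.1 z.2).
  apply: measurable_funM; first exact: (measurableT_comp mv measurable_fst).
  apply: measurable_funM; last exact: (measurableT_comp mu_ measurable_snd).
  apply: (measurableT_comp (measurable_kap D)); apply: measurable_funB.
    exact: measurable_snd.
  exact: measurable_fst.
have iG : itg (fun y => Int (fun x => `|G y x|)).
  apply: eq_itg (itg_UpotM au av) => y; rewrite -E1; apply: eq_Int => x.
  by rewrite ger0_norm.
have [_ _ _ F] := Fub mG i1 i2 iG.
by rewrite -(eq_Int E1) -(eq_Int E2).
Qed.

Definition minimizing := forall v M, admissible v M -> Int v = 1 ->
  Int (fun y => Upot w y * w y) <= Int (fun y => Upot v y * v y).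

Hypothesis wmin : minimizing.

Let aw : admissible w 0.
Proof. by split => // x; rewrite addr0. Qed.

Let Q := Int (fun y => Upot w y * w y).

Let w_Upot_ge v M : admissible v M -> Int v = 1 -> Q <= Int (fun y => Upot w y * v y).
Proof.
move=> av v1; pose B := Int (fun y => Upot w y * v y).
pose C := Int (fun y => Upot v y * v y).
apply: (@quad_min_arith _ _ C) => s s0 s1.
have [mv v0 vE vM M0] := av.
have s2 : 0 <= 1 - s by rewrite subr_ge0.
pose vs x := (1 - s) * w x + s * v x.
have avs : admissible vs M.
  split => //.
  - by rewrite /vs; mfun.
  - by move=> x; rewrite /vs addr_ge0// mulr_ge0// ltW.
  - by move=> x xE; rewrite /vs wE// vE// !mulr0 addr0.
  - move=> x; have := vM x; have := w0 x; rewrite /vs => h1 h2.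
    have : s * v x <= s * (w x + M) by rewrite ler_wpM2l ?(ltW s0).
    have : s * M <= M by rewrite ler_piMl.
    by rewrite mulrDr mulrBl mul1r; move: (s * w x) (s * v x) (s * M) => *; lra.
have vs1 : Int vs = 1.
  rewrite (IntD (itgZ _ wi) (itgZ _ (adm_itg av))) (IntZ _ wi) (IntZ _ (adm_itg av)) w1 v1.
  by ring.
have UE y : Upot vs y = (1 - s) * Upot w y + s * Upot v y.
  have i1 := itg_Upot y aw; have i2 := itg_Upot y av.
  rewrite -(IntZ _ i1) -(IntZ _ i2) -(IntD (itgZ _ i1) (itgZ _ i2)).
  by apply: eq_Int => x; rewrite /vs; ring.
apply: (le_trans (wmin avs vs1)).
have iww := itg_UpotM aw aw; have iwv := itg_UpotM aw av.
have ivw := itg_UpotM av aw; have ivv := itg_UpotM av av.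
have S : Int (fun y => Upot v y * w y) = B by rewrite (Upot_sym av aw).
have j1 := itgZ ((1 - s) ^+ 2) iww; have j2 := itgZ (s * (1 - s)) iwv.
have j3 := itgZ (s * (1 - s)) ivw; have j4 := itgZ (s ^+ 2) ivv.
have FE y : Upot vs y * vs y = (1 - s) ^+ 2 * (Upot w y * w y) + s * (1 - s) * (Upot w y * v y)
  + (s * (1 - s) * (Upot v y * w y) + s ^+ 2 * (Upot v y * v y)).
  by rewrite UE /vs; ring.
rewrite (eq_Int FE) (IntD (itgD j1 j2) (itgD j3 j4)) (IntD j1 j2) (IntD j3 j4).
rewrite (IntZ _ iww) (IntZ _ iwv) (IntZ _ ivw) (IntZ _ ivv) S -/Q -/B -/C.
by rewrite le_eqVlt; apply/orP; left; apply/eqP; ring.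
Qed.

(** If the part of [E] where the inequality fails had positive measure, its normalized indicator
    would contradict [w_Upot_ge]. *)
Lemma w_Upot_ae : {ae mu, forall x, E x -> Q <= Upot w x}.
Proof.
pose A := E `&` [set x | Upot w x < Q].
have mU := Upot_meas aw.
have mA : measurable A.
  apply: measurableI => //; rewrite -[X in measurable X]setTI.
  by apply: measurable_fun_ltr => //; exact: measurable_cst.
have Aa x : A x -> `|x| <= a by move=> [/Ea].
pose v x : R := \1_A x.
have mv : measurable_fun [set: R] v by exact: measurable_indic.
have v0 x : 0 <= v x by rewrite /v indicE.
have vi : itg v.
  apply: (itg_le mv (itg_near_ball 0 (a + 1))) => x.
  rewrite ger0_norm// near_ballE sub0r normrN /v indicE.
  by have [/set_mem/Aa h|] := boolP (x \in A); [rewrite (le_lt_trans h)// ltrDl|].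
suff : {ae mu, forall x, v x = 0}.
  apply: aeS => x vx xE; rewrite leNgt; apply/negP => h.
  by move: vx; rewrite /v indicE mem_set// => /eqP; rewrite oner_eq0.
have [/(Int_eq0_ae vi v0)//|I0] := eqVneq (Int v) 0.
have Ip : 0 < Int v by rewrite lt_neqAle eq_sym I0; exact: Int_ge0.
(* The competitor is bounded by its own height, which serves as the constant [M]. *)
have av : admissible (fun x => (Int v)^-1 * v x) (Int v)^-1.
  split.
  - by mfun.
  - by move=> x; rewrite mulr_ge0// invr_ge0 ltW.
  - move=> x xE; rewrite /v indicE memNset ?mulr0//; by case.
  - move=> x; rewrite -[leLHS]add0r lerD// ler_piMr ?invr_ge0 ?(ltW Ip)//.
    by rewrite /v indicE; case: (_ \in _).
  - by rewrite invr_ge0 ltW.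
have av1 : Int (fun x => (Int v)^-1 * v x) = 1 by rewrite (IntZ _ vi) mulVf.
have h := w_Upot_ge av av1.
have iU := itg_UpotM aw av; have iv := itgZ (Int v)^-1 vi.
pose f x := Q * ((Int v)^-1 * v x) - Upot w x * ((Int v)^-1 * v x).
have fi : itg f by apply: itgB; [exact: itgZ|].
have fE x : f x = (Q - Upot w x) * ((Int v)^-1 * v x) by rewrite /f mulrBl.
have f0 x : 0 <= f x.
  rewrite fE /v indicE; have [/set_mem[_ /= h1]|_] := boolP (x \in A); last by rewrite !mulr0.
  by rewrite mulr_ge0 ?subr_ge0 ?(ltW h1)// mulr_ge0// invr_ge0 ltW.
have If : Int f = 0.
  apply/eqP; rewrite eq_le Int_ge0// andbT /f (IntB (itgZ Q iv) iU) (IntZ _ iv) av1 mulr1.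
  by rewrite subr_le0.
apply: aeS (Int_eq0_ae fi f0 If) => x /eqP; rewrite fE !mulf_eq0 invr_eq0 (negbTE I0)/=.
move=> /orP[/eqP h1|/eqP//]; rewrite /v indicE.
by have [/set_mem[_ /= h2]|//] := boolP (x \in A); move: h2; rewrite -subr_gt0 h1 ltxx.
Qed.

(** [(Upot w - Q) * w] is nonnegative almost everywhere and its integral is [Q - Q], the mass of [w]
    being 1. *)
Lemma w_Upot_eq : {ae mu, forall x, Upot w x = Q \/ w x = 0}.
Proof.
pose f x := Upot w x * w x - Q * w x.
have iU := itg_UpotM aw aw; have iQ := itgZ Q wi.
have fi : itg f by exact: itgB.
have fE x : f x = (Upot w x - Q) * w x by rewrite /f mulrBl.
have f0 : {ae mu, forall x, `|f x| = f x}.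
  apply: aeS w_Upot_ae => x h; rewrite fE ger0_norm//.
  have [xE|xE] := pselect (E x); last by rewrite wE// mulr0.
  by rewrite mulr_ge0// subr_ge0 h.
have If : Int (fun x => `|f x|) = 0.
  rewrite (ae_Int (itg_meas (itg_abs fi)) (itg_meas fi) f0) (IntB iU iQ) (IntZ _ wi) w1 mulr1.
  by rewrite subrr.
apply: aeS (Int_eq0_ae (itg_abs fi) (fun x => normr_ge0 _) If) => x /eqP.
rewrite normr_eq0 fE mulf_eq0 => /orP[|] /eqP h; [left|by right].
by apply/eqP; rewrite -subr_eq0 h.
Qed.

(** Lower semicontinuity of the potential, by Fatou's lemma; the kernels converge except at [x = l].
    Hence the set where [Upot w <= Q] is closed. *)
Let Upot_lim l (u : nat -> R) : u n @[n --> \oo] --> l -> (forall n, Upot w (u n) <= Q) ->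
  Upot w l <= Q.
Proof.
move=> ul uQ.
have F0 n x : 0 <= kap D (x - u n) * w x by rewrite mulr_ge0 ?kap_ge0.
have f0 x : 0 <= kap D (x - l) * w x by rewrite mulr_ge0 ?kap_ge0.
have Fi n := itg_Upot (u n) aw.
have mf := itg_meas (itg_Upot l aw).
have cv : {ae mu, forall x, (fun n => kap D (x - u n) * w x) @ \oo --> kap D (x - l) * w x}.
  apply: aeS (ae_neq l) => x xl; apply: cvgM; last exact: cvg_cst.
  have h1 : (fun n => `|x - u n|) @ \oo --> `|x - l|.
    by apply: cvg_norm; apply: cvgB; [exact: cvg_cst|exact: ul].
  have p : 0 < `|x - l| by rewrite normr_gt0 subr_eq0.
  have h2 := continuous_cvg _ (continuous_ln p) h1.
  have h3 : (fun n => ln D - ln `|x - u n|) @ \oo --> ln D - ln `|x - l|.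
    by apply: cvgB; [exact: cvg_cst|exact: h2].
  have mE1 z : kap D z = 2^-1 * ((ln D - ln `|z|) + `|ln D - ln `|z| |).
    rewrite /kap; case: (leP 0 (ln D - ln `|z|)) => h.
      by rewrite (ger0_norm h); move: (ln D - _) => A; field.
    by rewrite (ltr0_norm h) subrr mulr0.
  rewrite mE1 (_ : (fun n => kap D (x - u n)) =
    fun n => 2^-1 * ((ln D - ln `|x - u n|) + `|ln D - ln `|x - u n| |)); last first.
    by apply/funext => n; exact: mE1.
  apply: cvgM; first exact: cvg_cst.
  by apply: cvgD; [exact: h3|apply: cvg_norm; exact: h3].
by have [_] := Fatou_Int Fi F0 mf f0 cv uQ.
Qed.

Let Q0 : 0 <= Q.
Proof. by apply: Int_ge0 => x; rewrite mulr_ge0// (Upot_ge0 x aw). Qed.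

(** The cut-off in [kap] makes the potential vanish far away, so every gap has endpoints on both
    sides. *)
Let Upot_far y : a + D <= `|y| -> Upot w y <= Q.
Proof.
move=> h; rewrite (_ : Upot w y = 0); first exact: Q0.
rewrite -(Int0 (R := R)); apply: eq_Int => x.
have [xE|xE] := pselect (E x); last by rewrite wE// mulr0.
rewrite /kap (_ : Num.max _ _ = 0) ?mul0r//; apply/max_idPl; rewrite subr_le0.
have D0 : 0 < D by exact: lt_le_trans D1.
have h1 : D <= `|x - y|.
  have := lerB_dist y x; rewrite distrC; have := Ea xE.
  by move: (`|x - y|) (`|y|) (`|x|) h => A B C; lra.
by rewrite ler_ln ?posrE// (lt_le_trans D0).
Qed.

(* A point with [U > Q] lies in a gap [(l, r)] of the closed set [U <= Q]; [w] vanishes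
   there, and outside of the gap the kernel at [y] is at most the convex combination
   of those at [l] and [r]. *)
Lemma w_Upot_le y : Upot w y <= Q.
Proof.
rewrite leNgt; apply/negP => yQ.
have yfar : `|y| < a + D by rewrite ltNge; apply/negP => /Upot_far; rewrite leNgt yQ.
pose S := [set s | Upot w s <= Q].
have yb : - (a + D) < y /\ y < a + D by move: yfar; rewrite ltr_norml => /andP[].
have aD : 0 <= a + D by rewrite (le_trans (normr_ge0 y))// ltW.
pose SL := S `&` [set s | s <= y]; pose SR := S `&` [set s | y <= s].
have SL0 : SL (- (a + D)).
  by split => /=; [apply: Upot_far; rewrite normrN ger0_norm|case: yb => /ltW].
have SR0 : SR (a + D).
  by split => /=; [apply: Upot_far; rewrite ger0_norm|case: yb => _ /ltW].
have hsL : has_sup SL by split; [exists (- (a + D))|exists y => s []].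
have hiR : has_inf SR by split; [exists (a + D)|exists y => s []].
pose l := sup SL; pose r := inf SR.
have lS : Upot w l <= Q.
  have /choice[u hu] n : exists s, SL s /\ l - eps n < s.
    by have [s ss sl] := sup_adherent (@eps_gt0 R n) hsL; exists s.
  apply: (@Upot_lim l u); last by move=> n; case: (hu n) => -[].
  apply: (@squeeze_cvgr _ _ _ _ (fun n => l - eps n) (fun=> l)); last exact: cvg_cst.
    apply: nearW => n; have [us lu] := hu n; rewrite (ltW lu)/=.
    exact: (ub_le_sup hsL.2 us).
  rewrite -[X in _ --> X]subr0; apply: cvgB; [exact: cvg_cst|exact: cvg_eps].
have rS : Upot w r <= Q.
  have /choice[u hu] n : exists s, SR s /\ s < r + eps n.
    by have [s ss sl] := inf_adherent (@eps_gt0 R n) hiR; exists s.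
  apply: (@Upot_lim r u); last by move=> n; case: (hu n) => -[].
  apply: (@squeeze_cvgr _ _ _ _ (fun=> r) (fun n => r + eps n)); last 2 first.
  - exact: cvg_cst.
  - rewrite -[X in _ --> X]addr0; apply: cvgD; [exact: cvg_cst|exact: cvg_eps].
  apply: nearW => n; have [us lu] := hu n; rewrite (ltW lu) andbT.
  exact: (ge_inf hiR.2 us).
have ly : l < y.
  rewrite lt_neqAle; apply/andP; split.
    by apply/eqP => h; move: lS; rewrite h leNgt yQ.
  by apply: ge_sup; [exists (- (a + D))|move=> s []].
have yr : y < r.
  rewrite lt_neqAle; apply/andP; split.
    by apply/eqP => h; move: rS; rewrite -h leNgt yQ.
  by apply: lb_le_inf; [exists (a + D)|move=> s []].
have gap x : l < x -> x < r -> Q < Upot w x.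
  move=> lx xr; rewrite ltNge; apply/negP => xS.
  have [xy|yx] := leP x y.
    by have : x <= l by [apply: (ub_le_sup hsL.2)]; rewrite leNgt lx.
  by have : r <= x by [apply: (ge_inf hiR.2); split => //=; exact: ltW]; rewrite leNgt xr.
have lr : l < r by exact: lt_trans yr.
have [c /andP[c0 c1] hc] := @kap_convex_out R D l r y ly yr.
have il := itg_Upot l aw; have ir := itg_Upot r aw; have iy := itg_Upot y aw.
have le1 : Upot w y <= Int (fun x => c * (kap D (x - l) * w x) + (1 - c) * (kap D (x - r) * w x)).
  apply: (ae_Int_le iy (itgD (itgZ c il) (itgZ (1 - c) ir))).
  have h3 := aeS2 (fun x (h : x != l) (h' : x != r) => conj h h') (ae_neq l) (ae_neq r).
  apply: aeS2 w_Upot_eq h3 => x hx [xl xr].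
  (* Where [w] is nonzero the potential is [Q], so the point is not in the gap. The endpoints were
     excluded because [kap] is finite at 0 by convention and convexity fails there. *)
  have [->|wx] := eqVneq (w x) 0; first by rewrite !mulr0 addr0.
  have {hx} Ux : Upot w x = Q by case: hx => // h; rewrite h eqxx in wx.
  have out : (x < l) || (r < x).
    rewrite -[x < l]orbF; case: (ltgtP x l) xl => //= lx _; case: (ltgtP r x) xr => //= xr' _.
    by have := gap x lx xr'; rewrite Ux ltxx.
  by rewrite !mulrA -mulrDl ler_wpM2r// hc.
have : Upot w y <= Q.
  apply: (le_trans le1); rewrite (IntD (itgZ c il) (itgZ (1 - c) ir)) (IntZ _ il) (IntZ _ ir).
  rewrite -/(Upot w l) -/(Upot w r).
  have : c * Upot w l <= c * Q by rewrite ler_wpM2l.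
  have : (1 - c) * Upot w r <= (1 - c) * Q by rewrite ler_wpM2l// subr_ge0.
  rewrite !mulrBl; move: (c * Q) (c * Upot w l) ((_ - _ : R)) => A B C; lra.
by rewrite leNgt yQ.
Qed.

Lemma equilibrium_constant : exists c, {ae mu, forall x, E x -> Upot w x = c}.
Proof.
exists Q; apply: aeS w_Upot_ae => x h xE; apply/eqP.
by rewrite eq_le w_Upot_le h.
Qed.

End Potential.

(** * From the energy of measures to the energy of densities *)

Section Equilibrium.
Context {R : realType}.
Notation mu := (@lebesgue_measure R).
Implicit Types (f g h v : R -> R) (d e t s x y a B M N : R).

Variables (E : set R) (w : R -> R) (q a : R) (k : nat).
Hypotheses (mw : measurable_fun [set: R] w) (w0 : forall x, 0 <= w x) (wi : itg w)
  (wq : itg (fun x => w x `^ q)) (k0 : (0 < k)%N)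
  (kq : 1 <= (q - 1) * (2 ^ k).-1%:R).
Hypotheses (a0 : 0 <= a) (mE : measurable E) (Ea : forall x, E x -> `|x| <= a).
Notation D := (1 + 2 * a).

Let D1 : 1 <= D. Proof. by rewrite lerDl mulr_ge0. Qed.

(** [D = 1 + 2 * a] exceeds the diameter of [E], so on [E] and off the diagonal the kernel is
    [kap - ln D]. The exceptional sets are null because [nu] is carried by [E] and, having a
    density, charges no point. *)
Lemma log_energyE (nu : probability (measurableTypeR R) R) v M :
  (forall A : set (measurableTypeR R), measurable A -> nu A = (\int[mu]_(x in A) (v x)%:E)%E) ->
  admissible E w v M -> supported_in E nu ->
  log_energy nu = (Int (fun y => Upot D v y * v y) - ln D)%:E.
Proof.
move=> nuE av sE; have [mv v0 vE _ _] := av.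
have iU y := itg_Upot mw w0 wi wq k0 kq D1 y av.
have mv' : measurable_fun [set: measurableTypeR R] (EFin \o v) by exact/measurable_EFinP.
have nu1 x : nu [set x] = 0%E.
  rewrite nuE; last exact: measurable_set1.
  apply: null_set_integral; first exact: measurable_set1.
    by apply: measurable_funTS; exact: mv'.
  exact: lebesgue_measure_set1.
have mcE : measurable (~` E) by exact: measurableC.
have inner x : E x -> (\int[nu]_t (- lne (`|x - t|%R)%:E) = (Upot D v x)%:E - (ln D)%:E)%E.
  move=> xE; have mk : measurable_fun [set: R] (fun t => (kap D (t - x))%:E).
    by apply/measurable_EFinP; apply: mshift; exact: measurable_kap.
  have mN : measurable (~` E `|` [set x]) by apply: measurableU => //; exact: measurable_set1.
  have N0 : nu (~` E `|` [set x]) = 0%E.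
    apply: (@null_set_setU _ (measurableTypeR R) R nu (~` E) [set x]).
    - exact: mcE.
    - exact: measurable_set1.
    - exact: sE.
    - exact: nu1.
  rewrite (@integral_null_eq _ (measurableTypeR R) R nu _ _ (fun t => (kap D (t - x))%:E - (ln D)%:E)%E mN N0); last first.
    move=> t /not_orP[/contrapT tE tx].
    have p : 0 < `|t - x| by rewrite normr_gt0 subr_eq0; apply/eqP.
    rewrite distrC lne_EFin// kapE//; last first.
      have := ler_normB t x; have := Ea tE; have := Ea xE.
      by move: (`|t|) (`|x|) (`|t - x|) => A B C; lra.
    by rewrite -EFinB addrAC subrr sub0r.
  rewrite integral_subc//; last by move=> t; rewrite lee_fin kap_ge0.
  rewrite (integral_density mv v0 nuE mk); last by move=> t; rewrite lee_fin kap_ge0.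
  by rewrite (IntE (iU x)).
rewrite /log_energy (@integral_null_eq _ (measurableTypeR R) R nu _ _ (fun x => (Upot D v x)%:E - (ln D)%:E)%E mcE sE); last first.
  by move=> x /contrapT xE; exact: inner.
have mU := Upot_meas mw w0 wi wq k0 kq D1 av.
have mU' : measurable_fun [set: R] (fun x => (Upot D v x)%:E) by exact/measurable_EFinP.
have U0 x : (0 <= (Upot D v x)%:E)%E by rewrite lee_fin; exact: (Upot_ge0 D x av).
rewrite integral_subc// (integral_density mv v0 nuE mU' U0).
by rewrite (IntE (itg_UpotM mw w0 wi wq k0 kq D1 Ea av av)).
Qed.

Hypothesis wE : equilibrium_density E w.

Lemma equilibrium_minimizing : minimizing E w D.
Proof.
have [nu [[_ sE wmin] _ _ nuE wE0]] := wE.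
move=> v M av v1.
have aw : admissible E w w 0 by split => // x; rewrite addr0.
have [mv v0 vE _ _] := av.
have vi : itg v.
  exact: (adm_itg w0 wi Ea av).
have v1' : (\int[mu]_x (v x)%:E = 1)%E by rewrite (IntE vi) v1.
pose nv := dens_prob mv v0 v1'.
have nvE A : measurable A -> nv A = (\int[mu]_(x in A) (v x)%:E)%E by [].
have sv : supported_in E nv.
  rewrite /supported_in nvE; last exact: measurableC.
  by rewrite integral0_eq// => x xE; rewrite vE.
have := wmin nv sv.
rewrite (log_energyE nuE aw sE) (log_energyE nvE av sv) lee_fin.
by rewrite lerD2r.
Qed.

Lemma equilibrium_mass : Int w = 1.
Proof.
have [nu [_ _ _ nuE _]] := wE.
apply: EFin_inj; rewrite -(IntE wi) -nuE; last exact: measurableT.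
exact: probability_setT.
Qed.

Lemma equilibrium_potential : exists c, {ae mu, forall x, E x -> Upot D w x = c}.
Proof.
have [nu [_ _ _ _ wE0]] := wE.
exact: (equilibrium_constant mw w0 wi wq k0 kq D1 mE Ea wE0 equilibrium_mass equilibrium_minimizing).
Qed.

End Equilibrium.

(** * Orthogonality of smoothed Hilbert transforms to the equilibrium density *)

Section Box.
Context {R : realType}.
Notation mu := (@lebesgue_measure R).
Local Notation Po e := (cv (Pois e)).
Local Notation Qo e := (cv (Conj e)).
Implicit Types (f g phi v : R -> R) (d e t s x y a h B M N : R).

Lemma Int_shift g h : itg g -> itg (fun t => g (t + h)) /\ Int (fun t => g (t + h)) = Int g.
Proof.
move=> gi; have i1 := itg_refl h gi; have i2 := itg_refl 0 i1.
have E t : g (h - (0 - t)) = g (t + h) by congr g; ring.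
split; first exact: eq_itg E i2.
rewrite -(eq_Int E) (@Int_refl _ (fun u => g (h - u)) 0 i2 (itg_meas i1)).
exact: Int_refl i1 (itg_meas gi).
Qed.

Definition box h u : R := h^-1 * (0 <= u <= h)%R%:R.

Lemma box_ge0 h u : 0 < h -> 0 <= box h u.
Proof. by move=> h0; rewrite mulr_ge0// invr_ge0 (ltW h0). Qed.

Lemma box_le h u : 0 < h -> `|box h u| <= h^-1.
Proof.
move=> h0; rewrite ger0_norm ?box_ge0// ler_piMr ?invr_ge0 ?(ltW h0)//.
by case: (_ && _).
Qed.

Lemma boxE h s t : box h (t - s) = h^-1 * \1_(`[s, s + h]%classic : set R) t.
Proof.
congr (_ * _); rewrite indicE mem_setE in_itv/= subr_ge0 lerBlDl.
by case: (_ && _).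
Qed.

Lemma mbox h : measurable_fun [set: R] (box h).
Proof.
have -> : box h = fun t => h^-1 * \1_(`[0, 0 + h]%classic : set R) t.
  by apply/funext => t; rewrite -boxE subr0.
by apply: measurable_funM; [exact: measurable_cst|exact: measurable_indic].
Qed.

(* Domination by the Poisson kernel gives access to [Leb_pt]. *)
Lemma box_Pois h u : 0 < h -> `|u| <= h -> h^-1 <= 2 * (pi * Pois h u).
Proof.
move=> h0 uh; have p := pi_gt0 R; rewrite PoisE /pk.
have d0 := den_gt0 u h0.
rewrite mulVKf ?gt_eqF// mulrA ler_pdivlMr// mulrC ler_pdivrMr//.
have : u ^+ 2 <= h ^+ 2 by rewrite -(real_normK (num_real u)) lerXn2r ?nnegrE ?(ltW h0).
by rewrite -mulrA -expr2; move: (u ^+ 2) (h ^+ 2) => A B; lra.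
Qed.

(** The recentred second bound is for a factor evaluated at [t + h] under the average. *)
Lemma boxP h u : 0 < h -> box h u <= 2 * (pi * Pois h u) /\ box h u <= 2 * (pi * Pois h (u - h)).
Proof.
move=> h0; have p := pi_gt0 R.
have P0 x : 0 <= 2 * (pi * Pois h x) by rewrite !mulr_ge0 ?Pois_ge0 ?(ltW p).
rewrite /box; have [/andP[u0 uh]|_] := boolP (0 <= u <= h); last by rewrite mulr0; split; exact: P0.
rewrite mulr1; split; apply: box_Pois => //; first by rewrite ger0_norm.
by rewrite distrC ger0_norm ?subr_ge0// gerBl.
Qed.

Lemma Int_box h x : 0 < h -> itg (fun t => box h (x - t)) /\ Int (fun t => box h (x - t)) = 1.
Proof.
move=> h0; have E t : box h (x - t) = h^-1 * \1_(`[x - h, x]%classic : set R) t.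
  congr (_ * _); rewrite indicE mem_setE in_itv/=; congr (nat_of_bool _)%:R.
  by apply/idP/idP => /andP[? ?]; apply/andP; split; lra.
pose J : set R := `[x - h, x]%classic.
have mJ : measurable_fun [set: R] (\1_J : R -> R) by apply: measurable_indic; exact: measurable_itv.
have Ji : itg (\1_J : R -> R).
  apply: (itg_le mJ (itg_near_ball x (h + 1))) => t.
  rewrite near_ballE indicE ger0_norm//.
  have [/set_mem|//] := boolP (t \in J); rewrite /J/= in_itv/= => /andP[h1 h2].
  by rewrite ger0_norm ?subr_ge0// (_ : x - t < h + 1)//; lra.
split; first by apply: (eq_itg (fun t => esym (E t))); exact: itgZ.
rewrite (eq_Int E) (IntZ _ Ji) IntEfine integral_indic ?setIT//; last exact: measurable_itv.
have mJe : mu (`[x - h, x]%classic : set R) = h%:E.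
  rewrite lebesgue_measure_itv/= lte_fin gtrBl h0 -EFinB; congr EFin; ring.
by rewrite [X in fine X](_ : _ = h%:E) ?mulVf// gt_eqF.
Qed.

Definition Lq e u : R := 2^-1 * ln (u ^+ 2 + e ^+ 2).

(** The convolution of [Conj e] with [box h] in closed form: [pi * Conj e] is the derivative of
    [Lq e], so averaging gives a difference quotient. *)
Definition Lbox h e u : R := (pi * h)^-1 * (Lq e u - Lq e (u - h)).

Lemma Int_Conj_box h e x s : 0 < h -> 0 < e ->
  itg (fun t => Conj e (x - t) * box h (t - s)) /\
  Int (fun t => Conj e (x - t) * box h (t - s)) = Lbox h e (x - s).
Proof.
move=> h0 e0; have p := pi_gt0 R.
have E t : Conj e (x - t) * box h (t - s) =
    h^-1 * ((fun t => Conj e (x - t)) \_ (`[s, s + h]%classic : set R)) t.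
  rewrite boxE patchE indicE mulrCA; congr (_ * _).
  by case: (_ \in _); rewrite ?mulr1 ?mulr0.
have mI : measurable (`[s, s + h]%classic : set R) by exact: measurable_itv.
have ci : continuous (fun t => Conj e (x - t)).
  move=> t; have h1 : {for t, continuous (Conj e \o (fun t => x - t))}.
    apply: continuous_comp; last exact: cont_Q.
    by apply: cvgB; [exact: cvg_cst|exact: cvg_id].
  exact: h1.
have i : itg ((fun t => Conj e (x - t)) \_ (`[s, s + h]%classic : set R)).
  rewrite itgE -restrict_EFin.
  apply: (iffLR (@integrable_mkcond _ _ _ mu _ (EFin \o (fun t => Conj e (x - t))) mI)).
  by apply: continuous_compact_integrable; [exact: segment_compact|exact: continuous_subspaceT].
split; first by apply: (eq_itg (fun t => esym (E t))); exact: itgZ.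
rewrite (eq_Int E) (IntZ _ i) Int_restrict.
pose F t := - pi^-1 * (2^-1 * ln ((t - x) ^+ 2 + e ^+ 2)).
have dF t : is_derive t (1 : R) F (Conj e (x - t)).
  have d1 := is_deriveZ (- pi^-1) (is_derive_lnq x t e0).
  apply: (is_derive_eq d1); rewrite /GRing.scale/= ConjE /qk mulNr -mulrN; congr (_ * _).
  by rewrite -mulNr opprB -[(t - x) ^+ 2]sqrrN opprB.
rewrite (FTC_itv _ dF ci); last by rewrite ltrDl.
rewrite /F /Lbox /Lq -[(s - x) ^+ 2]sqrrN opprB -[(s + h - x) ^+ 2]sqrrN.
rewrite (_ : - (s + h - x) = x - s - h); last by ring.
move: p; move: (@pi R) (ln _) (ln _) => p A B p0.
by field; rewrite !gt_eqF.
Qed.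

Lemma Lbox_bnd h e u : 0 < h -> 0 < e -> `|Lbox h e u| <= kb e.
Proof.
move=> h0 e0; have [i E] := Int_Conj_box u 0 h0 e0; rewrite subr0 in E; rewrite -E.
have Eb t : box h (t - 0) = box h (h - (h - t)) by congr (box h _); ring.
have [bi b1] := Int_box h h0.
have bi' : itg (fun t => box h (t - 0)).
  apply: (eq_itg (fun t => esym (Eb t))); exact: (itg_refl h bi).
have b1' : Int (fun t => box h (t - 0)) = 1.
  rewrite -b1 -(@Int_refl _ (fun t => box h (h - t)) h (itg_refl h bi) (itg_meas bi)).
  by apply: eq_Int => t; rewrite Eb.
rewrite -[leRHS]mulr1 -b1' -(IntZ _ bi'); apply: (Int_absle i (itgZ _ bi')) => t.
rewrite normrM (ger0_norm (box_ge0 _ h0)); apply: ler_wpM2r; first exact: box_ge0.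
exact: Conj_le.
Qed.

Lemma mLbox h e : 0 < h -> 0 < e -> measurable_fun [set: R] (Lbox h e).
Proof.
move=> h0 e0; have mL : measurable_fun [set: R] (Lq e).
  apply: measurable_funM; first exact: measurable_cst.
  apply: measurableT_comp; first exact: measurable_ln.
  by mfun.
by rewrite /Lbox; mfun.
Qed.

Lemma Qo_box h e a M f x : 0 < h -> 0 < e -> bsupp a M f ->
  Qo e (cv (box h) f) x = cv (Lbox h e) f x.
Proof.
move=> h0 e0 fb; have fi := bsupp_itg fb; have [mf fM fa] := fb.
pose G t s := Conj e (x - t) * (box h (t - s) * f s).
have kb0 := kb_ge0 e0.
have hi0 : 0 <= h^-1 by rewrite invr_ge0 (ltW h0).
have mb := mbox h.
have [Gx Gt _ _ E] : [/\ forall t, itg (G t), forall s, itg (G^~ s),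
      itg (fun t => Int (G t)), itg (fun s => Int (G^~ s)) &
      Int (fun t => Int (G t)) = Int (fun s => Int (G^~ s))].
  apply: (@FubM _ G (fun t => kb e * h^-1 * near_ball 0 (a + h + 1) t) (fun s => `|f s|)).
  - by rewrite /G; mfun.
  - by apply: itgZ; exact: itg_near_ball.
  - exact: itg_abs.
  - by move=> t; rewrite (mulr_ge0 (mulr_ge0 kb0 hi0))// near_ball_ge0.
  - move=> t s; rewrite /G (normrM (Conj _ _)) (normrM (box _ _)) near_ballE sub0r normrN.
    move: kb0 (Conj_le (x - t) e0); rewrite -/(kb e); move: (kb e) => K K0 HK.
    rewrite -[leRHS]mulrA -[K / h * _]mulrA.
    apply: ler_pM; [exact: normr_ge0|exact: mulr_ge0|exact: HK|].
    have [sa|sa] := leP `|s| a; last by rewrite fa// normr0 !mulr0.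
    have [bs|bs] := boolP (0 <= t - s <= h); last first.
      by rewrite /box (negbTE bs) mulr0 normr0 mul0r; apply: mulr_ge0 => //; exact: mulr_ge0.
    rewrite mulrA ler_wpM2r// (_ : `|t| < a + h + 1).
      by rewrite mulr1; exact: box_le.
    move: bs => /andP[b1 b2]; have := ler_normD (t - s) s; rewrite subrK (ger0_norm b1).
    by move: (`|t|) (`|s|) (t - s) b2 sa => A B C; lra.
rewrite (_ : Qo e (cv (box h) f) x = Int (fun t => Int (G t))).
  rewrite E; apply: eq_Int => s; have [i <-] := Int_Conj_box x s h0 e0.
  by rewrite mulrC -(IntZ _ i); apply: eq_Int => t; rewrite /G; ring.
apply: eq_Int => t; rewrite -(IntZ _ (cv_itg mb (fun u => box_le u h0) t fi)).
by [].
Qed.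

End Box.

(** * Vanishing of the smoothed transform against the density *)

Section Annihilation.
Context {R : realType}.
Notation mu := (@lebesgue_measure R).
Local Notation Po e := (cv (Pois e)).
Local Notation Qo e := (cv (Conj e)).
Implicit Types (f g phi v : R -> R) (d e t s x y h B M N : R).

Variables (E : set R) (w : R -> R) (q a c : R) (k : nat).
Hypotheses (mw : measurable_fun [set: R] w) (w0 : forall x, 0 <= w x) (wi : itg w)
  (wq : itg (fun x => w x `^ q)) (k0 : (0 < k)%N)
  (kq : 1 <= (q - 1) * (2 ^ k).-1%:R).
Hypotheses (a0 : 0 <= a) (mE : measurable E) (Ea : forall x, E x -> `|x| <= a)
  (wE : forall x, ~ E x -> w x = 0).
Notation D := (1 + 2 * a).
Hypothesis Uc : {ae mu, forall x, E x -> Upot D w x = c}.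

Let D1 : 1 <= D. Proof. by rewrite lerDl mulr_ge0. Qed.

Let aw : admissible E w w 0.
Proof. by split => // x; rewrite addr0. Qed.

Let iU y : itg (fun x => kap D (x - y) * w x).
Proof. exact: (itg_Upot mw w0 wi wq k0 kq D1 y aw). Qed.

(** Uniform in [e <= 1]: [Lq e u] lies between [ln |u|] and [ln D], the 1 in [D = 1 + 2 * a] leaving
    room for [e ^+ 2]. *)
Lemma Lq_bnd e u : 0 < e -> e <= 1 -> u != 0 -> `|u| <= 2 * a -> `|Lq e u| <= ln D + kap D u.
Proof.
move=> e0 e1 u0 ua; have D0 : 0 < D by exact: lt_le_trans D1.
have uD : `|u| <= D by apply: le_trans ua _; rewrite lerDr.
rewrite kapE// /Lq.
have lD : 2^-1 * ln (D ^+ 2) = ln D.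
  by rewrite lnXn// -[ln D *+ 2]mulr_natl mulrA mulVf// mul1r.
have lu : 2^-1 * ln (u ^+ 2) = ln `|u|.
  by rewrite -(real_normK (num_real u)) lnXn ?normr_gt0// -[ln _ *+ 2]mulr_natl mulrA mulVf// mul1r.
have u2 : 0 < u ^+ 2 by rewrite exprn_even_gt0.
have h1 : ln (u ^+ 2) <= ln (u ^+ 2 + e ^+ 2).
  by rewrite ler_ln ?posrE ?den_gt0// lerDl sqr_ge0.
have h2 : ln (u ^+ 2 + e ^+ 2) <= ln (D ^+ 2).
  rewrite ler_ln ?posrE ?den_gt0 ?exprn_gt0//.
  have : u ^+ 2 <= (2 * a) ^+ 2 by rewrite -(real_normK (num_real u)) lerXn2r ?nnegrE ?mulr_ge0.
  have : e ^+ 2 <= 1 by rewrite expr_le1// ltW.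
  rewrite sqrrD expr1n mul1r; move: (u ^+ 2) (e ^+ 2) ((2 * a) ^+ 2) => A B C.
  by move: a0 => ? ? ?; lra.
have h3 : ln `|u| <= ln D by rewrite ler_ln ?posrE ?normr_gt0.
have h4 : 0 <= ln D by rewrite ln_ge0.
rewrite -lu in h3 *; rewrite -lD in h3 h4 *.
move: (ln (u ^+ 2)) (ln (u ^+ 2 + e ^+ 2)) (ln (D ^+ 2)) h1 h2 h3 h4 => A B C h1 h2 h3 h4.
by rewrite ler_norml; apply/andP; split; lra.
Qed.

Lemma eps_le1 n : (eps n : R) <= 1.
Proof. by rewrite /eps -[leRHS]invr1 lef_pV2 ?posrE ?ltr0n// ler1n. Qed.

Lemma cvg_Lq (u : R) : u != 0 -> (fun n => Lq (eps n) u) @ \oo --> ln `|u|.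
Proof.
move=> u0; have u2 : 0 < u ^+ 2 by rewrite exprn_even_gt0.
have h1 : (fun n => u ^+ 2 + eps n ^+ 2) @ \oo --> u ^+ 2.
  rewrite -[u ^+ 2 in X in _ --> X]addr0; apply: cvgD; first exact: cvg_cst.
  by rewrite -(mulr0 (0 : R)); apply: cvgM; exact: cvg_eps.
have -> : ln `|u| = 2^-1 * ln (u ^+ 2).
  by rewrite -(real_normK (num_real u)) lnXn ?normr_gt0// -[ln _ *+ 2]mulr_natl mulrA mulVf// mul1r.
by apply: cvgM; [exact: cvg_cst|exact: (continuous_cvg _ (continuous_ln u2) h1)].
Qed.

(* Both endpoints lie where the potential takes its constant value. *)
Let good h t := [/\ E t, E (t + h), Upot D w t = c & Upot D w (t + h) = c].

Let inner h t n := Int (fun x => Lbox h (eps n) (x - t) * w x).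

(** The limit is [(Upot (t + h) - Upot t) / (pi * h)], where both potentials equal [c]. The majorant
    has the same integral for every good [t], hence a bound uniform in [t] as well. *)
Let inner_cvg h t : 0 < h -> good h t ->
  (forall n, `|inner h t n| <= (pi * h)^-1 * ((ln D * Int w + c) + (ln D * Int w + c))) /\
  inner h t n @[n --> \oo] --> 0.
Proof.
move=> h0 [tE thE Ut Uth]; set K := (pi * h)^-1.
have K0 : 0 <= K by rewrite invr_ge0 mulr_ge0 ?(ltW h0)// pi_ge0.
have i1 := iU t; have i2 := iU (t + h); have ilw := itgZ (ln D) wi.
pose g x := K * ((ln D * w x + kap D (x - t) * w x) + (ln D * w x + kap D (x - (t + h)) * w x)).
have gi0 := itgD (itgD ilw i1) (itgD ilw i2).
have gi : itg g by exact: itgZ.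
have Ig : Int g = K * ((ln D * Int w + c) + (ln D * Int w + c)).
  rewrite (IntZ _ gi0) (IntD (itgD ilw i1) (itgD ilw i2)) (IntD ilw i1) (IntD ilw i2) (IntZ _ wi).
  by rewrite -/(Upot D w t) -/(Upot D w (t + h)) Ut Uth.
have ne := aeS2 (fun x (u : x != t) (v : x != t + h) => conj u v) (ae_neq t) (ae_neq (t + h)).
have mF n : measurable_fun [set: R] (fun x => Lbox h (eps n) (x - t) * w x).
  by have mL := mLbox h0 (@eps_gt0 R n); mfun.
have dom n : {ae mu, forall x, `|Lbox h (eps n) (x - t) * w x| <= g x}.
  apply: aeS ne => x [xt xh]; rewrite normrM (ger0_norm (w0 x)).
  have [xE|xE] := pselect (E x); last by rewrite /g wE// !mulr0 !addr0 mulr0.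
  have xa := Ea xE; have ta := Ea tE; have tha := Ea thE.
  have b1 : `|x - t| <= 2 * a.
    by have := ler_normB x t; move: (`|x|) (`|t|) (`|x - t|) xa ta => A B C *; lra.
  have b2 : `|x - (t + h)| <= 2 * a.
    by have := ler_normB x (t + h); move: (`|x|) (`|t + h|) (`|x - (t + h)|) xa tha => A B C *; lra.
  have l1 := @Lq_bnd (eps n) (x - t) (eps_gt0 n) (eps_le1 n) _ b1.
  have l2 := @Lq_bnd (eps n) (x - (t + h)) (eps_gt0 n) (eps_le1 n) _ b2.
  rewrite !subr_eq0 in l1 l2; have {}l1 := l1 xt; have {}l2 := l2 xh.
  rewrite /Lbox -/K normrM (ger0_norm K0) /g -mulrA; apply: ler_wpM2l => //.
  rewrite -!mulrDl; apply: ler_wpM2r => //.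
  rewrite (_ : x - t - h = x - (t + h)); last by ring.
  exact: (le_trans (ler_normB _ _) (lerD l1 l2)).
pose f x := K * (kap D (x - (t + h)) * w x - kap D (x - t) * w x).
have fi : itg f by apply: itgZ; exact: itgB.
have If : Int f = 0.
  rewrite (IntZ _ (itgB i2 i1)) (IntB i2 i1) -/(Upot D w t) -/(Upot D w (t + h)) Ut Uth.
  by rewrite subrr mulr0.
have cvf : {ae mu, forall x, (fun n => Lbox h (eps n) (x - t) * w x) @ \oo --> f x}.
  apply: aeS ne => x [xt xh].
  have [xE|xE] := pselect (E x); last first.
    rewrite /f wE// !mulr0 subrr mulr0.
    rewrite (_ : (fun n => _) = fun=> 0); first exact: cvg_cst.
    by apply/funext => n; rewrite mulr0.
  have xa := Ea xE; have ta := Ea tE; have tha := Ea thE.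
  have bD (y : R) : E y -> `|x - y| <= D.
    by move=> /Ea ya; have := ler_normB x y; move: (`|x|) (`|y|) (`|x - y|) xa ya => A B C *; lra.
  have -> : f x = K * (ln `|x - t| - ln `|x - t - h|) * w x.
    rewrite /f !kapE//; [|exact: bD|exact: bD].
    by rewrite (_ : x - t - h = x - (t + h)); [move: (ln `|x - t|) (ln `|x - (t + h)|) (ln D) => A B C; ring|ring].
  have c1 := @cvg_Lq (x - t); rewrite subr_eq0 in c1; have {}c1 := c1 xt.
  have c2 := @cvg_Lq (x - t - h).
  rewrite (_ : x - t - h = x - (t + h)) in c2 *; last by ring.
  rewrite subr_eq0 in c2; have {}c2 := c2 xh.
  apply: cvgM; last exact: cvg_cst.
  rewrite /Lbox -/K; apply: cvgM; first exact: cvg_cst.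
  rewrite (_ : x - t - h = x - (t + h)); last by ring.
  by apply: cvgB; [exact: c1|exact: c2].
split; last by rewrite -If; exact: (DCT mF (itg_meas fi) gi cvf dom).2.
move=> n; rewrite -Ig; have Fi := ae_itg_le (mF n) gi (dom n).
by apply: (le_trans (Int_abs Fi)); exact: (ae_Int_le (itg_abs Fi) gi (dom n)).
Qed.

Lemma Qo_box_cvg0 h M chi : 0 < h -> bsupp a M chi -> (forall t, chi t != 0 -> good h t) ->
  Int (fun x => Qo (eps n) (cv (box h) chi) x * w x) @[n --> \oo] --> 0.
Proof.
move=> h0 cb cg; have ci := bsupp_itg cb; have mc := itg_meas ci.
set K := (pi * h)^-1 * ((ln D * Int w + c) + (ln D * Int w + c)).
have En n : Int (fun x => Qo (eps n) (cv (box h) chi) x * w x) = Int (fun t => chi t * inner h t n).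
  have e0 := @eps_gt0 R n.
  rewrite -(cv_adj (mLbox h0 e0) (fun u => Lbox_bnd u h0 e0) ci wi).
  by apply: eq_Int => x; rewrite (Qo_box x h0 e0 cb).
rewrite (_ : (fun n => _) = fun n => Int (fun t => chi t * inner h t n)); last first.
  by apply/funext => n; exact: En.
have mI n : measurable_fun [set: R] (fun t => inner h t n).
  have e0 := @eps_gt0 R n; have mL := mLbox h0 e0.
  have mL' : measurable_fun [set: R] (fun u => Lbox h (eps n) (- u)) by mfun.
  have := cv_meas mL' (fun u => Lbox_bnd (- u) h0 e0) wi.
  congr measurable_fun; apply/funext => t; apply: eq_Int => x; rewrite opprB//.
rewrite -(Int0 (R := R)); apply: (DCT _ _ (itgZ K (itg_abs ci)) _ _).2.
- by move=> n; have mIn := mI n; mfun.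
- exact: measurable_cst.
- apply: aeT => t; have [->|tn] := eqVneq (chi t) 0.
    rewrite (_ : (fun n => _) = fun=> 0); first exact: cvg_cst.
    by apply/funext => n; rewrite mul0r.
  rewrite -(mulr0 (chi t)); apply: cvgM; first exact: cvg_cst.
  exact: (inner_cvg h0 (cg t tn)).2.
- move=> n; apply: aeT => t; have [->|tn] := eqVneq (chi t) 0; first by rewrite mul0r normr0 mulr0.
  by rewrite normrM mulrC ler_wpM2r//; exact: (inner_cvg h0 (cg t tn)).1.
Qed.

(** Cutting with this indicator makes the potential equal to [c] at every point that is kept, as
    [good] demands, and changes nothing almost everywhere on [E]. *)
Let e2 (x : R) : R := \1_(E `&` [set x | Upot D w x = c]) x.

Let me2 : measurable_fun [set: R] e2.
Proof.
apply: measurable_indic; apply: measurableI => //.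
have mU := Upot_meas mw w0 wi wq k0 kq D1 aw.
by rewrite -[X in measurable X]setTI; exact: (mU measurableT [set c] (measurable_set1 c)).
Qed.

Let e2_bnd x : `|e2 x| <= 1.
Proof. by rewrite /e2 indicE; case: (_ \in _); rewrite ?normr1 ?normr0. Qed.

Let e2b : bsupp a 1 e2.
Proof.
split => // x xa; rewrite /e2 indicE memNset// => -[/Ea]; rewrite leNgt xa//.
Qed.

(** The second factor discards the points whose shift by [h] leaves the good set; [box_cvg] shows
    that this does no harm as [h] tends to 0. *)
Let chi phi h t := phi t * e2 (t + h).

Lemma box_arith (p p' u v M b A B : R) : `|u| <= 1 -> `|p'| <= M -> p' * v = p' -> 0 <= b ->
  b <= 2 * A -> b <= 2 * B ->
  `|b * (p * u - p')| <= 2 * (A * `|p - p'|) + 2 * M * (B * `|u - v|).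
Proof.
move=> u1 pM pv b0 bA bB; rewrite -{1}pv (_ : p * u - p' * v = (p - p') * u + p' * (u - v)); last by ring.
rewrite normrM (ger0_norm b0).
have M0 : 0 <= M by exact: le_trans pM.
have h : `|(p - p') * u + p' * (u - v)| <= `|p - p'| + M * `|u - v|.
  apply: (le_trans (ler_normD _ _)); rewrite !normrM; apply: lerD; first by rewrite ler_piMr.
  by rewrite ler_wpM2r.
apply: (le_trans (ler_wpM2l b0 h)); rewrite mulrDr; apply: lerD.
  by rewrite mulrA ler_wpM2r.
rewrite (_ : 2 * M * (B * `|u - v|) = 2 * B * (M * `|u - v|)); last by ring.
by rewrite ler_wpM2r// mulr_ge0.
Qed.

(** At a common Lebesgue point of [phi] and [e2] both factors of [chi] average to their values, and
    [phi s * e2 s = phi s] for almost every [s]. *)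
Lemma box_cvg phi M : bsupp a M phi -> (forall x, ~ E x -> phi x = 0) ->
  {ae mu, forall s, (fun m => cv (box (eps m)) (chi phi (eps m)) s) @ \oo --> phi s}.
Proof.
move=> pb pE; have [mp pM pa] := pb.
have M0 : 0 <= M by exact: le_trans (pM 0).
have p2 := bsupp_itg (bsuppX 1 pb); have e22 := bsupp_itg (bsuppX 1 e2b).
have L := aeS2 (fun s (u : Leb_pt phi s) (v : Leb_pt e2 s) => conj u v) (ae_Leb_pt mp p2) (ae_Leb_pt me2 e22).
apply: aeS2 L Uc => s [L1 L2] Us.
have pe : phi s * e2 s = phi s.
  have [sE|sE] := pselect (E s); last by rewrite pE// mul0r.
  by rewrite /e2 indicE mem_set ?mulr1//; split => //; exact: Us.
apply/cvgrPdist_le => eta eta0.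
have pp := pi_gt0 R.
pose K := 2 * pi * (1 + M).
have K0 : 0 < K by rewrite !mulr_gt0// ltr_pwDl.
have c1 : 0 <= 2 * pi :> R by rewrite mulr_ge0// ltW.
have c2 : 0 <= 2 * pi * M by rewrite mulr_ge0.
have E3 : 2 * pi * (eta / K) + 2 * pi * M * (eta / K) = eta.
  rewrite -mulrDl (_ : 2 * pi + 2 * pi * M = K); last by rewrite /K; ring.
  by rewrite mulrC divfK// gt_eqF.
have [d1 d10 H1] := L1 _ (divr_gt0 eta0 K0); have [d2 d20 H2] := L2 _ (divr_gt0 eta0 K0).
have [N1 HN1] := eps_lt d10; have [N2 HN2] := eps_lt d20.
exists (maxn N1 N2) => // m /= mN; have e1 := HN1 m (leq_trans (leq_maxl _ _) mN).
have e22' := HN2 m (leq_trans (leq_maxr _ _) mN).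
have {}H1 := H1 _ (eps_gt0 m) e1; have {}H2 := H2 _ (eps_gt0 m) e22'.
have h0 := @eps_gt0 R m; set h := eps m in h0 H1 H2 *.
have [bi b1] := Int_box s h0.
have mb := mbox h.
have cb : bsupp a (M * 1) (chi phi h) by apply: (bsuppM pb) => //; mfun.
have ci := bsupp_itg cb.
have ibc := cv_itg mb (fun u => box_le u h0) s ci.
have Ed : phi s - cv (box h) (chi phi h) s = - Int (fun t => box h (s - t) * (chi phi h t - phi s)).
  have E1 t : box h (s - t) * chi phi h t - phi s * box h (s - t) = box h (s - t) * (chi phi h t - phi s).
    by ring.
  by rewrite -(eq_Int E1) (IntB ibc (itgZ _ bi)) (IntZ _ bi) b1 mulr1 opprB.
have ib : itg (fun t => box h (s - t) * (chi phi h t - phi s)).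
  have E1 t : box h (s - t) * chi phi h t - phi s * box h (s - t) = box h (s - t) * (chi phi h t - phi s).
    by ring.
  exact: (eq_itg E1 (itgB ibc (itgZ _ bi))).
pose g1 t := Pois h (s - t) * `|phi t - phi s|; pose g2 t := Pois h (s - t) * `|e2 t - e2 s|.
have gi (u : R -> R) B : measurable_fun [set: R] u -> (forall t, `|u t| <= B) ->
    itg (fun t => Pois h (s - t) * `|u t - u s|).
  move=> mu_ uB; have j := itgP2 s h0.
  have mm : measurable_fun [set: R] (fun t => `|u t - u s|) by mfun.
  have bb t : `| `|u t - u s| | <= B + B.
    by rewrite normr_id (le_trans (ler_normB _ _))// lerD.
  have E1 t : `|u t - u s| * Pois h (s - t) = Pois h (s - t) * `|u t - u s| by rewrite mulrC.
  exact: (eq_itg E1 (itgM_bdd mm bb j)).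
have i1 : itg g1 by exact: gi pM.
have i2 : itg g2 by exact: gi e2_bnd.
have [i2s E2s] := Int_shift h i2.
have iR := itgD (itgZ (2 * pi) i1) (itgZ (2 * pi * M) i2s).
rewrite Ed normrN; apply: (le_trans (Int_absle ib iR _)).
  move=> t; have [bP bP2] := boxP (s - t) h0.
  have := @box_arith (phi t) (phi s) (e2 (t + h)) (e2 s) M (box h (s - t))
    (pi * Pois h (s - t)) (pi * Pois h (s - t - h)) (e2_bnd _) (pM s) pe (box_ge0 _ h0) bP bP2.
  rewrite /chi /g1 /g2 (_ : s - (t + h) = s - t - h); last by ring.
  move/le_trans; apply; rewrite le_eqVlt; apply/orP; left; apply/eqP.
  by move: (Pois _ _) (Pois _ _) `|_| `|_| (@pi R) => *; ring.
rewrite (IntD (itgZ (2 * pi) i1) (itgZ (2 * pi * M) i2s)) (IntZ _ i1) (IntZ _ i2s) E2s.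
have l1 : 2 * pi * Int g1 <= 2 * pi * (eta / K) := ler_wpM2l c1 H1.
have l2 : 2 * pi * M * Int g2 <= 2 * pi * M * (eta / K) := ler_wpM2l c2 H2.
by rewrite -[leRHS]E3; exact: (lerD l1 l2).
Qed.

(** Replacing [phi] by an average [B N] costs an error small in [L^(2^k)], which by [Qo_pow] and
    [weight_small] stays small uniformly in [e]. Only afterwards does [n] tend to infinity, with [N]
    fixed. *)
Let Qo_weight_cvg0_good phi M : bsupp a M phi ->
  (forall x, phi x != 0 -> E x /\ Upot D w x = c) ->
  Int (fun x => Qo (eps n) phi x * w x) @[n --> \oo] --> 0.
Proof.
move=> pb pg; have pE x : ~ E x -> phi x = 0.
  by move=> xE; apply/eqP; apply: contrapT => /negP/pg[].
 have [mp pM pa] := pb; have pi_ := bsupp_itg pb.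
have M0 : 0 <= M by exact: le_trans (pM 0).
(* Averaging over a length [eps m <= 1] enlarges the support, whence [a + 1]. *)
have a1 : 0 <= a + 1 by rewrite addr_ge0.
have [C C0 HC] := @Qo_pow R k k0.
apply/cvgrPdist_le => eta eta0; have eta2 : 0 < eta / 2 by rewrite divr_gt0.
have [del del0 Hdel] := weight_small mw w0 wi wq k0 kq eta2.
pose X m := chi phi (eps m); pose B m := cv (box (eps m)) (X m).
have Xb m : bsupp a M (X m).
  by rewrite -[M]mulr1; apply: (bsuppM pb) => //; mfun.
have Bm m : measurable_fun [set: R] (B m).
  exact: (cv_meas (mbox _) (fun u => box_le u (@eps_gt0 R m)) (bsupp_itg (Xb m))).
have Bb m : bsupp (a + 1) M (B m).
  have h0 := @eps_gt0 R m; have [mX XM Xa] := Xb m; split => // x.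
    have [bi b1] := Int_box x h0.
    have ibc := cv_itg (mbox (eps m)) (fun u => box_le u h0) x (bsupp_itg (Xb m)).
    rewrite -[leRHS]mulr1 -b1 -(IntZ _ bi); apply: (Int_absle ibc (itgZ _ bi)) => t.
    rewrite normrM (ger0_norm (box_ge0 _ h0)) mulrC; apply: ler_wpM2r; first exact: box_ge0.
    exact: XM.
  move=> xa; rewrite /B /cv -(Int0 (R := R)); apply: eq_Int => t.
  have [ta|ta] := leP `|t| a; last by rewrite Xa// mulr0.
  rewrite /box (_ : (0 <= x - t <= eps m) = false) ?mulr0 ?mul0r//.
  apply/negP => /andP[h1 h2]; have := ler_normD (x - t) t; rewrite subrK (ger0_norm h1).
  have := @eps_le1 m; move: (`|x|) (`|t|) (x - t) xa ta h2 => A1 A2 A3; move: (eps m : R) => ee; lra.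
pose g m x := phi x - B m x.
have gb m : bsupp (a + 1) (M + M) (g m).
  have [m1 m2 m3] := Bb m; split.
  - by rewrite /g; mfun.
  - by move=> x; rewrite /g (le_trans (ler_normB _ _))// lerD.
  - by move=> x xa; rewrite /g m3// pa ?subr0// (lt_trans _ xa)// ltrDl.
have gp : Int (fun x => g m x ^+ (2 ^ k)) @[m --> \oo] --> 0.
  rewrite -(Int0 (R := R)).
  apply: (DCT _ _ (itgZ ((M + M) ^+ (2 ^ k)) (itg_near_ball 0 (a + 1 + 1))) _ _).2.
  - by move=> m; have [mg _ _] := gb m; mfun.
  - exact: measurable_cst.
  - apply: aeS (box_cvg pb pE) => s Hs; rewrite pow2S.
    have h1 : (fun m => g m s) @ \oo --> 0.
      by rewrite -(subrr (phi s)); apply: cvgB; [exact: cvg_cst|exact: Hs].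
    have h2 := continuous_cvg (eventually_filter) (@exprn_continuous _ (2 ^ k).-1.+1 0) h1.
    rewrite expr0n in h2; exact: h2.
  - move=> m; apply: aeT => x; have [_ gM ga] := gb m; rewrite near_ballE sub0r normrN.
    case: ltP => h; last by rewrite ga ?(lt_le_trans _ h) ?ltrDl// mulr0 pow2S expr0n normr0.
    by rewrite mulr1 normrX lerXn2r ?nnegrE ?addr_ge0.
have C1 : 0 < C + 1 by rewrite ltr_wpDl.
have /cvgrPdist_le/(_ _ (divr_gt0 del0 C1))[N _ HN] := gp.
have {}HN := HN N (leqnn N); rewrite sub0r normrN in HN.
have gN : Int (fun x => g N x ^+ (2 ^ k)) <= del / (C + 1) := le_trans (ler_norm _) HN.
have small e : 0 < e -> `|Int (fun x => Qo e (g N) x * w x)| <= eta / 2.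
  move=> e0; have ip := itg_Qo_pow e0 a1 (gb N) k0.
  have mQg := Qo_meas e0 (bsupp_itg (gb N)).
  have iw := weight_itg mw w0 wi wq k0 kq mQg ip.
  apply: (le_trans (Int_abs iw)).
  have E1 x : `|Qo e (g N) x * w x| = `|Qo e (g N) x| * w x by rewrite normrM (ger0_norm (w0 x)).
  rewrite (eq_Int E1); apply: (Hdel _ mQg ip).
  apply: (le_trans (HC e (g N) (a + 1) (M + M) e0 a1 (gb N))).
  apply: (le_trans (ler_wpM2l C0 gN)).
  by rewrite mulrCA ler_piMr ?(ltW del0)// ler_pdivrMr// mul1r lerDl.
have hN := @eps_gt0 R N.
have good_chi t : X N t != 0 -> good (eps N) t.
  rewrite /X /chi mulf_eq0 negb_or => /andP[/pg[tE Ut] p2].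
  move: p2; rewrite /e2 indicE.
  have [/set_mem[tE2 Ut2] _|_] := boolP (t + eps N \in _); first by [].
  by rewrite eqxx.
have /cvgrPdist_le/(_ _ eta2)[N2 _ HN2] := Qo_box_cvg0 hN (Xb N) good_chi.
exists N2 => // n /= Nn; have {}HN2 := HN2 n Nn.
have e0 := @eps_gt0 R n; rewrite sub0r normrN.
have {}HN2 : `|Int (fun x => Qo (eps n) (B N) x * w x)| <= eta / 2 by move: HN2; rewrite sub0r normrN.
have gi := bsupp_itg (gb N); have bi := bsupp_itg (Bb N).
have i1 := itg_cvM (mQ e0) (fun u => Conj_le u e0) gi wi.
have i2 := itg_cvM (mQ e0) (fun u => Conj_le u e0) bi wi.
have E1 x : Qo (eps n) phi x * w x = Qo (eps n) (g N) x * w x + Qo (eps n) (B N) x * w x.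
  rewrite -mulrDl -(cvD (mQ e0) (fun u => Conj_le u e0) x gi bi); congr (_ * _).
  by apply: eq_Int => t; rewrite /g subrK.
rewrite (eq_Int E1) (IntD i1 i2); apply: (le_trans (ler_normD _ _)).
have hs := small _ e0; rewrite [leRHS]splitr; apply: lerD; [exact: hs|exact: HN2].
Qed.

Lemma Qo_weight_cvg0 phi M : bsupp a M phi -> (forall x, ~ E x -> phi x = 0) ->
  Int (fun x => Qo (eps n) phi x * w x) @[n --> \oo] --> 0.
Proof.
move=> pb pE; pose psi t := phi t * e2 t.
have psib : bsupp a (M * 1) psi by apply: (bsuppM pb).
have psig x : psi x != 0 -> E x /\ Upot D w x = c.
  rewrite /psi mulf_eq0 negb_or => /andP[_]; rewrite /e2 indicE.
  by have [/set_mem[]|_] := boolP (x \in _); [|rewrite eqxx].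
suff -> : (fun n => Int (fun x => Qo (eps n) phi x * w x)) =
    fun n => Int (fun x => Qo (eps n) psi x * w x) by exact: (Qo_weight_cvg0_good psib psig).
apply/funext => n; apply: eq_Int => x; congr (_ * _).
have e0 := @eps_gt0 R n.
apply: ae_Int.
- exact: (itg_meas (cv_itg (mQ e0) (fun u => Conj_le u e0) x (bsupp_itg pb))).
- exact: (itg_meas (cv_itg (mQ e0) (fun u => Conj_le u e0) x (bsupp_itg psib))).
apply: aeS Uc => t Ut; congr (_ * _); rewrite /psi.
have [tE|tE] := pselect (E t); last by rewrite pE// mul0r.
by rewrite /e2 indicE mem_set ?mulr1//; split => //; exact: Ut.
Qed.

End Annihilation.

(** * The weighted isometry *)

Section Remainder.
Context {R : realType}.
Notation mu := (@lebesgue_measure R).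
Local Notation Po e := (cv (Pois e)).
Local Notation Qo e := (cv (Conj e)).
Implicit Types (f g phi v : R -> R) (d e t s x y h B M N : R).

Lemma rem_limit_arith (p c T S V W M : R) : 0 <= M -> 0 <= V -> 0 <= W -> `|p| <= M -> `|c| <= M ->
  `|p - c| <= V -> `|T - c ^+ 2| <= M * W + M * V -> `|S - c ^+ 2 / 3| <= M * W + M * V ->
  `|2^-1 * p ^+ 2 + T - 3 / 2 * S - c ^+ 2| <= 4 * M * (V + W).
Proof.
move=> M0 V0 W0 pM cM pc h1 h2.
have h3 : `|p ^+ 2 - c ^+ 2| <= 2 * (M * V).
  rewrite subr_sqr normrM mulrC mulrA; apply: ler_pM => //.
  by rewrite (le_trans (ler_normD _ _))//; lra.
have MV := mulr_ge0 M0 V0; have MW := mulr_ge0 M0 W0.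
have -> : 4 * M * (V + W) = 4 * (M * V) + 4 * (M * W) by ring.
move: (p ^+ 2) (c ^+ 2) (M * V) (M * W) h1 h2 h3 MV MW => A B C D.
by rewrite !ler_norml => /andP[? ?] /andP[? ?] /andP[? ?] ? ?; apply/andP; split; lra.
Qed.

Variables (a M x : R) (f : R -> R).
Hypotheses (M0 : 0 <= M) (fb : bsupp a M f).

Let c := f x.
Let u s := `|f s - c|.
(** [u] equals [|c|] off the support of [f] and need not be integrable; [u'] is, so the laws for
    [Po] apply to it and the constant is added back. *)
Let u' s := u s - `|c|.

Let fM s : `|f s| <= M. Proof. by have [_ + _] := fb; apply. Qed.
Let mf : measurable_fun [set: R] f. Proof. by have [] := fb. Qed.
Let fi : itg f. Proof. exact: bsupp_itg fb. Qed.
Let mu_ : measurable_fun [set: R] u. Proof. by rewrite /u; mfun. Qed.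

Let uM s : `|u s| <= M + M.
Proof. by rewrite /u normr_id; apply: (le_trans (ler_normB _ _)); apply: lerD; exact: fM. Qed.

Let u'b : bsupp a ((M + M) + M) u'.
Proof.
split; first by rewrite /u'; mfun.
  move=> s; apply: (le_trans (ler_normB _ _)); apply: lerD; first exact: uM.
  by rewrite normr_id; exact: fM.
by have [_ _ fa] := fb; move=> s /fa sa; rewrite /u' /u sa sub0r normrN subrr.
Qed.

Let Pu d s : 0 < d -> itg (fun t => Pois d (s - t) * u t).
Proof.
move=> d0; have E t : u t * Pois d (s - t) = Pois d (s - t) * u t by rewrite mulrC.
exact: (eq_itg E (itgM_bdd mu_ uM (itgP2 s d0))).
Qed.

Let PuE d s : 0 < d -> Po d u s = Po d u' s + `|c|.
Proof.
move=> d0; have i1 := cv_itg (mP d0) (fun z => Pois_nle z d0) s (bsupp_itg u'b).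
have i2 := itgP2 s d0.
have -> : `|c| = Int (fun t => `|c| * Pois d (s - t)) by rewrite (IntZ _ i2) IntP2// mulr1.
rewrite -(IntD i1 (itgZ _ i2)); apply: eq_Int => t.
by rewrite /u'; ring.
Qed.

Section fixed.
Variable e : R.
Hypothesis e0 : 0 < e.
Let ee0 : 0 < e + e. Proof. exact: addr_gt0. Qed.
Let V := Po e u x.
Let W := Po (e + e) u x.

Let Pof_c t : `|Po e f t - c| <= Po e u t.
Proof.
have i1 := cv_itg (mP e0) (fun z => Pois_nle z e0) t fi; have i2 := itgP2 t e0.
have -> : Po e f t - c = Int (fun s => Pois e (t - s) * f s - c * Pois e (t - s)).
  by rewrite (IntB i1 (itgZ _ i2)) (IntZ _ i2) IntP2// mulr1.
apply: (Int_absle (itgB i1 (itgZ _ i2)) (Pu t e0)) => s.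
by rewrite [c * _]mulrC -mulrBr normrM ger0_norm// Pois_ge0.
Qed.

Let PPu : itg (fun t => Pois e (x - t) * Po e u t) /\ Int (fun t => Pois e (x - t) * Po e u t) = W.
Proof.
have ui := bsupp_itg u'b; have [Pui _] := Po_itg e0 ui.
have i1 := cv_itg (mP e0) (fun z => Pois_nle z e0) x Pui; have i2 := itgP2 x e0.
have E t : Pois e (x - t) * Po e u' t + `|c| * Pois e (x - t) = Pois e (x - t) * Po e u t.
  by rewrite (PuE t e0); ring.
split; first exact: (eq_itg E (itgD i1 (itgZ _ i2))).
rewrite -(eq_Int E) (IntD i1 (itgZ _ i2)) (IntZ _ i2) IntP2// mulr1 /W (PuE x ee0).
by congr (_ + _); exact: (PoPo e0 e0).
Qed.

Let V0 : 0 <= V. Proof. by apply: Int_ge0 => t; apply: mulr_ge0; [exact: Pois_ge0|exact: normr_ge0]. Qed.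
Let W0 : 0 <= W. Proof. by apply: Int_ge0 => t; apply: mulr_ge0; [exact: Pois_ge0|exact: normr_ge0]. Qed.

(** One estimate for the quadratic and the cubic term: [H] is what [J] becomes when [f] is replaced
    by the constant 1, and [K] is the resulting mass. *)
Let main_term (J : R -> R) (H : R -> R) K : itg (fun t => Pois e (x - t) * (f t * J t)) ->
  measurable_fun [set: R] J -> measurable_fun [set: R] H ->
  (forall t, `|H t| <= 1) -> {ae mu, forall t, `|J t - c * H t| <= Po e u t} ->
  Int (fun t => Pois e (x - t) * H t) = K ->
  `|Int (fun t => Pois e (x - t) * (f t * J t)) - c ^+ 2 * K| <= M * W + M * V.
Proof.
move=> iJ mJ mH H1 JH <-; have [iP IP] := PPu.
have i2 := itgP2 x e0.
have iH : itg (fun t => Pois e (x - t) * H t).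
  have E t : H t * Pois e (x - t) = Pois e (x - t) * H t by rewrite mulrC.
  exact: (eq_itg E (itgM_bdd mH H1 i2)).
have j1 := itgZ M iP; have j2 := itgZ M (Pu x e0).
rewrite -IP -(IntZ _ iP) -(IntZ _ iH) -(IntB iJ (itgZ _ iH)) -(IntZ _ (Pu x e0)) -(IntD j1 j2).
have iL := itgB iJ (itgZ (c ^+ 2) iH).
apply: (le_trans (Int_abs iL)); apply: (ae_Int_le (itg_abs iL) (itgD j1 j2)).
apply: aeS JH => t h; have P0 := Pois_ge0 (x - t) e0.
rewrite (_ : _ - _ = Pois e (x - t) * (f t * (J t - c * H t) + c * (H t * (f t - c)))); last by ring.
rewrite normrM (ger0_norm P0) !(mulrCA M) -mulrDr; apply: ler_wpM2l => //.
apply: (le_trans (ler_normD _ _)); rewrite !normrM; apply: lerD.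
  by apply: ler_pM => //; exact: fM.
apply: ler_pM; [exact: normr_ge0|exact: mulr_ge0|exact: fM|].
by rewrite ler_piMl.
Qed.

Lemma rem_limit : `|2^-1 * Po e f x ^+ 2 + Po e (fun t => f t * Po e f t) x - 3 / 2 * Scub e x f - c ^+ 2|
  <= 4 * M * (V + W).
Proof.
have i2 := itgP2 x e0; have mPf := Po_meas e0 fi.
apply: (rem_limit_arith M0 V0 W0 (Po_bnd x e0 mf fM) (fM x) (Pof_c x)).
- rewrite -[c ^+ 2]mulr1; apply: (@main_term (Po e f) (fun=> 1) 1) => //.
  + apply: (cv_itg (mP e0) (fun z => Pois_nle z e0) x).
    exact: (itgM_bdd mf fM (Po_itg e0 fi).1).
  + by move=> t; rewrite normr1.
  + by apply: aeT => t; rewrite mulr1; exact: Pof_c.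
  + by rewrite -[RHS](IntP2 x e0); apply: eq_Int => t; rewrite mulr1.
- pose g s := Pois e (x - s) * f s.
  have gi : itg g by exact: (cv_itg (mP e0) (fun z => Pois_nle z e0) x fi).
  pose J t := pi * e * Po e g t; pose H t := pi * e * Pois (e + e) (t - x).
  have pe0 : 0 <= pi * e by rewrite mulr_ge0 ?pi_ge0// ltW.
  have mJ : measurable_fun [set: R] J by have m := Po_meas e0 gi; rewrite /J; mfun.
  have mH : measurable_fun [set: R] H by rewrite /H; have m := mP ee0; mfun.
  apply: (@main_term J H 3^-1) => //.
  + apply: (cv_itg (mP e0) (fun z => Pois_nle z e0) x).
    exact: (itgM_bdd mf fM (itgZ _ (Po_itg e0 gi).1)).
  + move=> t; have h0 : 0 <= pi * e * Pois (e + e) (t - x) by rewrite mulr_ge0// Pois_ge0.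
    have := piePois_le ee0 (t - x); rewrite /H (ger0_norm h0) mulrDr mulrDl.
    by move: (pi * e * _) h0 => z; lra.
  + apply: aeS (ae_neq x) => t tx.
    have iQ := itgPP t x e0 e0.
    have E1 s : Pois e (s - t) * Pois e (s - x) = Pois e (t - s) * Pois e (x - s) by rewrite !(P_sym e s).
    have EH : H t = pi * e * Int (fun s => Pois e (t - s) * Pois e (x - s)).
      rewrite -(eq_Int E1) (@IntPP _ t x e e e0 e0); [by []|by left].
    have iQ' : itg (fun s => Pois e (t - s) * Pois e (x - s)) := eq_itg E1 iQ.
    have ig := cv_itg (mP e0) (fun z => Pois_nle z e0) t gi.
    have -> : J t - c * H t = Int (fun s => pi * e * (Pois e (t - s) * g s) - c * (pi * e * (Pois e (t - s) * Pois e (x - s)))).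
      by rewrite (IntB (itgZ _ ig) (itgZ _ (itgZ _ iQ'))) (IntZ _ ig) (IntZ _ (itgZ _ iQ')) (IntZ _ iQ') EH.
    apply: (Int_absle (itgB (itgZ _ ig) (itgZ _ (itgZ _ iQ'))) (Pu t e0)) => s.
    rewrite (_ : _ - _ = (pi * e * Pois e (x - s)) * (Pois e (t - s) * (f s - c))); last by rewrite /g; ring.
    rewrite !normrM -!mulrA ger0_norm ?pi_ge0//.
    have := piePois_le e0 (x - s) => h1.
    rewrite (ger0_norm (ltW e0)) !(ger0_norm (Pois_ge0 _ e0)) !mulrA -mulrA -[leRHS]mul1r.
    apply: ler_wpM2r => //; by rewrite mulr_ge0// Pois_ge0.
  (* The centres coincide here, so [IntPP] is used with different parameters; the mass is [pi * e]
     times [Pois (3 * e)] at 0, that is 1/3. *)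
  + have ne : e != e + e by rewrite -{1}[e]addr0 (inj_eq (addrI e)) eq_sym gt_eqF.
    have E1 t : Pois e (t - x) * Pois (e + e) (t - x) * (pi * e) = Pois e (x - t) * H t.
      by rewrite /H (P_sym e x); ring.
    have i := @itgPP _ x x e (e + e) e0 ee0.
    rewrite -(eq_Int E1); have E2 t : pi * e * (Pois e (t - x) * Pois (e + e) (t - x)) =
      Pois e (t - x) * Pois (e + e) (t - x) * (pi * e) by ring.
    rewrite -(eq_Int E2) (IntZ _ i) (IntPP e0 ee0); last by right.
    rewrite subrr PoisE /pk expr0n/= add0r; have := pi_gt0 R; move: (@pi R) e0 => p e0' p0.
    by field; rewrite !gt_eqF// ?addr_gt0.
Qed.
End fixed.

Lemma Tricomi_limit : Leb_pt f x ->
  (fun n => Qo (eps n) f x ^+ 2 - 2 * Qo (eps n) (fun t => f t * Qo (eps n) f t) x) @ \oo --> f x ^+ 2.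
Proof.
move=> L; apply/cvgrPdist_le => eta eta0.
have K0 : 0 < 8 * M + 1 by rewrite ltr_wpDl// mulr_ge0.
have [d d0 Hd] := L _ (divr_gt0 eta0 K0).
have d20 : 0 < d / 2 by rewrite divr_gt0.
have [N HN] := eps_lt d20; exists N => // n /= Nn.
have e0 := @eps_gt0 R n; have en := HN n Nn.
rewrite (Tricomi_eps x e0 fi) distrC; apply: (le_trans (rem_limit e0)).
have h1 : Po (eps n) u x <= eta / (8 * M + 1).
  by apply: Hd => //; move: en (ltW d0); move: (eps n : R) => ee; lra.
have h2 : Po (eps n + eps n) u x <= eta / (8 * M + 1).
  by apply: Hd; [exact: addr_gt0|move: en; move: (eps n : R) => ee; lra].
have M4 : 0 <= 4 * M by rewrite mulr_ge0.
apply: (le_trans (ler_wpM2l M4 (lerD h1 h2))).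
rewrite (_ : 4 * M * (_ + _) = 8 * M * (eta / (8 * M + 1))); last by ring.
rewrite mulrCA ler_piMr ?(ltW eta0)// ler_pdivrMr// mul1r lerDl//.
Qed.
End Remainder.

(** * Limits in the weighted space [L^2(w)] *)

Section WeightedL2.
Context {R : realType}.
Notation mu := (@lebesgue_measure R).
Implicit Types (f g h v : R -> R) (d e t s x y A B M eta : R).
Variable w : R -> R.
Hypotheses (mw : measurable_fun [set: R] w) (w0 : forall x, 0 <= w x).

Lemma sqr_split x y : x ^+ 2 <= 2 * (x - y) ^+ 2 + 2 * y ^+ 2.
Proof. by have := sqr_ge0 (x - 2 * y); rewrite !expr2; nra. Qed.

Lemma L2w_itg g h : measurable_fun [set: R] g -> measurable_fun [set: R] h ->
  itg (fun x => (g x - h x) ^+ 2 * w x) -> itg (fun x => h x ^+ 2 * w x) ->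
  itg (fun x => g x ^+ 2 * w x).
Proof.
move=> mg mh i1 i2; apply: (itg_le _ (itgD (itgZ 2 i1) (itgZ 2 i2))); first by mfun.
move=> x; rewrite (ger0_norm (mulr_ge0 (sqr_ge0 _) (w0 x))).
apply: (@le_trans _ _ ((2 * (g x - h x) ^+ 2 + 2 * h x ^+ 2) * w x)).
  by apply: ler_wpM2r => //; exact: sqr_split.
by rewrite le_eqVlt; apply/orP; left; apply/eqP; ring.
Qed.

(** Fatou's lemma in the second index shows that the almost everywhere limit is also the limit in
    [L^2(w)]. *)
Lemma L2w_Fatou (G : nat -> R -> R) h : (forall n, measurable_fun [set: R] (G n)) ->
  measurable_fun [set: R] h -> (forall n m, itg (fun x => (G n x - G m x) ^+ 2 * w x)) ->
  {ae mu, forall x, G n x @[n --> \oo] --> h x} ->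
  (forall eta, 0 < eta -> exists N, forall n m, (N <= n)%N -> (N <= m)%N ->
    Int (fun x => (G n x - G m x) ^+ 2 * w x) <= eta) ->
  forall eta, 0 < eta -> exists N, forall n, (N <= n)%N ->
    itg (fun x => (G n x - h x) ^+ 2 * w x) /\ Int (fun x => (G n x - h x) ^+ 2 * w x) <= eta.
Proof.
move=> mG mh iG cG CG eta eta0; have [N HN] := CG _ eta0; exists N => n Nn.
apply: (@Fatou_Int R (fun m x => (G n x - G (m + N)%N x) ^+ 2 * w x)).
- by move=> m; exact: iG.
- by move=> m x; rewrite mulr_ge0 ?sqr_ge0.
- by mfun.
- by move=> x; rewrite mulr_ge0 ?sqr_ge0.
- apply: aeS cG => x cx.
  have cx' : (fun m => G (m + N)%N x) @ \oo --> h x by move: cx; rewrite -(cvg_shiftn N).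
  have c1 : (fun m => G n x - G (m + N)%N x) @ \oo --> G n x - h x.
    by apply: cvgB; [exact: cvg_cst|exact: cx'].
  by apply: cvgM; [apply: cvgM; exact: c1|exact: cvg_cst].
- by move=> m; apply: HN => //; exact: leq_addl.
Qed.

Lemma L2w_arith (z y lam : R) : 0 < lam -> `|z ^+ 2 - y ^+ 2| <= (1 + lam^-1) * (z - y) ^+ 2 + lam * y ^+ 2.
Proof.
move=> l0; have -> : z ^+ 2 - y ^+ 2 = (z - y) ^+ 2 + 2 * ((z - y) * y) by ring.
move: (z - y) => d; have li : 0 < lam^-1 by rewrite invr_gt0.
have E (s : R) : s ^+ 2 = 1 -> 0 <= lam^-1 * d ^+ 2 + 2 * s * (d * y) + lam * y ^+ 2.
  move=> s1; rewrite (_ : _ + _ = lam^-1 * (d + s * (lam * y)) ^+ 2).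
    by rewrite mulr_ge0 ?sqr_ge0// ltW.
  transitivity (lam^-1 * d ^+ 2 + 2 * s * (d * y) + lam * y ^+ 2 * s ^+ 2); first by rewrite s1; ring.
  by field; rewrite gt_eqF.
have s1 : (-1 : R) ^+ 2 = 1 by rewrite sqrrN expr1n.
have := E 1 (expr1n _ _); have := E (-1) s1.
have := sqr_ge0 d; rewrite [(1 + lam^-1) * _]mulrDl mul1r.
move: (d ^+ 2) (lam^-1 * _) (d * y) (lam * _) => A B C D' *.
by rewrite ler_norml; apply/andP; split; lra.
Qed.

(** The weight [v] may change sign, so that [w x * x] is covered. *)
Lemma L2w_cvg (G : nat -> R -> R) h A v : 0 <= A -> (forall n, measurable_fun [set: R] (G n)) ->
  measurable_fun [set: R] h -> measurable_fun [set: R] v -> (forall x, `|v x| <= A * w x) ->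
  itg (fun x => h x ^+ 2 * w x) ->
  (forall eta, 0 < eta -> exists N, forall n, (N <= n)%N ->
    itg (fun x => (G n x - h x) ^+ 2 * w x) /\ Int (fun x => (G n x - h x) ^+ 2 * w x) <= eta) ->
  Int (fun x => G n x ^+ 2 * v x) @[n --> \oo] --> Int (fun x => h x ^+ 2 * v x).
Proof.
move=> A0 mG mh mv vA ih CG; apply/cvgrPdist_le => eta eta0.
pose H := Int (fun x => h x ^+ 2 * w x).
have H0 : 0 <= H by apply: Int_ge0 => x; rewrite mulr_ge0 ?sqr_ge0.
have AH : 0 < A * H + 1 by rewrite ltr_wpDl// mulr_ge0.
pose lam := eta / 2 / (A * H + 1); have l0 : 0 < lam by rewrite !divr_gt0.
pose K := 1 + lam^-1; have K0 : 0 < K by rewrite addr_gt0// invr_gt0.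
have AK : 0 < A * K + 1 by rewrite ltr_wpDl// mulr_ge0// ltW.
have [N HN] := CG _ (divr_gt0 (divr_gt0 eta0 (ltr0n R 2)) AK).
exists N => // n /= Nn; have [i1 I1] := HN n Nn.
have vsq g : measurable_fun [set: R] g -> itg (fun x => g x ^+ 2 * w x) -> itg (fun x => g x ^+ 2 * v x).
  move=> mg ig; apply: (itg_le _ (itgZ A ig)); first by mfun.
  move=> x; rewrite normrM (ger0_norm (sqr_ge0 (g x))) mulrCA; apply: ler_wpM2l => //; exact: sqr_ge0.
have iG := vsq _ (mG n) (L2w_itg (mG n) mh i1 ih); have ihv := vsq _ mh ih.
have mGn := mG n.
have iR := itgD (itgZ (A * K) i1) (itgZ (A * lam) ih).
rewrite distrC -(IntB iG ihv); apply: (le_trans (Int_absle (itgB iG ihv) iR _)).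
  move=> x; rewrite -mulrBl normrM.
  have h1 := L2w_arith (G n x) (h x) l0.
  apply: (@le_trans _ _ ((K * (G n x - h x) ^+ 2 + lam * h x ^+ 2) * (A * w x))).
    by apply: ler_pM.
  by rewrite le_eqVlt; apply/orP; left; apply/eqP; ring.
rewrite (IntD (itgZ (A * K) i1) (itgZ (A * lam) ih)) (IntZ _ i1) (IntZ _ ih) -/H.
have AK0 : 0 <= A * K by rewrite mulr_ge0// ltW.
apply: (le_trans (lerD (ler_wpM2l AK0 I1) (lexx _))).
rewrite [leRHS]splitr; apply: lerD.
  by rewrite mulrCA ler_piMr ?divr_ge0 ?(ltW eta0)// ler_pdivrMr// mul1r lerDl.
rewrite /lam (_ : _ * H = eta / 2 * (A * H / (A * H + 1))); last by ring.
by rewrite ler_piMr ?divr_ge0 ?(ltW eta0)// ler_pdivrMr// mul1r lerDl.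
Qed.
End WeightedL2.

(** * The two identities, for bounded functions and by truncation *)

Section Bounded.
Context {R : realType}.
Notation mu := (@lebesgue_measure R).
Local Notation Po e := (cv (Pois e)).
Local Notation Qo e := (cv (Conj e)).
Implicit Types (f g h v : R -> R) (d e t s x y A B M eta : R).
Variables (E : set R) (w : R -> R) (q a : R) (k : nat).
Hypotheses (mw : measurable_fun [set: R] w) (w0 : forall x, 0 <= w x) (wi : itg w)
  (wq : itg (fun x => w x `^ q)) (k0 : (0 < k)%N)
  (kq : 1 <= (q - 1) * (2 ^ k).-1%:R) (a0 : 0 <= a).
Hypothesis Z : forall phi M, bsupp a M phi -> (forall x, ~ E x -> phi x = 0) ->
  Int (fun x => Qo (eps n) phi x * w x) @[n --> \oo] --> 0.

Let CB e : 0 < e -> forall z, `|Conj e z| <= kb e.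
Proof. by move=> e0 z; exact: Conj_le. Qed.

(** [Z] concerns a fixed function, so the inner parameter is frozen at [m]. The remaining factor
    [G n - G m] is small in [L^(2^k)], and so is its image under the outer [Qo]. The choices [g = f]
    and [g t = t * f t] serve the two identities. *)
Lemma QgQ_cvg0 f g M B : bsupp a M f -> bsupp a B g -> (forall x, ~ E x -> g x = 0) ->
  Int (fun x => Qo (eps n) (fun t => g t * Qo (eps n) f t) x * w x) @[n --> \oo] --> 0.
Proof.
move=> fb gb gE; have fi := bsupp_itg fb; have [mg gB _] := gb.
have B0 : 0 <= B by exact: le_trans (gB 0).
pose G n := Qo (eps n) f.
have mG n : measurable_fun [set: R] (G n) by exact: Qo_meas (@eps_gt0 R n) fi.
have GB n x : `|G n x| <= kb (eps n) * Int (fun t => `|f t|) by exact: Qo_bnd (@eps_gt0 R n) fi.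
have gGb n := bsuppM gb (mG n) (GB n).
have [C C0 HC] := @Qo_pow R k k0.
apply/cvgrPdist_le => eta eta0; have eta2 : 0 < eta / 2 by rewrite divr_gt0.
have [del del0 Hdel] := weight_small mw w0 wi wq k0 kq eta2.
have C1 : 0 < C + 1 by rewrite ltr_wpDl.
have B1 : 0 < B ^+ (2 ^ k) + 1 by rewrite ltr_wpDl// exprn_ge0.
have [d0 d00 Hd] := Qo_Cauchy_pow a0 fb k0 (divr_gt0 (divr_gt0 del0 C1) B1).
have [m0 Hm0] := eps_lt d00; pose m := m0.
have em := Hm0 m (leqnn _).
have gmE x : ~ E x -> g x * G m x = 0 by move=> /gE ->; rewrite mul0r.
have /cvgrPdist_le/(_ _ eta2)[N1 _ HN1] := Z (gGb m) gmE.
exists (maxn N1 m0) => // n /= nN.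
have {}HN1 := HN1 n (leq_trans (leq_maxl _ _) nN).
have en := Hm0 n (leq_trans (leq_maxr _ _) nN).
have e0 := @eps_gt0 R n.
have bG x : `|G n x - G m x| <= kb (eps n) * Int (fun t => `|f t|) + kb (eps m) * Int (fun t => `|f t|).
  by apply: (le_trans (ler_normB _ _)); exact: (lerD (GB n x) (GB m x)).
have mGG : measurable_fun [set: R] (fun x => G n x - G m x) by have m1 := mG n; have m2 := mG m; mfun.
have pb := bsuppM gb mGG bG; set B' := B * _ in pb.
pose phi t := g t * (G n t - G m t).
have pbi : itg (fun x => phi x ^+ (2 ^ k)) := bsupp_itg (bsupp_pow2 k pb).
have iGG : itg (fun x => (G n x - G m x) ^+ (2 ^ k)).
  have [_ _ fa] := fb.
  apply: (itg_pow mGG bG _ k0); apply: itg_sqrB; [exact: mG|exact: mG| |].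
    exact: (itg_Qo2 a0 fi fa e0).
  exact: (itg_Qo2 a0 fi fa (@eps_gt0 R m)).
have Iphi : Int (fun x => phi x ^+ (2 ^ k)) <= del / (C + 1).
  have l1 : Int (fun x => phi x ^+ (2 ^ k)) <= Int (fun x => B ^+ (2 ^ k) * (G n x - G m x) ^+ (2 ^ k)).
    apply: (Int_le pbi (itgZ _ iGG)) => x; rewrite exprMn ler_wpM2r ?even_pow_ge0//.
    by rewrite (even_norm (g x) k0) lerXn2r ?nnegrE.
  apply: (le_trans l1); rewrite (IntZ _ iGG).
  have l2 := Hd _ _ e0 (@eps_gt0 R m) en em.
  have Bk : 0 <= B ^+ (2 ^ k) by rewrite exprn_ge0.
  apply: (le_trans (ler_wpM2l Bk l2)).
  by rewrite mulrCA ler_piMr ?divr_ge0 ?(ltW del0) ?(ltW C1)// ler_pdivrMr// mul1r lerDl.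
have small : `|Int (fun x => Qo (eps n) phi x * w x)| <= eta / 2.
  have ip := itg_Qo_pow e0 a0 pb k0.
  have mQg := Qo_meas e0 (bsupp_itg pb).
  have iw := weight_itg mw w0 wi wq k0 kq mQg ip.
  apply: (le_trans (Int_abs iw)).
  have E1 x : `|Qo (eps n) phi x * w x| = `|Qo (eps n) phi x| * w x by rewrite normrM (ger0_norm (w0 x)).
  rewrite (eq_Int E1); apply: (Hdel _ mQg ip).
  apply: (le_trans (HC (eps n) phi a B' e0 a0 pb)).
  apply: (le_trans (ler_wpM2l C0 Iphi)).
  by rewrite mulrCA ler_piMr ?(ltW del0)// ler_pdivrMr// mul1r lerDl.
have i1 := itg_cvM (mQ e0) (CB e0) (bsupp_itg pb) wi.
have i2 := itg_cvM (mQ e0) (CB e0) (bsupp_itg (gGb m)) wi.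
have E1 x : Qo (eps n) (fun t => g t * G n t) x * w x =
    Qo (eps n) phi x * w x + Qo (eps n) (fun t => g t * G m t) x * w x.
  rewrite -mulrDl -(cvD (mQ e0) (CB e0) x (bsupp_itg pb) (bsupp_itg (gGb m))); congr (_ * _).
  by apply: eq_Int => t; congr (_ * _); rewrite /phi; ring.
rewrite sub0r normrN (eq_Int E1) (IntD i1 i2); apply: (le_trans (ler_normD _ _)).
have {}HN1 : `|Int (fun x => Qo (eps n) (fun t => g t * G m t) x * w x)| <= eta / 2.
  by move: HN1; rewrite sub0r normrN.
by rewrite [leRHS]splitr; apply: lerD; [exact: small|exact: HN1].
Qed.

(** [Conj e] is odd, so this quadratic form equals its own negative. *)
Lemma Int_fQf e f M : 0 < e -> bsupp a M f -> Int (fun t => f t * Qo e f t) = 0.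
Proof.
move=> e0 fb; have fi := bsupp_itg fb.
have E1 : Int (fun t => f t * Qo e f t) = Int (fun t => f t * Int (fun x => Conj e (x - t) * f x)).
  by rewrite -(cv_adj (mQ e0) (CB e0) fi fi); apply: eq_Int => t; rewrite mulrC.
have E2 t : f t * Int (fun x => Conj e (x - t) * f x) = - 1 * (f t * Qo e f t).
  rewrite mulN1r -mulrN; congr (_ * _).
  rewrite -[RHS]mulN1r -IntZ; last exact: (cv_itg (mQ e0) (CB e0) t fi).
  by apply: eq_Int => x; rewrite Q_anti; ring.
have i : itg (fun t => f t * Qo e f t).
  have E3 t : Qo e f t * f t = f t * Qo e f t by rewrite mulrC.
  exact: (eq_itg E3 (itg_cvM (mQ e0) (CB e0) fi fi)).
move: E1; rewrite (eq_Int E2) (IntZ _ i); lra.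
Qed.

(** From [y = t + (y - t)] and [u * Conj e u = 1 / pi - e * Pois e u]. *)
Lemma mul_Qo e phi y : 0 < e -> itg phi -> itg (fun t => t * phi t) ->
  y * Qo e phi y = Qo e (fun t => t * phi t) y + pi^-1 * Int phi - e * Po e phi y.
Proof.
move=> e0 pi1 pi2.
have i1 := cv_itg (mQ e0) (CB e0) y pi1; have i2 := cv_itg (mQ e0) (CB e0) y pi2.
have i3 := cv_itg (mP e0) (fun z => Pois_nle z e0) y pi1.
rewrite -(IntZ y i1) -(IntZ pi^-1 pi1) -(IntZ e i3) -(IntD i2 (itgZ _ pi1)) -(IntB (itgD i2 (itgZ _ pi1)) (itgZ _ i3)).
apply: eq_Int => t; rewrite ConjE PoisE /qk /pk; have := den_gt0 (y - t) e0.
by move: (pi^-1 : R) => p d0; field; rewrite gt_eqF.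
Qed.
End Bounded.

Section Identity.
Context {R : realType}.
Notation mu := (@lebesgue_measure R).
Local Notation Po e := (cv (Pois e)).
Local Notation Qo e := (cv (Conj e)).
Implicit Types (f g h v : R -> R) (d e t s x y A B M eta : R).
Variables (E : set R) (w : R -> R) (q a : R) (k : nat).
Hypotheses (mw : measurable_fun [set: R] w) (w0 : forall x, 0 <= w x) (wi : itg w)
  (wq : itg (fun x => w x `^ q)) (k0 : (0 < k)%N)
  (kq : 1 <= (q - 1) * (2 ^ k).-1%:R) (a0 : 0 <= a)
  (wa : forall x, a < `|x| -> w x = 0).
Hypothesis Z : forall phi M, bsupp a M phi -> (forall x, ~ E x -> phi x = 0) ->
  Int (fun x => Qo (eps n) phi x * w x) @[n --> \oo] --> 0.

Let CB e : 0 < e -> forall z, `|Conj e z| <= kb e.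
Proof. by move=> e0 z; exact: Conj_le. Qed.

Let PB e : 0 < e -> forall z, `|Pois e z| <= kb e.
Proof. by move=> e0 z; exact: Pois_nle. Qed.

Let wx_le x : `|w x * x| <= a * w x.
Proof.
rewrite normrM (ger0_norm (w0 x)) mulrC; have [h|h] := leP `|x| a; first exact: ler_wpM2r.
by rewrite wa// !mulr0.
Qed.

Section bounded.
Variables (f : R -> R) (M : R).
Hypotheses (fb : bsupp a M f) (fE : forall x, ~ E x -> f x = 0).

Let mf : measurable_fun [set: R] f. Proof. by have [] := fb. Qed.
Let fM x : `|f x| <= M. Proof. by have [_ + _] := fb; apply. Qed.
Let M0 : 0 <= M. Proof. exact: le_trans (fM 0). Qed.
Let fi : itg f. Proof. exact: bsupp_itg fb. Qed.
Let G n := Qo (eps n) f.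
Let fG n t := f t * G n t.
Let mG n : measurable_fun [set: R] (G n). Proof. exact: Qo_meas (@eps_gt0 R n) fi. Qed.
Let GB n x : `|G n x| <= kb (eps n) * Int (fun t => `|f t|).
Proof. exact: Qo_bnd (@eps_gt0 R n) fi. Qed.
Let fGb n := bsuppM fb (mG n) (GB n).

(** Uniformity in [n] lets the term with the factor [e] in [mul_Qo] vanish in the limit. *)
Let Po_weight_bound : exists K, forall n, Int (fun x => `|Po (eps n) (fG n) x| * w x) <= K.
Proof.
have [C C0 HC] := @Qo_pow R k k0.
exists (M ^+ (2 ^ k) * (C * Int (fun x => f x ^+ (2 ^ k))) + Int (fun x => w x + w x `^ q)) => n.
have e0 := @eps_gt0 R n; have [mp pB _] := bsupp_abs (fGb n).
have pbi := bsupp_itg (bsupp_pow2 k (bsupp_abs (fGb n))).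
have [Pi PI] := Po_itg e0 pbi; have iw := itgD wi wq.
have ai := bsupp_itg (bsupp_abs (fGb n)).
have le x : `|Po (eps n) (fG n) x| * w x <=
    Po (eps n) (fun t => `|fG n t| ^+ (2 ^ k)) x + (w x + w x `^ q).
  have h1 := Po_abs x e0 (bsupp_itg (fGb n)).
  have P0 : 0 <= Po (eps n) (fun t => `|fG n t|) x by apply: Po_ge0.
  apply: (le_trans (ler_wpM2r (w0 x) h1)).
  have h2 := weight_le k0 kq (Po (eps n) (fun t => `|fG n t|) x) ltr01 (w0 x).
  rewrite (ger0_norm P0) expr1n invr1 !mul1r in h2.
  apply: (le_trans h2); rewrite lerD2r.
  apply: (Po_pow x k e0 mp); first by [].
  by move=> t; apply: le_trans (ler_norm _) (pB t).
have mPf := Po_meas e0 (bsupp_itg (fGb n)).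
have iL : itg (fun x => `|Po (eps n) (fG n) x| * w x).
  apply: (itg_le _ (itgD Pi iw)).
    by apply: measurable_funM => //; exact: measurable_fun_norm.
  by move=> x; rewrite ger0_norm ?mulr_ge0//; exact: le.
apply: (le_trans (Int_le iL (itgD Pi iw) le)); rewrite (IntD Pi iw) PI lerD2r.
have [_ _ fa] := fb; have mGn := mG n.
have iG : itg (fun x => G n x ^+ (2 ^ k)) := itg_Qo_pow e0 a0 fb k0.
have Mk : 0 <= M ^+ (2 ^ k) by rewrite exprn_ge0.
apply: (le_trans (Int_le pbi (itgZ (M ^+ (2 ^ k)) iG) _)).
  move=> x; rewrite normrM exprMn -(even_norm (G n x) k0); apply: ler_wpM2r.
    exact: even_pow_ge0.
  by rewrite lerXn2r ?nnegrE.
by rewrite (IntZ _ iG); apply: ler_wpM2l => //; exact: (HC _ _ _ _ e0 a0 fb).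
Qed.

Let QfG_w : Int (fun x => Qo (eps n) (fG n) x * w x) @[n --> \oo] --> 0.
Proof. exact: (QgQ_cvg0 mw w0 wi wq k0 kq a0 Z fb fb fE). Qed.

Let QfG_wx : Int (fun x => Qo (eps n) (fG n) x * (w x * x)) @[n --> \oo] --> 0.
Proof.
pose g t := t * f t.
have gb : bsupp a (a * M) g.
  have [_ _ fa] := fb; split; first by rewrite /g; mfun.
    move=> t; rewrite /g normrM; have [h|h] := leP `|t| a; first exact: ler_pM.
    by rewrite fa// normr0 mulr0 mulr_ge0.
  by move=> t /fa h; rewrite /g h mulr0.
have gE x : ~ E x -> g x = 0 by move=> /fE h; rewrite /g h mulr0.
have c1 := QgQ_cvg0 mw w0 wi wq k0 kq a0 Z fb gb gE.
have [K HK] := Po_weight_bound.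
have En n : Int (fun x => Qo (eps n) (fG n) x * (w x * x)) =
    Int (fun x => Qo (eps n) (fun t => g t * G n t) x * w x) - eps n * Int (fun x => Po (eps n) (fG n) x * w x).
  have e0 := @eps_gt0 R n; have i1 := bsupp_itg (fGb n).
  have E1 t : g t * G n t = t * fG n t by rewrite /g /fG; ring.
  have i2 := bsupp_itg (bsuppM gb (mG n) (GB n)).
  have j1 := itg_cvM (mQ e0) (CB e0) i2 wi; have j2 := itg_cvM (mP e0) (PB e0) i1 wi.
  rewrite -(IntZ _ j2) -(IntB j1 (itgZ _ j2)); apply: eq_Int => x.
  have := mul_Qo x e0 i1 (eq_itg E1 i2); rewrite (Int_fQf e0 fb) mulr0 addr0.
  have -> : Qo (eps n) (fun t => t * fG n t) x = Qo (eps n) (fun t => g t * G n t) x.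
    by apply: eq_Int => t; rewrite E1.
  move=> hh; transitivity ((x * Qo (eps n) (fG n) x) * w x); first by ring.
  by rewrite hh mulrBl mulrA.
rewrite (_ : (fun n => _) = fun n => Int (fun x => Qo (eps n) (fun t => g t * G n t) x * w x)
  - eps n * Int (fun x => Po (eps n) (fG n) x * w x)); last by apply/funext => n; exact: En.
rewrite -(subr0 (0 : R)); apply: cvgB; first exact: c1.
have cK : (fun n => eps n * K) @ \oo --> 0.
  by rewrite -(mul0r K); apply: cvgM; [exact: cvg_eps|exact: cvg_cst].
apply/cvgrPdist_le => eta eta0; have /cvgrPdist_le/(_ _ eta0)[N _ HN] := cK.
exists N => // n Nn; have := HN n Nn; rewrite /= !sub0r !normrN; apply: le_trans.
have e0 := @eps_gt0 R n.
have j2 := itg_cvM (mP e0) (PB e0) (bsupp_itg (fGb n)) wi.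
rewrite normrM (ger0_norm (ltW e0)); apply: (@le_trans _ _ (eps n * K)); last exact: ler_norm.
apply: ler_wpM2l; first exact: ltW.
apply: le_trans (HK n); apply: (le_trans (Int_abs j2)).
rewrite le_eqVlt; apply/orP; left; apply/eqP; apply: eq_Int => x.
by rewrite normrM (ger0_norm (w0 x)).
Qed.

(** Dominated convergence is applied to the combination [T n], which is bounded by [6 * M ^+ 2], and
    not to [G n ^+ 2], for which only bounds depending on [n] are at hand. *)
Let lim_identity v A : 0 <= A -> measurable_fun [set: R] v -> (forall x, `|v x| <= A * w x) ->
  Int (fun x => Qo (eps n) (fG n) x * v x) @[n --> \oo] --> 0 ->
  Int (fun x => G n x ^+ 2 * v x) @[n --> \oo] --> Int (fun x => f x ^+ 2 * v x).
Proof.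
move=> A0 mv vA Qv.
have vi : itg v := itg_le mv (itgZ A wi) vA.
pose T n x := G n x ^+ 2 - 2 * Qo (eps n) (fG n) x.
have mQf n := Qo_meas (@eps_gt0 R n) (bsupp_itg (fGb n)).
have mT n : measurable_fun [set: R] (T n) by have m1 := mG n; have m2 := mQf n; rewrite /T; mfun.
have TB n x : `|T n x| <= 6 * M ^+ 2.
  have e0 := @eps_gt0 R n; have ee := addr_gt0 e0 e0.
  apply: (le_trans (Tricomi_rem_le e0 fb x)).
  have m2 : measurable_fun [set: R] (fun t => f t ^+ 2) by mfun.
  have b2 t : `|f t ^+ 2| <= M ^+ 2 by rewrite normrX lerXn2r ?nnegrE.
  have := Po_bnd x e0 m2 b2; have := Po_bnd x ee m2 b2.
  move: (Po _ _ _) (Po _ _ _) (M ^+ 2) => u1 u2 m; rewrite !ler_norml => /andP[_ h1] /andP[_ h2]; lra.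
have TvB n x : `|T n x * v x| <= 6 * M ^+ 2 * `|v x| by rewrite normrM; apply: ler_wpM2r.
have iT n : itg (fun x => T n x * v x) := itgM_bdd (mT n) (TB n) vi.
have cT : Int (fun x => T n x * v x) @[n --> \oo] --> Int (fun x => f x ^+ 2 * v x).
  apply: (DCT _ _ (itgZ (6 * M ^+ 2) (itg_abs vi)) _ _).2.
  - by move=> n; have m1 := mT n; mfun.
  - by mfun.
  - have f2 := bsupp_itg (bsuppX 1 fb).
    apply: aeS (ae_Leb_pt mf f2) => x L; apply: cvgM; last exact: cvg_cst.
    exact: (Tricomi_limit M0 fb L).
  - by move=> n; apply: aeT; exact: TvB.
have En n : Int (fun x => G n x ^+ 2 * v x) =
    Int (fun x => T n x * v x) + 2 * Int (fun x => Qo (eps n) (fG n) x * v x).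
  have i2 := itg_cvM (mQ (@eps_gt0 R n)) (CB (@eps_gt0 R n)) (bsupp_itg (fGb n)) vi.
  rewrite -(IntZ _ i2) -(IntD (iT n) (itgZ _ i2)); apply: eq_Int => x.
  by rewrite /T; ring.
rewrite (_ : (fun n => _) = fun n => Int (fun x => T n x * v x) +
  2 * Int (fun x => Qo (eps n) (fG n) x * v x)); last by apply/funext => n; exact: En.
rewrite -[X in _ --> X]addr0 -(mulr0 2); apply: cvgD; first exact: cT.
by apply: cvgM; [exact: cvg_cst|exact: Qv].
Qed.

(** [weight_small] is applied to the square of the difference, hence the exponent [2 ^ k.+1]. *)
Let GC eta : 0 < eta -> exists N, forall n m, (N <= n)%N -> (N <= m)%N ->
  Int (fun x => (G n x - G m x) ^+ 2 * w x) <= eta.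
Proof.
move=> eta0; have [del del0 Hdel] := weight_small mw w0 wi wq k0 kq eta0.
have [d0 d00 Hd] := Qo_Cauchy_pow a0 fb (isT : (0 < k.+1)%N) del0.
have [N HN] := eps_lt d00; exists N => n m Nn Nm.
have mGn := mG n; have mGm := mG m; have [_ _ fa] := fb.
have E2 x : (G n x - G m x) ^+ (2 ^ k.+1) = ((G n x - G m x) ^+ 2) ^+ (2 ^ k) by rewrite expnS exprM.
have h := Hd _ _ (@eps_gt0 R n) (@eps_gt0 R m) (HN n Nn) (HN m Nm).
have bG x : `|G n x - G m x| <= kb (eps n) * Int (fun t => `|f t|) + kb (eps m) * Int (fun t => `|f t|).
  by apply: (le_trans (ler_normB _ _)); exact: (lerD (GB n x) (GB m x)).
have i2 : itg (fun x => (G n x - G m x) ^+ 2).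
  exact: (itg_sqrB mGn mGm (itg_Qo2 a0 fi fa (@eps_gt0 R n)) (itg_Qo2 a0 fi fa (@eps_gt0 R m))).
have mD : measurable_fun [set: R] (fun x => G n x - G m x) by mfun.
have ik := itg_pow mD bG i2 (isT : (0 < k.+1)%N).
have mD2 : measurable_fun [set: R] (fun x => (G n x - G m x) ^+ 2) by mfun.
have := Hdel _ mD2 (eq_itg E2 ik); rewrite -(eq_Int E2) => /(_ h).
apply: le_trans; rewrite le_eqVlt; apply/orP; left; apply/eqP; apply: eq_Int => x.
by rewrite (ger0_norm (sqr_ge0 _)).
Qed.

Let iGG n m : itg (fun x => (G n x - G m x) ^+ 2 * w x).
Proof.
have mGn := mG n; have mGm := mG m.
have mD : measurable_fun [set: R] (fun x => (G n x - G m x) ^+ 2) by mfun.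
have bD x : `|(G n x - G m x) ^+ 2| <= (kb (eps n) * Int (fun t => `|f t|) + kb (eps m) * Int (fun t => `|f t|)) ^+ 2.
  rewrite normrX; have h : `|G n x - G m x| <= kb (eps n) * Int (fun t => `|f t|) + kb (eps m) * Int (fun t => `|f t|).
    by apply: (le_trans (ler_normB _ _)); exact: (lerD (GB n x) (GB m x)).
  by rewrite lerXn2r ?nnegrE// (le_trans _ h).
exact: (itgM_bdd mD bD wi).
Qed.

(** The integrals of [G n ^+ 2] have two limits to be equated: one by convergence in [L^2(w)], the
    other by [lim_identity]. *)
Lemma bounded_identity h : measurable_fun [set: R] h ->
  {ae mu, forall x, Qo (eps n) f x @[n --> \oo] --> h x} ->
  [/\ itg (fun x => h x ^+ 2 * w x), Int (fun x => h x ^+ 2 * w x) = Int (fun x => f x ^+ 2 * w x) &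
    Int (fun x => h x ^+ 2 * (w x * x)) = Int (fun x => f x ^+ 2 * (w x * x))].
Proof.
move=> mh Gh; have F := L2w_Fatou mw w0 mG mh iGG Gh GC.
have [N0 HN0] := F 1 ltr01; have [iN _] := HN0 N0 (leqnn _).
have iG : itg (fun x => G N0 x ^+ 2 * w x).
  have mGn := mG N0; have mD : measurable_fun [set: R] (fun x => G N0 x ^+ 2) by mfun.
  have bD x : `|G N0 x ^+ 2| <= (kb (eps N0) * Int (fun t => `|f t|)) ^+ 2.
    by rewrite normrX; have h1 := GB N0 x; rewrite lerXn2r ?nnegrE// (le_trans _ h1).
  exact: (itgM_bdd mD bD wi).
have ih : itg (fun x => h x ^+ 2 * w x).
  have E1 x : (G N0 x - h x) ^+ 2 * w x = (h x - G N0 x) ^+ 2 * w x by rewrite -sqrrN opprB.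
  exact: (L2w_itg mw w0 mh (mG N0) (eq_itg E1 iN) iG).
have w1 x : `|w x| <= 1 * w x by rewrite mul1r ger0_norm.
have mwx : measurable_fun [set: R] (fun x => w x * x) by mfun.
have c1 := L2w_cvg mw w0 ler01 mG mh mw w1 ih F.
have c2 := L2w_cvg mw w0 a0 mG mh mwx wx_le ih F.
have d1 := lim_identity ler01 mw w1 QfG_w.
have d2 := lim_identity a0 mwx wx_le QfG_wx.
split => //.
- by rewrite -(cvg_lim (@Rhausdorff R) c1); exact: (cvg_lim (@Rhausdorff R) d1).
- by rewrite -(cvg_lim (@Rhausdorff R) c2); exact: (cvg_lim (@Rhausdorff R) d2).
Qed.
End bounded.

(** Transforms of truncations of [f] are Cauchy in [L^2(w)] by the isometry for bounded functions;
    convergence in unweighted [L^2] identifies their limit with the transform of [f]. *)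
Lemma hilbert_weighted f : (forall x, E x -> `|x| <= a) -> measurable_fun [set: R] f -> itg f ->
  itg (fun x => f x ^+ 2) -> (forall x, ~ E x -> f x = 0) -> itg (fun x => f x ^+ 2 * w x) ->
  exists2 h : R -> R, measurable_fun [set: R] h &
  [/\ {ae mu, forall x, hilbert f x = h x}, itg (fun x => h x ^+ 2 * w x),
    Int (fun x => h x ^+ 2 * w x) = Int (fun x => f x ^+ 2 * w x) &
    Int (fun x => h x ^+ 2 * (w x * x)) = Int (fun x => f x ^+ 2 * (w x * x))].
Proof.
move=> Ea mf fi f2 fE fw.
have supE g : (forall x, ~ E x -> g x = 0) -> supp a g.
  by move=> gE x xa; apply: gE => /Ea; rewrite leNgt xa.
pose ft m x := if `|f x| <= m%:R then f x else 0.
have ftE m x : ~ E x -> ft m x = 0 by move=> /fE h; rewrite /ft h; case: ifP.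
have mft m : measurable_fun [set: R] (ft m).
  apply: (@measurable_fun_ifT _ _ _ _ f (cst 0) (fun x => `|f x| <= m%:R)) => //.
  by apply: measurable_fun_ler; [exact: measurable_fun_norm|exact: measurable_cst].
have ftb m : bsupp a m%:R (ft m).
  split => //; last exact: supE (ftE m).
  by move=> x; rewrite /ft; case: ifP => // _; rewrite normr0.
have ftf m x : ft m x ^+ 2 <= f x ^+ 2 by rewrite /ft; case: ifP => // _; rewrite expr0n sqr_ge0.
have dft m x : (f x - ft m x) ^+ 2 <= f x ^+ 2.
  by rewrite /ft; case: ifP => _; rewrite ?subr0// subrr expr0n sqr_ge0.
have cft x : (fun m => ft m x) @ \oo --> f x.
  apply: cvg_near_cst; exists (Num.trunc `|f x|).+1 => // m /= Nm.
  rewrite /ft ifT//; apply: (@le_trans _ _ (Num.trunc `|f x|).+1%:R); last by rewrite ler_nat.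
  by have /andP[_ /ltW] := truncn_itv (normr_ge0 (f x)).
have d0 (p : R -> R) : measurable_fun [set: R] p -> (forall x, 0 <= p x) ->
    itg (fun x => f x ^+ 2 * p x) ->
    [/\ forall m, itg (fun x => (f x - ft m x) ^+ 2 * p x) &
    forall eta, 0 < eta -> exists N, forall m, (N <= m)%N -> Int (fun x => (f x - ft m x) ^+ 2 * p x) <= eta].
  move=> mp p0 ip.
  have mF m : measurable_fun [set: R] (fun x => (f x - ft m x) ^+ 2 * p x) by have m1 := mft m; mfun.
  have F0 m x : `|(f x - ft m x) ^+ 2 * p x| <= f x ^+ 2 * p x.
    by rewrite (ger0_norm (mulr_ge0 (sqr_ge0 _) (p0 x))); apply: ler_wpM2r.
  split => [m|eta eta0]; first exact: (itg_le (mF m) ip (F0 m)).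
  have cv : {ae mu, forall x, (fun m => (f x - ft m x) ^+ 2 * p x) @ \oo --> (fun=> 0 : R) x}.
    apply: aeT => x; rewrite -(mul0r (p x)); apply: cvgM; last exact: cvg_cst.
    have h1 : (fun m => f x - ft m x) @ \oo --> 0.
      by rewrite -(subrr (f x)); apply: cvgB; [exact: cvg_cst|exact: cft].
    by rewrite -(mulr0 (0 : R)); apply: cvgM; exact: h1.
  have [_ c] := DCT mF (measurable_cst _) ip cv (fun m => aeT (F0 m)).
  move: c => /cvgrPdist_le/(_ _ eta0)[N _ HN]; exists N => m Nm.
  have := HN m Nm; rewrite Int0 sub0r normrN; exact: le_trans (ler_norm _).
have [dw DW] := d0 w mw w0 fw.
have f21 : itg (fun x => f x ^+ 2 * 1) by apply: eq_itg f2 => x; rewrite mulr1.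
have [d1 D1] := d0 (fun=> 1) (measurable_cst _) (fun=> ler01) f21.
have [h mh [h2 _ Hh Qh _]] := hilbert_L2 a0 fi f2 (supE _ fE).
exists h => //.
have ex_m m : exists hm : R -> R, measurable_fun [set: R] hm /\ itg (fun x => hm x ^+ 2) /\
    {ae mu, forall x, Qo (eps n) (ft m) x @[n --> \oo] --> hm x}.
  have [_ _ fa] := ftb m.
  have [hm mhm [hm2 _ _ Qhm _]] := hilbert_L2 a0 (bsupp_itg (ftb m)) (bsupp_itg (bsuppX 1 (ftb m))) fa.
  by exists hm.
have /choice[hm Hm] := ex_m.
have mhm m : measurable_fun [set: R] (hm m) by have [] := Hm m.
have hm2 m : itg (fun x => hm m x ^+ 2) by have [_ []] := Hm m.
have Qhm m : {ae mu, forall x, Qo (eps n) (ft m) x @[n --> \oo] --> hm m x} by have [_ []] := Hm m.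
have QB n g g' x : itg g -> itg g' -> Qo (eps n) (fun t => g t - g' t) x = Qo (eps n) g x - Qo (eps n) g' x.
  by move=> ig ig'; exact: (cvB (mQ (@eps_gt0 R n)) (CB (@eps_gt0 R n)) x ig ig').
have i21 m : itg (fun x => (f x - ft m x) ^+ 2) by apply: eq_itg (d1 m) => x; rewrite mulr1.
(* [h - hm m] is almost everywhere the transform of [f - ft m], both being limits of the linear
   [Qo (eps n)]. *)
have hd m : Int (fun x => (h x - hm m x) ^+ 2) <= Int (fun x => (f x - ft m x) ^+ 2).
  have ig : itg (fun x => f x - ft m x) := itgB fi (bsupp_itg (ftb m)).
  have gs : supp a (fun x => f x - ft m x) by apply: supE => x xE; rewrite fE// ftE// subrr.
  have [h' mh' [_ le _ Qh' _]] := hilbert_L2 a0 ig (i21 m) gs.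
  apply: le_trans le; rewrite le_eqVlt; apply/orP; left; apply/eqP.
  have mhmm := mhm m; apply: ae_Int; [by mfun|by mfun|].
  have A1 := aeS2 (fun x (u : Qo (eps n) f x @[n --> \oo] --> h x)
    (v : Qo (eps n) (ft m) x @[n --> \oo] --> hm m x) => conj u v) Qh (Qhm m).
  apply: aeS2 A1 Qh' => x [c1 c2] c3.
  have c4 : Qo (eps n) (fun x => f x - ft m x) x @[n --> \oo] --> h x - hm m x.
    rewrite (_ : (fun n => _) = fun n => Qo (eps n) f x - Qo (eps n) (ft m) x).
      by apply: cvgB; [exact: c1|exact: c2].
    by apply/funext => n; exact: (QB n f (ft m) x fi (bsupp_itg (ftb m))).
  by congr (_ ^+ 2); exact: (cvg_unique (@Rhausdorff R) c4 c3).
have i2h m : itg (fun x => (h x - hm m x) ^+ 2) := itg_sqrB mh (mhm m) h2 (hm2 m).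
have iD m n : itg (fun x => ((h x - hm m x) - (h x - hm n x)) ^+ 2).
  by have m1 := mhm m; have m2 := mhm n; apply: itg_sqrB; [mfun|mfun|exact: i2h|exact: i2h].
have smallh eta : 0 < eta -> exists N, forall m, (N <= m)%N -> Int (fun x => (h x - hm m x) ^+ 2) <= eta.
  move=> eta0; have [N HN] := D1 _ eta0; exists N => m Nm; apply: (le_trans (hd m)).
  by apply: le_trans (HN m Nm); rewrite le_eqVlt; apply/orP; left; apply/eqP; apply: eq_Int => x; rewrite mulr1.
have dsq (y z : R) : (y - z) ^+ 2 <= 2 * y ^+ 2 + 2 * z ^+ 2.
  by have := sqr_ge0 (y + z); rewrite !expr2; nra.
have [phi [h' mh' [phin ch']]] := @L2_ae_subseq R (fun m x => h x - hm m x)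
  (fun m => measurable_funB mh (mhm m)) iD ltac:(
  move=> eta eta0; have [N HN] := smallh _ (divr_gt0 eta0 (ltr0n R 4)); exists N => m n Nm Nn;
  apply: (le_trans (Int_le (iD m n) (itgD (itgZ 2 (i2h m)) (itgZ 2 (i2h n))) (fun x => dsq _ _)));
  rewrite (IntD (itgZ 2 (i2h m)) (itgZ 2 (i2h n))) (IntZ _ (i2h m)) (IntZ _ (i2h n));
  have := HN m Nm; have := HN n Nn; move: (Int _) (Int _) => A B; lra).
have h'0 : {ae mu, forall x, h' x = 0}.
  have h'le eta : 0 < eta -> itg (fun x => h' x ^+ 2) /\ Int (fun x => h' x ^+ 2) <= eta.
    move=> eta0; have [N HN] := smallh _ eta0.
    apply: (@Fatou_Int R (fun n x => (h x - hm (phi (n + N)%N) x) ^+ 2)).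
    - by move=> n; exact: i2h.
    - by move=> n x; exact: sqr_ge0.
    - by mfun.
    - by move=> x; exact: sqr_ge0.
    - apply: aeS ch' => x c.
      have c' : (fun n => h x - hm (phi (n + N)%N) x) @ \oo --> h' x.
        by move: c; rewrite -(cvg_shiftn N).
      by apply: cvgM; exact: c'.
    - by move=> n; apply: HN; apply: leq_trans (phin _); exact: leq_addl.
  have ih' := (h'le 1 ltr01).1.
  have I0 : Int (fun x => h' x ^+ 2) = 0.
    apply/eqP; rewrite eq_le (Int_ge0 (fun x => sqr_ge0 (h' x))) andbT.
    by apply/ler_addgt0Pr => eta eta0; rewrite add0r; exact: (h'le _ eta0).2.
  by apply: aeS (Int_eq0_ae ih' (fun x => sqr_ge0 _) I0) => x /eqP; rewrite sqrf_eq0 => /eqP.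
pose H n := hm (phi n).
have cH : {ae mu, forall x, H n x @[n --> \oo] --> h x}.
  apply: aeS2 h'0 ch' => x h'x c; rewrite h'x in c.
  have c2 : (fun n => h x - (h x - hm (phi n) x)) @ \oo --> h x - 0.
    by apply: cvgB; [exact: cvg_cst|exact: c].
  rewrite subr0 in c2.
  suff -> : (fun n => H n x) = fun n => h x - (h x - hm (phi n) x) by exact: c2.
  by apply/funext => n; rewrite /H subKr.
(* The identity for bounded functions is used on a difference of truncations, which makes the
   transform isometric on the sequence. *)
have diffE n m : itg (fun x => (H n x - H m x) ^+ 2 * w x) /\
    Int (fun x => (H n x - H m x) ^+ 2 * w x) = Int (fun x => (ft (phi n) x - ft (phi m) x) ^+ 2 * w x).
  have b1 := ftb (phi n); have b2 := ftb (phi m).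
  have db : bsupp a ((phi n)%:R + (phi m)%:R) (fun x => ft (phi n) x - ft (phi m) x).
    have [m1 B1 _] := b1; have [m2 B2 _] := b2; split; first by mfun.
      by move=> x; apply: (le_trans (ler_normB _ _)); exact: lerD.
    by apply: supE => x xE; rewrite !ftE// subrr.
  have dE x : ~ E x -> ft (phi n) x - ft (phi m) x = 0 by move=> xE; rewrite !ftE// subrr.
  have mH : measurable_fun [set: R] (fun x => H n x - H m x) := measurable_funB (mhm _) (mhm _).
  have cc : {ae mu, forall x, Qo (eps j) (fun x => ft (phi n) x - ft (phi m) x) x @[j --> \oo] --> H n x - H m x}.
    apply: aeS2 (Qhm (phi n)) (Qhm (phi m)) => x c1 c2.
    rewrite (_ : (fun j => _) = fun j => Qo (eps j) (ft (phi n)) x - Qo (eps j) (ft (phi m)) x).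
      by apply: cvgB; [exact: c1|exact: c2].
    by apply/funext => j; exact: (QB j _ _ x (bsupp_itg b1) (bsupp_itg b2)).
  by have [? ? _] := bounded_identity db dE mH cc.
have iHH n m : itg (fun x => (H n x - H m x) ^+ 2 * w x) := (diffE n m).1.
have DWphi eta : 0 < eta -> exists N, forall n, (N <= n)%N ->
    itg (fun x => (ft (phi n) x - f x) ^+ 2 * w x) /\ Int (fun x => (ft (phi n) x - f x) ^+ 2 * w x) <= eta.
  move=> eta0; have [N HN] := DW _ eta0; exists N => n Nn.
  have E1 x : (f x - ft (phi n) x) ^+ 2 * w x = (ft (phi n) x - f x) ^+ 2 * w x by rewrite -sqrrN opprB.
  split; first exact: (eq_itg E1 (dw _)).
  by rewrite -(eq_Int E1); apply: HN; exact: leq_trans (phin n).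
have HC eta : 0 < eta -> exists N, forall n m, (N <= n)%N -> (N <= m)%N ->
    Int (fun x => (H n x - H m x) ^+ 2 * w x) <= eta.
  move=> eta0; have [N HN] := DWphi _ (divr_gt0 eta0 (ltr0n R 4)).
  exists N => n m Nn Nm; have [i1 I1] := HN n Nn; have [i2 I2] := HN m Nm.
  rewrite (diffE n m).2.
  have key x : (ft (phi n) x - ft (phi m) x) ^+ 2 * w x <=
      2 * ((ft (phi n) x - f x) ^+ 2 * w x) + 2 * ((ft (phi m) x - f x) ^+ 2 * w x).
    have h1 := ler_wpM2r (w0 x) (dsq (ft (phi n) x - f x) (ft (phi m) x - f x)).
    have E1 : (ft (phi n) x - f x) - (ft (phi m) x - f x) = ft (phi n) x - ft (phi m) x by ring.
    rewrite E1 in h1; apply: (le_trans h1); rewrite le_eqVlt; apply/orP; left; apply/eqP; ring.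
  have i3 : itg (fun x => (ft (phi n) x - ft (phi m) x) ^+ 2 * w x).
    have m1 := mft (phi n); have m2 := mft (phi m).
    apply: (itg_le _ (itgD (itgZ 2 i1) (itgZ 2 i2))); first by mfun.
    by move=> x; rewrite (ger0_norm (mulr_ge0 (sqr_ge0 _) (w0 x))).
  apply: (le_trans (Int_le i3 (itgD (itgZ 2 i1) (itgZ 2 i2)) key)).
  rewrite (IntD (itgZ 2 i1) (itgZ 2 i2)) (IntZ _ i1) (IntZ _ i2).
  by move: (Int _) (Int _) I1 I2 => A B; lra.
have F := L2w_Fatou mw w0 (fun n => mhm (phi n)) mh iHH cH HC.
have ident n := bounded_identity (ftb (phi n)) (ftE (phi n)) (mhm (phi n)) (Qhm (phi n)).
have [N0 HN0] := F 1 ltr01; have [iN _] := HN0 N0 (leqnn _).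
have ih : itg (fun x => h x ^+ 2 * w x).
  have E1 x : (H N0 x - h x) ^+ 2 * w x = (h x - H N0 x) ^+ 2 * w x by rewrite -sqrrN opprB.
  have [i0 _ _] := ident N0.
  exact: (L2w_itg mw w0 mh (mhm _) (eq_itg E1 iN) i0).
have w1 x : `|w x| <= 1 * w x by rewrite mul1r ger0_norm.
have mwx : measurable_fun [set: R] (fun x => w x * x) by mfun.
have lim_eq v A : 0 <= A -> measurable_fun [set: R] v -> (forall x, `|v x| <= A * w x) ->
    (forall n, Int (fun x => H n x ^+ 2 * v x) = Int (fun x => ft (phi n) x ^+ 2 * v x)) ->
    Int (fun x => h x ^+ 2 * v x) = Int (fun x => f x ^+ 2 * v x).
  move=> A0 mv vA En.
  have c1 := L2w_cvg mw w0 A0 (fun n => mhm (phi n)) mh mv vA ih F.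
  have c2 := L2w_cvg mw w0 A0 (fun n => mft (phi n)) mf mv vA fw DWphi.
  have E1 : (fun n => Int (fun x => H n x ^+ 2 * v x)) = fun n => Int (fun x => ft (phi n) x ^+ 2 * v x).
    by apply/funext => n; exact: En.
  have c1' : (fun n => Int (fun x => H n x ^+ 2 * v x)) @ \oo --> Int (fun x => h x ^+ 2 * v x) := c1.
  by rewrite E1 in c1'; exact: (cvg_unique (@Rhausdorff R) c1' c2).
have En1 n : Int (fun x => H n x ^+ 2 * w x) = Int (fun x => ft (phi n) x ^+ 2 * w x).
  by have [_ e1 _] := ident n; exact: e1.
have En2 n : Int (fun x => H n x ^+ 2 * (w x * x)) = Int (fun x => ft (phi n) x ^+ 2 * (w x * x)).
  by have [_ _ e1] := ident n; exact: e1.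
split; [exact: Hh|exact: ih| |].
- exact: (lim_eq w 1 ler01 mw w1 En1).
- exact: (lim_eq _ a a0 mwx wx_le En2).
Qed.
End Identity.

(** * Exponents, real and imaginary parts, and the conclusion *)

Section Final.
Context {R : realType}.
Notation mu := (@lebesgue_measure R).
Local Notation Qo e := (cv (Conj e)).
Implicit Types (f g h u v w : R -> R) (x y z a p q : R).

Lemma conj_exponent p q : 4 < p -> 2 / p + 1 / q = 1 ->
  [/\ 1 < q, q - 1 = 2 / (p - 2) & exists2 k, (0 < k)%N & 1 <= (q - 1) * (2 ^ k).-1%:R].
Proof.
move=> p4 pq; have p0 : 0 < p by lra.
have p2 : 0 < p - 2 by lra.
(* With [q = 0] the convention [1 / 0 = 0] would turn the relation into [p = 2]. *)
have q0 : q != 0.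
  apply/eqP => q0; move: pq; rewrite q0 invr0 mulr0 addr0 => h.
  have : p = 2 by have := divfK (lt0r_neq0 p0) 2; rewrite h mul1r.
  by lra.
have qE : q - 1 = 2 / (p - 2).
  have h : 1 / q = (p - 2) / p by rewrite -[LHS](addKr (2 / p)) pq; field; rewrite gt_eqF.
  have -> : q = p / (p - 2) by rewrite -[q]invrK -[q^-1]mul1r h invf_div.
  by field; rewrite gt_eqF.
have q1 : 0 < q - 1 by rewrite qE divr_gt0.
split => //; first by rewrite -subr_gt0.
(* [m] exceeds [1 / (q - 1)], and [2 ^ m.+1 - 1 >= m]. *)
pose m := (Num.trunc (q - 1)^-1).+1; exists m.+1 => //.
have h : (q - 1)^-1 <= m%:R.
  have i0 : 0 <= (q - 1)^-1 by rewrite invr_ge0 ltW.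
  by have /andP[_ /ltW] := truncn_itv i0.
have hm : (m <= (2 ^ m.+1).-1)%N by have := ltn_expl m.+1 (isT : (1 < 2)%N); lia.
rewrite mulrC -ler_pdivrMr// mul1r (le_trans h)// ler_nat//.
Qed.

(** The exponents [p / 2] and [q] are conjugate; comparing [z] with [y ^ (p - 2)] shows which term
    on the right suffices. *)
Lemma young_le (p q y z : R) : 4 < p -> q - 1 = 2 / (p - 2) -> 0 <= y -> 0 <= z ->
  y ^+ 2 * z <= y `^ p + z `^ q.
Proof.
move=> p4 qE y0 z0; have p2 : 0 < p - 2 by lra.
have q1 : 0 < q - 1 by rewrite qE divr_gt0.
have yp : y `^ 2 = y ^+ 2 by rewrite powR_mulrn.
have [zy|yz] := leP z (y `^ (p - 2)).
  apply: (@le_trans _ _ (y `^ p)); last by rewrite lerDl powR_ge0.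
  have -> : y `^ p = y `^ 2 * y `^ (p - 2).
    rewrite -powRD; first by congr powR; ring.
    by apply/implyP => /eqP h; exfalso; lra.
  by rewrite yp ler_wpM2l ?sqr_ge0.
have zp : 0 < z by exact: le_lt_trans (powR_ge0 _ _) yz.
apply: (@le_trans _ _ (z `^ q)); last by rewrite lerDr powR_ge0.
have -> : z `^ q = z `^ (q - 1) * z.
  rewrite -{3}[z]powRr1// -powRD ?subrK//.
  by apply/implyP => _; rewrite gt_eqF.
apply: ler_wpM2r => //; rewrite -yp qE.
have -> : y `^ 2 = (y `^ (p - 2)) `^ (2 / (p - 2)).
  by rewrite -powRrM mulrC divfK// gt_eqF.
by rewrite ge0_ler_powR ?nnegrE ?powR_ge0 ?divr_ge0 ?(ltW p2)// ltW.
Qed.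

Lemma powR_dominates (p y c : R) (n : nat) : n%:R <= p -> `|y| <= c -> `|y| ^+ n <= 1 + c `^ p.
Proof.
move=> np yc; have [y1|y1] := leP `|y| 1.
  by apply: (@le_trans _ _ 1); [exact: exprn_ile1|rewrite lerDl powR_ge0].
have c1 : 1 <= c by exact: le_trans (ltW y1) yc.
have c0 : 0 <= c by exact: le_trans c1.
apply: (@le_trans _ _ (c `^ p)); last by rewrite lerDr.
apply: (@le_trans _ _ (c ^+ n)); first by rewrite lerXn2r ?nnegrE.
by rewrite -powR_mulrn// ler_powR.
Qed.

(** Every truncated integral is unchanged, so the transforms agree at each [x]. This allows a
    function vanishing almost everywhere off [E] to be replaced by its restriction. *)
Lemma ae_eq_hilbert f g x : {ae mu, forall t, f t = g t} -> hilbert f x = hilbert g x.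
Proof.
move=> [N [mN N0 fgN]].
suff E1 : (fun e => trunc_hilbert f e x) = fun e => trunc_hilbert g e x by rewrite /hilbert E1.
apply/funext => e; rewrite /trunc_hilbert; congr (_ * _); rewrite /Rintegral; congr fine.
rewrite integral_mkcond [RHS]integral_mkcond.
apply: (@integral_null_eq _ _ R mu N) => // t tN; rewrite !patchE; case: ifP => // _.
by congr (_ / _)%:E; apply: contrapT => h; apply: tN; exact: fgN.
Qed.

Lemma cmod_sqr (z : R[i]) : cmod z ^+ 2 = complex.Re z ^+ 2 + complex.Im z ^+ 2.
Proof. by case: z => u v; rewrite /cmod /= sqr_sqrtr// addr_ge0 ?sqr_ge0. Qed.

Lemma cmod_ge0 (z : R[i]) : 0 <= cmod z.
Proof. by case: z => u v; rewrite /cmod /= sqrtr_ge0. Qed.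

Lemma Re_le_cmod (z : R[i]) : `|complex.Re z| <= cmod z /\ `|complex.Im z| <= cmod z.
Proof.
have h := cmod_sqr z; have c0 := cmod_ge0 z.
have key (y : R) : y ^+ 2 <= cmod z ^+ 2 -> `|y| <= cmod z.
  by move=> yz; rewrite -(@ler_pXn2r _ 2) ?nnegrE// real_normK// num_real.
by split; apply: key; rewrite h ?lerDl ?lerDr sqr_ge0.
Qed.

Lemma compact_abs_bounded (E : set R) : compact E -> exists2 a, 0 <= a & forall x, E x -> `|x| <= a.
Proof.
move=> /compact_bounded[M [_ HM]]; exists (`|M| + 1); first by rewrite addr_ge0.
by move=> x Ex; apply: HM => //; rewrite (le_lt_trans (ler_norm _))// ltrDl.
Qed.

(** Meant for the real and the imaginary part, with the modulus as common majorant [c]; [h] is a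
    well-behaved stand-in for [hilbert u]. *)
Lemma weighted_component (E : set R) w u c p q : 4 < p -> 2 / p + 1 / q = 1 -> compact E ->
  equilibrium_density E w -> (w : measurableTypeR R -> R) \in Lfun lebesgue_measure q%:E ->
  measurable_fun [set: R] u -> itg (fun x => c x `^ p) -> (forall x, `|u x| <= c x) ->
  {ae mu, forall x, ~ E x -> u x = 0} ->
  exists h : R -> R, [/\ {ae mu, forall x, hilbert u x = h x},
    itg (fun x => h x ^+ 2 * w x) /\ itg (fun x => u x ^+ 2 * w x),
    itg (fun x => h x ^+ 2 * w x * x) /\ itg (fun x => u x ^+ 2 * w x * x),
    Int (fun x => h x ^+ 2 * w x) = Int (fun x => u x ^+ 2 * w x) &
    Int (fun x => h x ^+ 2 * w x * x) = Int (fun x => u x ^+ 2 * w x * x)].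
Proof.
move=> p4 pq cE wE wL mu_ ci uc uE.
have [q1 qE [k k0 kq]] := conj_exponent p4 pq.
have [nu [_ mw w0 nuE wE0]] := wE.
have [a a0 Ea] := compact_abs_bounded cE.
have mE : measurable E by exact: compact_measurable.
have wi : itg w.
  apply: (ge0_itg mw w0); rewrite -nuE; last exact: measurableT.
  by apply: le_lt_trans (probability_le1 _ _) (ltry _); exact: measurableT.
have wq : itg (fun x => w x `^ q).
  have := Lfun_integrable (ltW q1) wL; rewrite itgE; congr (_.-integrable _ _).
  by apply/funext => x /=; rewrite ger0_norm.
have [cst Uc] := equilibrium_potential mw w0 wi wq k0 kq a0 mE Ea wE.
have Z := Qo_weight_cvg0 mw w0 wi wq k0 kq a0 mE Ea wE0 Uc.
have wa x : a < `|x| -> w x = 0 by move=> xa; apply: wE0 => /Ea; rewrite leNgt xa.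
pose u1 := u \_ E.
have u1E x : E x -> u1 x = u x by move=> xE; rewrite /u1 patchE mem_set.
have u10 x : ~ E x -> u1 x = 0 by move=> xE; rewrite /u1 patchE memNset.
have mu1 : measurable_fun [set: R] u1.
  by apply/(measurable_restrictT _ _).1 => //; exact: measurable_funTS.
have u1c x : `|u1 x| <= c x.
  have [xE|xE] := pselect (E x); first by rewrite u1E.
  by rewrite u10// normr0 (le_trans _ (uc x)).
have dom := itgD (itg_near_ball 0 (a + 1)) ci.
have dom_le n x : n.+1%:R <= p -> `|u1 x| ^+ n.+1 <= near_ball 0 (a + 1) x + c x `^ p.
  move=> np; rewrite near_ballE sub0r normrN.
  have [xE|xE] := pselect (E x); last by rewrite u10// normr0 expr0n/= addr_ge0// powR_ge0.
  by rewrite (le_lt_trans (Ea x xE)) ?ltrDl//; exact: powR_dominates.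
have u1i : itg u1.
  by apply: (itg_le mu1 dom) => x; apply: (dom_le 0%N); lra.
have u12 : itg (fun x => u1 x ^+ 2).
  by apply: (itg_le _ dom) => [|x]; [mfun|rewrite normrX; apply: (dom_le 1%N); lra].
have u1w : itg (fun x => u1 x ^+ 2 * w x).
  apply: (itg_le _ (itgD ci wq)) => [|x]; first by mfun.
  rewrite (ger0_norm (mulr_ge0 (sqr_ge0 _) (w0 x))) -(real_normK (num_real (u1 x))).
  have c0 : 0 <= c x by exact: le_trans (uc x).
  apply: le_trans (young_le p4 qE c0 (w0 x)); apply: ler_wpM2r => //.
  by rewrite lerXn2r ?nnegrE.
have [h mh [Hh ih I1 I2]] := hilbert_weighted mw w0 wi wq k0 kq a0 wa Z Ea mu1 u1i u12 u10 u1w.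
have uu x : u1 x ^+ 2 * w x = u x ^+ 2 * w x.
  have [xE|xE] := pselect (E x); first by rewrite u1E.
  by rewrite wE0// !mulr0.
have uwi := eq_itg uu u1w.
have xi g : measurable_fun [set: R] g -> itg (fun x => g x ^+ 2 * w x) -> itg (fun x => g x ^+ 2 * w x * x).
  move=> mg ig; apply: (itg_le _ (itgZ a ig)); first by mfun.
  move=> x; rewrite normrM (ger0_norm (mulr_ge0 (sqr_ge0 _) (w0 x))) mulrC.
  have [xa|xa] := leP `|x| a; last by rewrite wa// !mulr0.
  by apply: ler_wpM2r => //; rewrite mulr_ge0 ?sqr_ge0.
exists h; split.
- apply: aeS Hh => x <-; apply: ae_eq_hilbert; apply: aeS uE => t ut.
  by have [tE|tE] := pselect (E t); [rewrite u1E|rewrite u10// ut].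
- by [].
- by split; apply: xi.
- by rewrite I1; exact: eq_Int.
- transitivity (Int (fun x => h x ^+ 2 * (w x * x))); first by apply: eq_Int => x; rewrite mulrA.
  by rewrite I2; apply: eq_Int => x; rewrite mulrA uu.
Qed.

End Final.

Theorem theorem4 (R : realType) (p q : R) (E : set R) (w : R -> R)
    (f : R -> R[i]) :
  4 < p ->
  2 / p + 1 / q = 1 ->
  compact E ->
  equilibrium_density E w ->
  (w : measurableTypeR R -> R) \in Lfun lebesgue_measure q%:E ->
  LfunC p%:E f ->
  {ae lebesgue_measure, forall x, ~ E x -> f x = 0} ->
  (\int[lebesgue_measure]_(y in E) (cmod (f y) ^+ 2 * w y)%:E =
   \int[lebesgue_measure]_(y in E) (cmod (hilbertC f y) ^+ 2 * w y)%:E)%E /\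
  (\int[lebesgue_measure]_(y in E) (cmod (f y) ^+ 2 * w y * y)%:E =
   \int[lebesgue_measure]_(y in E) (cmod (hilbertC f y) ^+ 2 * w y * y)%:E)%E.
Proof.
move=> p4 pq cE wE wL [mre mim fn] fE.
pose c x := cmod (f x); pose u x := complex.Re (f x); pose v x := complex.Im (f x).
have mu_ : measurable_fun [set: R] u by exact: mre.
have mv : measurable_fun [set: R] v by exact: mim.
have cs x : c x = Num.sqrt (u x ^+ 2 + v x ^+ 2).
  by rewrite /u /v -cmod_sqr sqrtr_sqr ger0_norm// cmod_ge0.
have mc : measurable_fun [set: R] c.
  rewrite (_ : c = fun x => Num.sqrt (u x ^+ 2 + v x ^+ 2)); last exact/funext.
  by apply: measurableT_comp; [apply: continuous_measurable_fun; exact: sqrt_continuous|mfun].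
have cL : (c : measurableTypeR R -> R) \in Lfun lebesgue_measure p%:E.
  by apply/andP; split; rewrite inE.
have ci : itg (fun x => c x `^ p).
  have p1 : 1 <= p by lra.
  have := Lfun_integrable p1 cL; rewrite itgE; congr (_.-integrable _ _).
  by apply/funext => x /=; rewrite ger0_norm// cmod_ge0.
have uE : {ae (@lebesgue_measure R), forall x, ~ E x -> u x = 0}.
  by apply: aeS fE => x h /h; rewrite /u => ->.
have vE : {ae (@lebesgue_measure R), forall x, ~ E x -> v x = 0}.
  by apply: aeS fE => x h /h; rewrite /v => ->.
have [h1 [H1 [ih1 iu] [ih1x iux] I1 J1]] := weighted_component p4 pq cE wE wL mu_ ci (fun x => (Re_le_cmod (f x)).1) uE.
have [h2 [H2 [ih2 iv] [ih2x ivx] I2 J2]] := weighted_component p4 pq cE wE wL mv ci (fun x => (Re_le_cmod (f x)).2) vE.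
have [nu [_ _ _ _ wE0]] := wE.
have HH := aeS2 (fun x (s : hilbert u x = h1 x) (t : hilbert v x = h2 x) => conj s t) H1 H2.
(* Off this null set the two transforms may be exchanged for [h1] and [h2], whose weighted squares
   are known to be integrable. *)
have [N [mN N0 HN]] := HH.
have offN x : ~ N x -> hilbert u x = h1 x /\ hilbert v x = h2 x.
  by move=> xN; apply: contrapT => h; apply: xN; exact: HN.
have fullE (F : R -> R) : (forall x, ~ E x -> F x = 0) ->
    (\int[lebesgue_measure]_(y in E) (F y)%:E = \int[lebesgue_measure]_y (F y)%:E)%E.
  move=> F0; rewrite integral_mkcond; apply: eq_integral => x _.
  by rewrite patchE; case: ifPn => // /negP xE; rewrite F0// => h; apply: xE; exact: mem_set.
have w0E (F : R -> R) x : ~ E x -> F x * w x = 0 by move=> /wE0 ->; rewrite mulr0.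
split.
- rewrite !fullE; [|by move=> x xE; rewrite wE0// mulr0|by move=> x xE; rewrite wE0// mulr0].
  transitivity ((Int (fun x => u x ^+ 2 * w x) + Int (fun x => v x ^+ 2 * w x))%:E).
    rewrite -(IntD iu iv) -(IntE (itgD iu iv)); apply: eq_integral => x _.
    by rewrite cmod_sqr mulrDl.
  rewrite -I1 -I2 -(IntD ih1 ih2) -(IntE (itgD ih1 ih2)).
  apply: (@integral_null_eq _ _ R lebesgue_measure N) => // x /offN[E1 E2].
  by rewrite cmod_sqr/= E1 E2 mulrDl.
- rewrite !fullE; [|by move=> x xE; rewrite wE0// mulr0 mul0r|by move=> x xE; rewrite wE0// mulr0 mul0r].
  transitivity ((Int (fun x => u x ^+ 2 * w x * x) + Int (fun x => v x ^+ 2 * w x * x))%:E).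
    rewrite -(IntD iux ivx) -(IntE (itgD iux ivx)); apply: eq_integral => x _.
    by rewrite cmod_sqr !mulrDl.
  rewrite -J1 -J2 -(IntD ih1x ih2x) -(IntE (itgD ih1x ih2x)).
  apply: (@integral_null_eq _ _ R lebesgue_measure N) => // x /offN[E1 E2].
  by rewrite cmod_sqr/= E1 E2 !mulrDl.
Qed.
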